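(* Suppose that $L$ is a complete filtered $\mathbb Z_2$-graded Lie algebra of finite type over the field $\mathfrak K$, with codifferential $d$. Then there is a miniversal deformation $\tilde d=d+\delta$ of $d$.
   Context: $\mathfrak K$ is a field of characteristic $0$. All spaces are $\mathbb Z_2$-graded $\mathfrak K$-vector spaces, with the usual sign conventions, and all subspaces of filtrations are graded subspaces. Filtered Lie algebras. A filtration on $F$ is a sequence of subspaces $F=F^0\supseteq F^1\supseteq\cdots$ with $\bigcap_nF^n=0$; it defines a topology with the $F^n$ as a basis of neighbourhoods of $0$. $F$ is complete if every Cauchy sequence converges, and of finite type if $\dim F^n/F^{n+1}<\infty$ for all $n$. A filtered $\mathbb Z_2$-graded Lie algebra is a $\mathbb Z_2$-graded Lie algebra $L$ with a filtration satisfying $[L^m,L^n]\subseteq L^{m+n}$ (the main example is the Lie algebra of coderivations of the symmetric or tensor coalgebra of $W$, $L=\prod_{n\ge1}\operatorname{Hom}(S^n(W),W)$ or $\prod_{n\ge1}\operatorname{Hom}(T^n(W),W)$, with $L^m=\prod_{i\ge m+1}L_i$, where $L_i$ is the $i$-th factor; codifferentials are then $L_\infty$, resp. $A_\infty$, structures). A codifferential is an odd $d\in L$ with $[d,d]=0$. Formal algebras. An augmented algebra is a $\mathbb Z_2$-graded commutative unital $\mathfrak K$-algebra $\mathcal A$ with a fixed augmentation $\mathcal A\to\mathfrak K$ with kernel $\mathfrak m$. A formal algebra is a complete local augmented algebra, $\mathcal A=\varprojlim_n\mathcal A/\mathfrak m^n$, where powers of $\mathfrak m$ are taken in the closed sense;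 precisely, $\mathcal A=\varprojlim_n\mathcal A_n$ for an inverse system of augmented algebras $\mathcal A_n$ with augmentation ideals $\mathfrak m_n$, with $\mathcal A_1=\mathfrak K$ and with surjective maps $\mathcal A_{n+1}\to\mathcal A_n$ of kernel $\mathfrak m_{n+1}^n$, and one writes $\mathcal A/\mathfrak m^n$ for $\mathcal A_n$. An infinitesimal algebra is a local augmented algebra with $\mathfrak m^2=0$; it is in particular formal. Morphisms of formal algebras are continuous unital (even) algebra homomorphisms compatible with the augmentations. Formal deformations. For a vector space $X$, $L\,\hat\otimes\,X=\varprojlim_n(L/L^n)\otimes X$. For a formal algebra $\mathcal A$, put $L_{\mathcal A}=\varprojlim_n L\,\hat\otimes\,(\mathcal A/\mathfrak m^n)$, a $\mathbb Z_2$-graded Lie algebra over $\mathcal A$, and let $L_{\mathfrak m}$ be the kernel of the projection $L_{\mathcal A}\to L$ induced by the augmentation, so $L_{\mathcal A}=L\oplus L_{\mathfrak m}$. A formal deformation of $d$ with base $\mathcal A$ is an odd $\tilde d=d+\delta\in L_{\mathcal A}$ with $\delta\in L_{\mathfrak m}$ and $[\tilde d,\tilde d]=0$. A morphism $f:\mathcal A\to\mathcal A'$ induces $f_*:L_{\mathcal A}\to L_{\mathcal A'}$, which sends formal deformations with base $\mathcal A$ to formal deformations with base $\mathcal A'$. Two formal deformations with base $\mathcal A$ are equivalent if one is carried to the other by an automorphism of $L_{\mathcal A}$ of the form $\exp(\operatorname{ad}\lambda)$ with $\lambda\in L_{\mathfrak m}$ even (when $L$ is the Lie algebra of coderivations of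 the symmetric or tensor coalgebra of $W$, these are exactly the automorphisms $\varphi\mapsto f^{-1}\circ\varphi\circ f$ induced by $\mathcal A$-coalgebra automorphisms $f$ of the coalgebra with scalars extended to $\mathcal A$ that reduce to the identity under the augmentation). Miniversality. A formal deformation $\tilde d$ of $d$ with base a formal algebra $\mathcal A$ is miniversal if (i) for every formal algebra $\mathcal A'$ and every formal deformation $\tilde d'$ of $d$ with base $\mathcal A'$ there is a morphism $f:\mathcal A\to\mathcal A'$ such that $f_*(\tilde d)$ is equivalent to $\tilde d'$; and (ii) when $\mathcal A'$ is infinitesimal, the morphism $f$ in (i) is unique. *)

(* Defs.v *)
From HB Require Import structures.
From mathcomp Require Import all_boot all_algebra.
From mathcomp Require Import sesquilinear.
From mathcomp Require Import boolp.
From mathcomp Require Import freeg.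

Set Implicit Arguments.
Unset Strict Implicit.
Unset Printing Implicit Defensive.

Import GRing.Theory.
Local Open Scope ring_scope.
Local Open Scope quotient_scope.

Section Quotient.
Variables (K : fieldType) (V : lmodType K) (U : submodClosed V).

Lemma submod_opp_closed : oppr_closed U.
Proof. by move=> x xU; rewrite -scaleN1r rpredZ. Qed.

Definition submod_zmod : zmodClosed V :=
  HB.pack (GRing.SubmodClosed.sort U)
    (GRing.isOppClosed.Build V (GRing.SubmodClosed.sort U) submod_opp_closed).

Definition quotm : Type := Quotient.quot submod_zmod.
HB.instance Definition _ := GRing.Zmodule.on quotm.

Definition qpi (x : V) : quotm := \pi_(Quotient.quot submod_zmod) x.
Definition qrepr (q : quotm) : V := repr (q : Quotient.quot submod_zmod).

Lemma qreprK q : qpi (qrepr q) = q.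
Proof. exact: reprK. Qed.

Lemma qpiP x y : reflect (qpi x = qpi y) (x - y \in U).
Proof.
rewrite [x - y \in U](Quotient.idealrBE submod_zmod).
exact: eqP.
Qed.

Lemma quotmW (P : quotm -> Prop) : (forall x, P (qpi x)) -> forall q, P q.
Proof. by move=> PP q; rewrite -(qreprK q). Qed.

Lemma qpiD x y : qpi (x + y) = qpi x + qpi y.
Proof. by rewrite /qpi raddfD. Qed.

Definition qscale (a : K) (q : quotm) : quotm := qpi (a *: qrepr q).

Lemma qscale_pi a x : qscale a (qpi x) = qpi (a *: x).
Proof. by apply/qpiP; rewrite -scalerBr rpredZ //; apply/qpiP; rewrite qreprK. Qed.

Fact qscaleA a b q : qscale a (qscale b q) = qscale (a * b) q.
Proof. by elim/quotmW: q => x; rewrite !qscale_pi scalerA. Qed.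
Fact qscale1 : left_id 1 qscale.
Proof. by elim/quotmW => x; rewrite qscale_pi scale1r. Qed.
Fact qscaleDr : right_distributive qscale +%R.
Proof.
move=> a; elim/quotmW => x; elim/quotmW => y.
by rewrite -qpiD !qscale_pi -qpiD scalerDr.
Qed.
Fact qscaleDl q : {morph qscale^~ q : a b / a + b}.
Proof. by move=> a b; elim/quotmW: q => x; rewrite !qscale_pi -qpiD scalerDl. Qed.

HB.instance Definition _ :=
  GRing.Zmodule_isLmodule.Build K quotm qscaleA qscale1 qscaleDr qscaleDl.

Fact qpi_linear : linear qpi.
Proof. by move=> a x y; rewrite qpiD -qscale_pi. Qed.
HB.instance Definition _ := GRing.isLinear.Build K V quotm *:%R qpi qpi_linear.

Section Lift.
Variables (W : lmodType K) (f : {linear V -> W}).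

Definition qlift (fU : forall x, x \in U -> f x = 0) (q : quotm) : W := f (qrepr q).

Hypothesis fU : forall x, x \in U -> f x = 0.

Lemma qliftE x : qlift fU (qpi x) = f x.
Proof.
apply/eqP; rewrite -subr_eq0 -linearB; apply/eqP/fU.
by apply/qpiP; rewrite qreprK.
Qed.

Fact qlift_linear : linear (qlift fU).
Proof.
move=> a; elim/quotmW => x; elim/quotmW => y.
by rewrite -linearP !qliftE linearP.
Qed.
HB.instance Definition _ :=
  GRing.isLinear.Build K quotm W *:%R (qlift fU) qlift_linear.

End Lift.
End Quotient.

Section Tensor.
Variables (K : fieldType) (V X : lmodType K).

Local Notation FVX := {freeg (V * X) / K}.

Definition tgen (v : V) (x : X) : FVX := << (v, x) >>.

(* the smallest subspace of the free vector space on V * X that contains the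
   bilinearity relations *)
Definition tens_rel : {pred FVX} := fun t =>
  `[< forall S : submodClosed FVX,
        (forall a v v' x,
           tgen (a *: v + v') x - (a *: tgen v x + tgen v' x) \in S) ->
        (forall a v x x',
           tgen v (a *: x + x') - (a *: tgen v x + tgen v x') \in S) ->
        t \in S >].

Fact tens_rel_closed : submod_closed tens_rel.
Proof.
split; first by apply/asboolP => S _ _; rewrite rpred0.
move=> a s t /asboolP sr /asboolP tr; apply/asboolP => S H1 H2.
by rewrite rpredD ?rpredZ ?sr ?tr.
Qed.

HB.instance Definition _ := GRing.isSubmodClosed.Build K FVX tens_rel tens_rel_closed.

Definition tensor : Type := quotm tens_rel.
HB.instance Definition _ := GRing.Lmodule.on tensor.

Definition tens (v : V) (x : X) : tensor := qpi tens_rel (tgen v x).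

Fact tens_bilinear : bilinear_for *:%R *:%R tens.
Proof.
split=> [x a v v'|v a x x'].
  rewrite /tens -linearP; apply/qpiP/asboolP => S H1 H2; exact: H1.
rewrite /tens -linearP; apply/qpiP/asboolP => S H1 H2; exact: H2.
Qed.
HB.instance Definition _ :=
  bilinear_isBilinear.Build K V X tensor *:%R *:%R tens tens_bilinear.

Lemma tensPl a v v' x : tens (a *: v + v') x = a *: tens v x + tens v' x.
Proof. exact: tens_bilinear.1. Qed.
Lemma tensPr v a x x' : tens v (a *: x + x') = a *: tens v x + tens v x'.
Proof. exact: tens_bilinear.2. Qed.
Lemma tensZr v a x : tens v (a *: x) = a *: tens v x.
Proof. exact: (scalable_linear (tens_bilinear.2 v)). Qed.
Lemma tensZl v a x : tens (a *: v) x = a *: tens v x.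
Proof. exact: (scalable_linear (tens_bilinear.1 x)). Qed.

Lemma tens_ind (P : tensor -> Prop) :
  P 0 -> (forall a v x t, P t -> P (a *: tens v x + t)) -> forall t, P t.
Proof.
move=> P0 PS; elim/quotmW => D.
rewrite -[D]freeg_sumE.
elim: (dom D) => [|[v x] s IH]; first by rewrite big_nil linear0.
rewrite big_cons; move: (coeff _ _) => a.
have -> : << a *g (v, x) >> = a *: tgen v x.
  apply/eqP/freeg_eqP => y; rewrite coeffZ !coeffU mul1r //.
by rewrite linearP; apply: PS.
Qed.

Lemma tens_eq (W : lmodType K) (f g : {linear tensor -> W}) :
  (forall v x, f (tens v x) = g (tens v x)) -> f =1 g.
Proof.
move=> fg; elim/tens_ind => [|a v x t IH]; first by rewrite !linear0.
by rewrite !linearP fg IH.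
Qed.

Section Lift.
Variables (W : lmodType K) (f : V -> X -> W).
Hypothesis fb : bilinear_for *:%R *:%R f.

Let f2 (vx : V * X) : W := f vx.1 vx.2.

Fact fgl_linear : linear (fglift f2 : FVX -> W).
Proof.
have addL := lift_is_additive f2.
pose g : {additive FVX -> W} :=
  HB.pack (fglift f2 : FVX -> W) (GRing.isZmodMorphism.Build FVX W (fglift f2) addL).
have gZ a D : g (a *: D) = a *: g D.
  rewrite -[D]freeg_sumE [a *: _]scaler_sumr !raddf_sum.
  apply: eq_bigr => z _.
  have -> : a *: << coeff z D *g z >> = << a * coeff z D *g z >> :> FVX.
    by apply/eqP/freeg_eqP => y; rewrite coeffZ !coeffU mulrA.
  by rewrite /g /= !liftU scalerA.
by move=> a D D'; rewrite -[fglift f2]/(g : _ -> _) raddfD gZ.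
Qed.

Definition fgl_lin : {linear FVX -> W} :=
  HB.pack (fglift f2 : FVX -> W)
    (GRing.isLinear.Build K FVX W *:%R (fglift f2) fgl_linear).

Lemma fgl_tgen v x : fgl_lin (tgen v x) = f v x.
Proof. by rewrite /= liftU scale1r. Qed.

Definition fgl_ker : {pred FVX} := fun t => fgl_lin t == 0.
Fact fgl_ker_closed : submod_closed fgl_ker.
Proof.
split; first by rewrite unfold_in linear0.
by move=> a s t /eqP s0 /eqP t0; rewrite unfold_in linearP s0 t0 scaler0 addr0.
Qed.
HB.instance Definition _ := GRing.isSubmodClosed.Build K FVX fgl_ker fgl_ker_closed.

Fact fgl_rel0 t : t \in tens_rel -> fgl_lin t = 0.
Proof.
move=> /asboolP /(_ fgl_ker) H; apply/eqP/H => [a v v' x|a v x x'].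
  by rewrite unfold_in linearB linearP !fgl_tgen fb.1 subrr.
by rewrite unfold_in linearB linearP !fgl_tgen fb.2 subrr.
Qed.

Definition tlift : tensor -> W := qlift fgl_rel0.
HB.instance Definition _ := GRing.Linear.on tlift.

Lemma tliftE v x : tlift (tens v x) = f v x.
Proof. by rewrite -fgl_tgen; apply: qliftE; exact: fgl_rel0. Qed.

End Lift.
End Tensor.

Section TensorMap.
Variables (K : fieldType) (V V' X X' : lmodType K).
Variables (g : {linear V -> V'}) (h : {linear X -> X'}).

Definition tmap_fun (v : V) (x : X) : tensor V' X' := tens (g v) (h x).
Fact tmap_fun_bilinear : bilinear_for *:%R *:%R tmap_fun.
Proof.
split=> [x a v v'|v a x x']; first by rewrite /tmap_fun linearP tensPl.
by rewrite /tmap_fun linearP tensPr.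
Qed.

Definition tmap : tensor V X -> tensor V' X' := tlift tmap_fun_bilinear.
HB.instance Definition _ := GRing.Linear.on tmap.

Lemma tmapE v x : tmap (tens v x) = tens (g v) (h x).
Proof. exact: tliftE. Qed.
Lemma tmapP a s t : tmap (a *: s + t) = a *: tmap s + tmap t.
Proof. exact: linearP. Qed.
Lemma tmapZ a t : tmap (a *: t) = a *: tmap t.
Proof. exact: linearZ. Qed.
Lemma tmap_sum I (r : seq I) (F : I -> tensor V X) :
  tmap (\sum_(i <- r) F i) = \sum_(i <- r) tmap (F i).
Proof. exact: linear_sum. Qed.
Lemma tmap0 : tmap 0 = 0.
Proof. exact: linear0. Qed.

End TensorMap.

Lemma tmap_eqr (K : fieldType) (V V' X X' : lmodType K)
    (g : {linear V -> V'}) (h h' : {linear X -> X'}) :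
  h =1 h' -> forall t, tmap g h t = tmap g h' t.
Proof.
move=> hE; elim/tens_ind => [|a v x t IH]; first by rewrite !tmap0.
by rewrite !tmapP IH !tmapE hE.
Qed.

Lemma tmap_comp (K : fieldType) (V X X1 X2 : lmodType K)
    (h1 : {linear X -> X1}) (h2 : {linear X1 -> X2}) (t : tensor V X) :
  tmap idfun h2 (tmap idfun h1 t) = tmap idfun (h2 \o h1) t.
Proof.
elim/tens_ind: t => [|a v x t IH]; first by rewrite !tmap0.
by rewrite !tmapP IH !tmapE.
Qed.

Lemma tmap_square (K : fieldType) (V V1 V2 V3 X X1 X2 X3 : lmodType K)
    (g1 : {linear V -> V1}) (h1 : {linear X -> X1})
    (g2 : {linear V1 -> V3}) (h2 : {linear X1 -> X3})
    (g1' : {linear V -> V2}) (h1' : {linear X -> X2})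
    (g2' : {linear V2 -> V3}) (h2' : {linear X2 -> X3}) :
  (forall v, g2 (g1 v) = g2' (g1' v)) -> (forall x, h2 (h1 x) = h2' (h1' x)) ->
  forall t, tmap g2 h2 (tmap g1 h1 t) = tmap g2' h2' (tmap g1' h1' t).
Proof.
move=> gE hE; elim/tens_ind => [|a v x t IH]; first by rewrite !tmap0.
by rewrite !tmapP IH !tmapE gE hE.
Qed.

Section InverseLimit.
Variables (K : fieldType) (T : nat -> lmodType K).
Variable p : forall n, {linear T n.+1 -> T n}.

Record invlim : Type := InvLim {
  coord :> forall n, T n;
  coordP : forall n, p n (coord n.+1) = coord n }.

Lemma invlim_eq (s t : invlim) : (forall n, s n = t n) -> s = t.
Proof.
case: s t => [s sP] [t tP] /= st.
have e : s = t by apply: functional_extensionality_dep.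
by case: t / e tP {st} => tP; rewrite (Prop_irrelevance sP tP).
Qed.

HB.instance Definition _ := gen_eqMixin invlim.
HB.instance Definition _ := gen_choiceMixin invlim.

Fact invlim0P n : p n (0 : T n.+1) = 0. Proof. exact: linear0. Qed.
Definition invlim0 : invlim := InvLim invlim0P.
Fact invlimNP (s : invlim) n : p n (- s n.+1) = - s n.
Proof. by rewrite linearN coordP. Qed.
Definition invlimN s : invlim := InvLim (invlimNP s).
Fact invlimDP (s t : invlim) n : p n (s n.+1 + t n.+1) = s n + t n.
Proof. by rewrite linearD !coordP. Qed.
Definition invlimD s t : invlim := InvLim (invlimDP s t).
Fact invlimZP a (s : invlim) n : p n (a *: s n.+1) = a *: s n.
Proof. by rewrite linearZ /= coordP. Qed.
Definition invlimZ a s : invlim := InvLim (invlimZP a s).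

Fact invlim_addA : associative invlimD.
Proof. by move=> s t u; apply: invlim_eq => n /=; rewrite addrA. Qed.
Fact invlim_addC : commutative invlimD.
Proof. by move=> s t; apply: invlim_eq => n /=; rewrite addrC. Qed.
Fact invlim_add0 : left_id invlim0 invlimD.
Proof. by move=> s; apply: invlim_eq => n /=; rewrite add0r. Qed.
Fact invlim_addN : left_inverse invlim0 invlimN invlimD.
Proof. by move=> s; apply: invlim_eq => n /=; rewrite addNr. Qed.
HB.instance Definition _ :=
  GRing.isZmodule.Build invlim invlim_addA invlim_addC invlim_add0 invlim_addN.

Fact invlim_scaleA a b s : invlimZ a (invlimZ b s) = invlimZ (a * b) s.
Proof. by apply: invlim_eq => n /=; rewrite scalerA. Qed.
Fact invlim_scale1 : left_id 1 invlimZ.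
Proof. by move=> s; apply: invlim_eq => n /=; rewrite scale1r. Qed.
Fact invlim_scaleDr : right_distributive invlimZ +%R.
Proof. by move=> a s t; apply: invlim_eq => n /=; rewrite scalerDr. Qed.
Fact invlim_scaleDl s : {morph invlimZ^~ s : a b / a + b}.
Proof. by move=> a b; apply: invlim_eq => n /=; rewrite scalerDl. Qed.
HB.instance Definition _ := GRing.Zmodule_isLmodule.Build K invlim
  invlim_scaleA invlim_scale1 invlim_scaleDr invlim_scaleDl.

Definition ilproj n (s : invlim) : T n := s n.
Fact ilproj_linear n : linear (ilproj n). Proof. by []. Qed.
HB.instance Definition _ n :=
  GRing.isLinear.Build K invlim (T n) *:%R (ilproj n) (ilproj_linear n).

End InverseLimit.

Lemma invlim_surj (K : fieldType) n :
  forall (T : nat -> lmodType K) (p : forall n, {linear T n.+1 -> T n}),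
  (forall n y, exists x, p n x = y) -> forall a : T n, exists s : invlim p, s n = a.
Proof.
elim: n => [|n IH] T p psurj a.
  pose lift m (y : T m) : T m.+1 := sval (cid (psurj m y)).
  pose u := nat_rect T a lift.
  have uP m : p m (u m.+1) = u m by rewrite /= /lift; case: cid.
  by exists (InvLim uP).
have [s sn] := IH (fun m => T m.+1) (fun m => p m.+1) (fun m => psurj m.+1) a.
pose u m : T m := match m with 0 => p 0 (s 0) | m'.+1 => s m' end.
have uP m : p m (u m.+1) = u m by case: m => [//|m]; exact: (coordP s m).
by exists (InvLim uP).
Qed.

Section InvLimMap.
Variables (K : fieldType) (T T' : nat -> lmodType K).
Variables (p : forall n, {linear T n.+1 -> T n}).
Variables (p' : forall n, {linear T' n.+1 -> T' n}).
Variable g : forall n, {linear T n -> T' n}.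
Hypothesis gP : forall n x, p' n (g n.+1 x) = g n (p n x).

Fact ilmap_subproof (s : invlim p) n : p' n (g n.+1 (s n.+1)) = g n (s n).
Proof. by rewrite gP coordP. Qed.
Definition ilmap (s : invlim p) : invlim p' := InvLim (ilmap_subproof s).
Fact ilmap_linear : linear ilmap.
Proof. by move=> a s t; apply: invlim_eq => n /=; rewrite linearP. Qed.
HB.instance Definition _ :=
  GRing.isLinear.Build K (invlim p) (invlim p') *:%R ilmap ilmap_linear.

End InvLimMap.

(* A grading is given by the two projections onto the even part (i = false)
   and the odd part (i = true); parities are added with (+). *)

Record z2grading (K : fieldType) (V : lmodType K) := Z2Grading {
  z2proj :> bool -> {linear V -> V};
  z2projD : forall v, z2proj false v + z2proj true v = v;
  z2projK : forall i j v, z2proj i (z2proj j v) = if i == j then z2proj j v else 0 }.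

Definition homog (K : fieldType) (V : lmodType K) (G : z2grading V) i (v : V) :=
  G i v = v.

Record gLie (K : fieldType) := GLie {
  gl_sort :> lmodType K;
  gl_gr : z2grading gl_sort;
  gl_br : {bilinear gl_sort -> gl_sort -> gl_sort};
  gl_br_homog : forall i j x y, homog gl_gr i x -> homog gl_gr j y ->
    homog gl_gr (i (+) j) (gl_br x y);
  gl_anti : forall i j x y, homog gl_gr i x -> homog gl_gr j y ->
    gl_br x y = - ((-1) ^+ (i && j) *: gl_br y x);
  gl_jacobi : forall i j x y z, homog gl_gr i x -> homog gl_gr j y ->
    gl_br x (gl_br y z)
      = gl_br (gl_br x y) z + (-1) ^+ (i && j) *: gl_br y (gl_br x z) }.

Record augAlg (K : fieldType) := AugAlg {
  aa_sort :> algType K;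
  aa_gr : z2grading aa_sort;
  aa_one_even : homog aa_gr false 1;
  aa_mul_homog : forall i j a b, homog aa_gr i a -> homog aa_gr j b ->
    homog aa_gr (i (+) j) (a * b);
  aa_comm : forall i j a b, homog aa_gr i a -> homog aa_gr j b ->
    a * b = (-1) ^+ (i && j) *: (b * a);
  aa_aug : {lrmorphism aa_sort -> K^o};
  aa_aug_odd : forall a, homog aa_gr true a -> aa_aug a = 0 }.

Definition aug (K : fieldType) (A : augAlg K) (a : A) : K := aa_aug A a.

(* the n-th power of the augmentation ideal, with m^0 the whole algebra *)
Fixpoint aug_pow (K : fieldType) (A : augAlg K) (n : nat) (a : A) : Prop :=
  if n is n'.+1 then
    exists s : seq (A * A),
      (forall xy, xy \in s -> aug xy.1 = 0 /\ aug_pow n' xy.2)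
      /\ a = \sum_(xy <- s) xy.1 * xy.2
  else True.

Record aug_mor (K : fieldType) (A B : augAlg K) := AugMor {
  am_fun :> {lrmorphism A -> B};
  am_even : forall i a, am_fun (aa_gr A i a) = aa_gr B i (am_fun a);
  am_aug : forall a, aug (am_fun a) = aug a }.

Section TensorLie.
Variables (K : fieldType) (Q : gLie K) (A : augAlg K).

Lemma gl_brPl c (x x' y : Q) :
  gl_br Q (c *: x + x') y = c *: gl_br Q x y + gl_br Q x' y.
Proof. exact: linearPl. Qed.
Lemma gl_brPr c (x y y' : Q) :
  gl_br Q x (c *: y + y') = c *: gl_br Q x y + gl_br Q x y'.
Proof. exact: linearPr. Qed.

(* [q (x) a, y (x) b] = (-1)^(|a||y|) [q, y] (x) ab, extended from homogeneous
   a and y by splitting both into their even and odd parts *)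
Definition tbr_pure (q : Q) (a : A) (y : Q) (b : A) : tensor Q A :=
  \sum_(i : bool) \sum_(j : bool)
    (-1) ^+ (i && j) *: tens (gl_br Q q (gl_gr Q j y)) (aa_gr A i a * b).

Fact sum2P (c : K) (f g h : bool -> bool -> tensor Q A) :
  (forall i j, f i j = c *: g i j + h i j) ->
  \sum_(i : bool) \sum_(j : bool) (-1) ^+ (i && j) *: f i j
  = c *: (\sum_(i : bool) \sum_(j : bool) (-1) ^+ (i && j) *: g i j)
    + \sum_(i : bool) \sum_(j : bool) (-1) ^+ (i && j) *: h i j.
Proof.
move=> fE; rewrite scaler_sumr -big_split; apply: eq_bigr => i _.
rewrite scaler_sumr -big_split; apply: eq_bigr => j _ /=.
by rewrite fE scalerDr !scalerA mulrC.
Qed.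

Fact tbr_pure_bil q a : bilinear_for *:%R *:%R (tbr_pure q a).
Proof.
split=> [b c y y'|y c b b']; apply: sum2P => i j.
  by rewrite linearP gl_brPr tensPl.
by rewrite mulrDr -scalerAr tensPr.
Qed.

Fact tbr_pure_l q q' c a y b :
  tbr_pure (c *: q + q') a y b = c *: tbr_pure q a y b + tbr_pure q' a y b.
Proof. by apply: sum2P => i j; rewrite gl_brPl tensPl. Qed.
Fact tbr_pure_r q c a a' y b :
  tbr_pure q (c *: a + a') y b = c *: tbr_pure q a y b + tbr_pure q a' y b.
Proof. by apply: sum2P => i j; rewrite linearP mulrDl -scalerAl tensPr. Qed.

Definition tbr_left (t : tensor Q A) (q : Q) (a : A) : tensor Q A :=
  tlift (tbr_pure_bil q a) t.

Fact tbr_leftP t c (x y z : tensor Q A -> tensor Q A) :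
    linear x -> linear y -> linear z ->
    (forall q a, x (tens q a) = c *: y (tens q a) + z (tens q a)) ->
  x t = c *: y t + z t.
Proof.
move=> xL yL zL xyz; elim/tens_ind: t => [|k q a t IH].
  have l0 (w : tensor Q A -> tensor Q A) : linear w -> w 0 = 0.
    by move=> wL; have := wL (-1) 0 0; rewrite scaler0 addr0 scaleN1r addNr.
  by rewrite (l0 _ xL) (l0 _ yL) (l0 _ zL) scaler0 addr0.
rewrite xL yL zL IH xyz !scalerDr addrACA !scalerA.
by rewrite [k * c]mulrC.
Qed.

Fact tbr_left_bil t : bilinear_for *:%R *:%R (tbr_left t).
Proof.
split=> [a c q q'|q c a a']; apply: tbr_leftP; try exact: linearP.
  by move=> y b; rewrite !tliftE tbr_pure_l.
by move=> y b; rewrite !tliftE tbr_pure_r.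
Qed.

Definition tbr (s t : tensor Q A) : tensor Q A := tlift (tbr_left_bil t) s.

Lemma tbrE q a y b : tbr (tens q a) (tens y b) = tbr_pure q a y b.
Proof. by rewrite /tbr tliftE /tbr_left tliftE. Qed.

Fact tbr_bil : bilinear_for *:%R *:%R tbr.
Proof.
split=> [t c s s'|s c t t']; first exact: linearP.
apply: (@tbr_leftP s c (tbr^~ (c *: t + t')) (tbr^~ t) (tbr^~ t')); try exact: linearP.
by move=> q a; rewrite /tbr !tliftE /tbr_left linearP.
Qed.

Lemma tbrPl t c s s' : tbr (c *: s + s') t = c *: tbr s t + tbr s' t.
Proof. exact: tbr_bil.1. Qed.
Lemma tbrPr s c t t' : tbr s (c *: t + t') = c *: tbr s t + tbr s t'.
Proof. exact: tbr_bil.2. Qed.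
Lemma tbr0l t : tbr 0 t = 0.
Proof. exact: linear0. Qed.
Lemma tbr0r s : tbr s 0 = 0.
Proof. by have := tbrPr s (-1) 0 0; rewrite scaler0 addr0 scaleN1r addNr. Qed.

(* the projections onto the even and odd parts of the total grading *)
Definition tgr (i : bool) (t : tensor Q A) : tensor Q A :=
  \sum_(j : bool) tmap (gl_gr Q j) (aa_gr A (i (+) j)) t.

End TensorLie.

Section TensorLieMap.
Variables (K : fieldType) (Q Q' : gLie K) (A A' : augAlg K).
Variables (g : {linear Q -> Q'}) (h : {linear A -> A'}).
Hypothesis g_gr : forall i x, g (gl_gr Q i x) = gl_gr Q' i (g x).
Hypothesis g_br : forall x y, g (gl_br Q x y) = gl_br Q' (g x) (g y).
Hypothesis h_gr : forall i a, h (aa_gr A i a) = aa_gr A' i (h a).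
Hypothesis h_mul : forall a b, h (a * b) = h a * h b.

Lemma tmap_tbr s t : tmap g h (tbr s t) = tbr (tmap g h s) (tmap g h t).
Proof.
elim/tens_ind: s => [|c q a s IHs]; first by rewrite tbr0l !tmap0 tbr0l.
rewrite tbrPl !tmapP tbrPl IHs; congr (_ *: _ + _) => {IHs}.
elim/tens_ind: t => [|k y b t IHt]; first by rewrite tbr0r !tmap0 tbr0r.
rewrite tbrPr !tmapP tbrPr IHt; congr (_ *: _ + _).
rewrite !tmapE !tbrE /tbr_pure tmap_sum; apply: eq_bigr => i _.
rewrite tmap_sum; apply: eq_bigr => j _.
by rewrite tmapZ tmapE g_br g_gr h_mul h_gr.
Qed.

End TensorLieMap.

Record filtLie (K : fieldType) := FiltLie {
  fl_lie :> gLie K;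
  fl_filt : nat -> submodClosed fl_lie;
  fl_filt0 : forall x, x \in fl_filt 0;
  fl_filtS : forall n x, x \in fl_filt n.+1 -> x \in fl_filt n;
  fl_filt_sep : forall x, (forall n, x \in fl_filt n) -> x = 0;
  fl_filt_gr : forall n i x, x \in fl_filt n -> gl_gr fl_lie i x \in fl_filt n;
  fl_filt_br : forall m n x y, x \in fl_filt m -> y \in fl_filt n ->
    gl_br fl_lie x y \in fl_filt (m + n) }.

Section FiltLieProps.
Variables (K : fieldType) (L : filtLie K).

Definition fl_complete := forall u : nat -> L,
  (forall n, exists N, forall i j, (N <= i)%N -> (N <= j)%N ->
    u i - u j \in fl_filt L n) ->
  exists x, forall n, exists N, forall i, (N <= i)%N -> u i - x \in fl_filt L n.

(* F^n is spanned modulo F^(n+1) by finitely many vectors b i *)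
Definition fl_finite_type := forall n, exists (m : nat) (b : 'I_m -> L),
  (forall i, b i \in fl_filt L n) /\
  forall x, x \in fl_filt L n ->
    exists c : 'I_m -> K, x - \sum_(i < m) c i *: b i \in fl_filt L n.+1.

Definition codifferential (d : L) := homog (gl_gr L) true d /\ gl_br L d d = 0.

End FiltLieProps.

Section QuotientLie.
Variables (K : fieldType) (L : filtLie K) (n : nat).
Local Notation U := (fl_filt L n).
Local Notation LU := (quotm U).

Fact qgr0 i x : x \in U -> (qpi U \o gl_gr L i) x = 0.
Proof.
move=> xU; rewrite -(linear0 (qpi U)); apply/qpiP.
by rewrite subr0 fl_filt_gr.
Qed.
Definition qgr i : LU -> LU := qlift (@qgr0 i).
HB.instance Definition _ i := GRing.Linear.on (qgr i).
Lemma qgrE i x : qgr i (qpi U x) = qpi U (gl_gr L i x).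
Proof. by apply: qliftE; exact: qgr0. Qed.

Fact qgrD v : qgr false v + qgr true v = v.
Proof. by elim/quotmW: v => x; rewrite !qgrE -linearD z2projD. Qed.
Fact qgrK i j v : qgr i (qgr j v) = if i == j then qgr j v else 0.
Proof.
elim/quotmW: v => x; rewrite !qgrE z2projK; case: eqP => // _.
exact: linear0.
Qed.
Definition quot_gr : z2grading LU := @Z2Grading K LU qgr qgrD qgrK.

Definition qbr (p q : LU) : LU := qpi U (gl_br L (qrepr p) (qrepr q)).
Lemma qbrE x y : qbr (qpi U x) (qpi U y) = qpi U (gl_br L x y).
Proof.
set x' := qrepr (qpi U x); set y' := qrepr (qpi U y).
have xx : x' - x \in U by apply/qpiP; rewrite qreprK.
have yy : y' - y \in U by apply/qpiP; rewrite qreprK.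
apply/qpiP.
have -> : gl_br L x' y' - gl_br L x y
    = gl_br L (x' - x) y' + gl_br L x (y' - y).
  by rewrite linearBl linearBr addrA subrK.
rewrite rpredD //.
  by have := fl_filt_br xx (fl_filt0 y'); rewrite addn0.
exact: (fl_filt_br (fl_filt0 x) yy).
Qed.
Fact qbr_bil : bilinear_for *:%R *:%R qbr.
Proof.
split=> [q a p p'|p a q q']; elim/quotmW: p => x; elim/quotmW: q => y.
  by elim/quotmW: p' => z; rewrite -linearP !qbrE -linearP linearPl.
by elim/quotmW: q' => z; rewrite -linearP !qbrE -linearP linearPr.
Qed.
Definition qbr_bilin : {bilinear LU -> LU -> LU} :=
  HB.pack qbr (bilinear_isBilinear.Build K LU LU LU *:%R *:%R qbr qbr_bil).

Lemma qbr_bilinE x y : qbr_bilin (qpi U x) (qpi U y) = qpi U (gl_br L x y).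
Proof. exact: qbrE. Qed.

Lemma qhomogP i (v : LU) : homog quot_gr i v ->
  exists2 x, homog (gl_gr L) i x & v = qpi U x.
Proof.
elim/quotmW: v => x; rewrite /homog -[quot_gr i _]/(qgr i _) qgrE => <-.
by exists (gl_gr L i x) => //; rewrite /homog z2projK eqxx.
Qed.

Fact qbr_homog i j p q : homog quot_gr i p -> homog quot_gr j q ->
  homog quot_gr (i (+) j) (qbr_bilin p q).
Proof.
move=> /qhomogP[x xi ->] /qhomogP[y yj ->].
by rewrite qbr_bilinE /homog [LHS]qgrE gl_br_homog.
Qed.
Fact qbr_anti i j p q : homog quot_gr i p -> homog quot_gr j q ->
  qbr_bilin p q = - ((-1) ^+ (i && j) *: qbr_bilin q p).
Proof.
move=> /qhomogP[x xi ->] /qhomogP[y yj ->].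
by rewrite !qbr_bilinE (gl_anti xi yj) linearN linearZ.
Qed.
Fact qbr_jacobi i j p q r : homog quot_gr i p -> homog quot_gr j q ->
  qbr_bilin p (qbr_bilin q r)
    = qbr_bilin (qbr_bilin p q) r + (-1) ^+ (i && j) *: qbr_bilin q (qbr_bilin p r).
Proof.
move=> /qhomogP[x xi ->] /qhomogP[y yj ->]; elim/quotmW: r => z.
by rewrite !qbr_bilinE (gl_jacobi _ xi yj) linearD linearZ.
Qed.
Definition quotLie : gLie K := GLie qbr_homog qbr_anti qbr_jacobi.

End QuotientLie.

Section QuotientTower.
Variables (K : fieldType) (L : filtLie K) (n : nat).

Fact qtr0 x : x \in fl_filt L n.+1 -> qpi (fl_filt L n) x = 0.
Proof.
move=> xU; rewrite -(linear0 (qpi (fl_filt L n))); apply/qpiP.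
by rewrite subr0 fl_filtS.
Qed.
Definition qtr : quotLie L n.+1 -> quotLie L n := qlift qtr0.
HB.instance Definition _ := GRing.Linear.on qtr.
Lemma qtrE x : qtr (qpi (fl_filt L n.+1) x) = qpi (fl_filt L n) x.
Proof. by apply: qliftE; exact: qtr0. Qed.
Lemma qtr_gr i x : qtr (gl_gr (quotLie L n.+1) i x) = gl_gr (quotLie L n) i (qtr x).
Proof. elim/quotmW: x => x.
by rewrite [gl_gr _ _ _]qgrE !qtrE; symmetry; exact: qgrE. Qed.
Lemma qtr_br x y :
  qtr (gl_br (quotLie L n.+1) x y) = gl_br (quotLie L n) (qtr x) (qtr y).
Proof.
elim/quotmW: x => x; elim/quotmW: y => y.
by rewrite [gl_br _ _ _]qbrE !qtrE; symmetry; exact: qbrE.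
Qed.
End QuotientTower.

Arguments qtr {K} L n x.

(* Completed tensor product L (x)^ X = lim_n (L / L^n) (x) X *)

Section CompletedTensor.
Variables (K : fieldType) (L : filtLie K).

Definition ctens_tr (X : lmodType K) (n : nat) :
    {linear tensor (quotLie L n.+1) X -> tensor (quotLie L n) X} :=
  tmap (qtr L n) idfun.

Definition ctens (X : lmodType K) : Type := invlim (ctens_tr X).
HB.instance Definition _ X := GRing.Lmodule.on (ctens X).

Variables (X Y : lmodType K) (g : {linear X -> Y}).

Fact ctmap_subproof n (t : tensor (quotLie L n.+1) X) :
  ctens_tr Y n (tmap idfun g t) = tmap idfun g (ctens_tr X n t).
Proof. exact: tmap_square. Qed.

Definition ctmap : ctens X -> ctens Y := ilmap ctmap_subproof.
HB.instance Definition _ := GRing.Linear.on ctmap.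

End CompletedTensor.

Arguments ctmap {K} L {X Y} g t.

(* A formal algebra is given by the tower of its quotients by the powers of the
   augmentation ideal; fa_lev A n stands for A / m^(n+1). *)

Record formalAlg (K : fieldType) := FormalAlg {
  fa_lev :> nat -> augAlg K;
  fa_tr : forall n, aug_mor (fa_lev n.+1) (fa_lev n);
  fa_lev0 : forall a : fa_lev 0, aug a = 0 -> a = 0;
  fa_surj : forall n (b : fa_lev n), exists a, fa_tr n a = b;
  fa_ker : forall n (a : fa_lev n.+1), fa_tr n a = 0 <-> aug_pow n.+1 a }.

Section FormalLimit.
Variables (K : fieldType) (A : formalAlg K).

Definition fa_tr_lin n : {linear A n.+1 -> A n} := fa_tr A n.

Definition flim_sort : Type :=
  @invlim K (fun n => A n : lmodType K) fa_tr_lin.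
HB.instance Definition _ := GRing.Lmodule.on flim_sort.

Fact flim_oneP n : fa_tr_lin n 1 = 1. Proof. exact: (rmorph1 (fa_tr A n)). Qed.
Definition flim_one : flim_sort := InvLim flim_oneP.
Fact flim_mulP (a b : flim_sort) n :
  fa_tr_lin n (coord a n.+1 * coord b n.+1) = coord a n * coord b n.
Proof.
rewrite -[coord a n]coordP -[coord b n]coordP.
exact: (rmorphM (fa_tr A n)).
Qed.
Definition flim_mul (a b : flim_sort) : flim_sort := InvLim (flim_mulP a b).

Fact flim_mulA : associative flim_mul.
Proof. by move=> a b c; apply: invlim_eq => n /=; rewrite mulrA. Qed.
Fact flim_mul1l : left_id flim_one flim_mul.
Proof. by move=> a; apply: invlim_eq => n /=; rewrite mul1r. Qed.
Fact flim_mul1r : right_id flim_one flim_mul.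
Proof. by move=> a; apply: invlim_eq => n /=; rewrite mulr1. Qed.
Fact flim_mulDl : left_distributive flim_mul +%R.
Proof. by move=> a b c; apply: invlim_eq => n /=; rewrite mulrDl. Qed.
Fact flim_mulDr : right_distributive flim_mul +%R.
Proof. by move=> a b c; apply: invlim_eq => n /=; rewrite mulrDr. Qed.
Fact flim_one_neq0 : flim_one != 0.
Proof.
apply/eqP => /(congr1 (fun a : flim_sort => coord a 0)) /= /eqP.
by rewrite oner_eq0.
Qed.
HB.instance Definition _ := GRing.Zmodule_isNzRing.Build flim_sort
  flim_mulA flim_mul1l flim_mul1r flim_mulDl flim_mulDr flim_one_neq0.

Fact flim_scaleAl (c : K) (a b : flim_sort) : c *: (a * b) = (c *: a) * b.
Proof. by apply: invlim_eq => n /=; rewrite scalerAl. Qed.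
HB.instance Definition _ := GRing.Lmodule_isLalgebra.Build K flim_sort flim_scaleAl.
Fact flim_scaleAr (c : K) (a b : flim_sort) : c *: (a * b) = a * (c *: b).
Proof. by apply: invlim_eq => n /=; rewrite scalerAr. Qed.
HB.instance Definition _ := GRing.Lalgebra_isAlgebra.Build K flim_sort flim_scaleAr.

Fact flim_gr_subproof i n (a : A n.+1) :
  fa_tr_lin n (aa_gr (A n.+1) i a) = aa_gr (A n) i (fa_tr_lin n a).
Proof. exact: (am_even (fa_tr A n)). Qed.
Definition flim_gr i : flim_sort -> flim_sort := ilmap (flim_gr_subproof i).
HB.instance Definition _ i := GRing.Linear.on (flim_gr i).
Fact flim_grD a : flim_gr false a + flim_gr true a = a.
Proof. by apply: invlim_eq => n; exact: z2projD. Qed.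
Fact flim_grK i j a : flim_gr i (flim_gr j a) = if i == j then flim_gr j a else 0.
Proof.
apply: invlim_eq => n; rewrite [LHS]z2projK; by case: eqP.
Qed.
Definition flim_grading : z2grading flim_sort :=
  @Z2Grading K flim_sort flim_gr flim_grD flim_grK.

Fact flim_homog i (a : flim_sort) :
  homog flim_grading i a -> forall n, homog (aa_gr (A n)) i (coord a n).
Proof. by move=> ai n; exact: (congr1 (fun b : flim_sort => coord b n) ai). Qed.

Fact flim_one_even : homog flim_grading false 1.
Proof. by apply: invlim_eq => n; exact: aa_one_even. Qed.
Fact flim_mul_homog i j (a b : flim_sort) :
  homog flim_grading i a -> homog flim_grading j b ->
  homog flim_grading (i (+) j) (a * b).
Proof.
move=> ai bj; apply: invlim_eq => n.
exact: aa_mul_homog (flim_homog ai n) (flim_homog bj n).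
Qed.
Fact flim_comm i j (a b : flim_sort) :
  homog flim_grading i a -> homog flim_grading j b ->
  a * b = (-1) ^+ (i && j) *: (b * a).
Proof.
move=> ai bj; apply: invlim_eq => n.
exact: aa_comm (flim_homog ai n) (flim_homog bj n).
Qed.

Definition flim_aug (a : flim_sort) : K^o := aa_aug (A 0) (coord a 0).
Fact flim_aug_linear : linear flim_aug.
Proof. by move=> c a b; rewrite /flim_aug -linearP. Qed.
Fact flim_aug_mul : monoid_morphism flim_aug.
Proof.
by split=> [|a b]; [exact: (rmorph1 (aa_aug (A 0)))|exact: (rmorphM (aa_aug (A 0)))].
Qed.
HB.instance Definition _ :=
  GRing.isLinear.Build K flim_sort K^o *:%R flim_aug flim_aug_linear.
HB.instance Definition _ :=
  GRing.isMonoidMorphism.Build flim_sort K^o flim_aug flim_aug_mul.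
Fact flim_aug_odd a : homog flim_grading true a -> flim_aug a = 0.
Proof. by move=> /flim_homog a1; exact: aa_aug_odd. Qed.

Definition flim : augAlg K :=
  @AugAlg K flim_sort flim_grading flim_one_even flim_mul_homog flim_comm
    flim_aug flim_aug_odd.

Definition flev n (a : flim) : A n := coord (a : flim_sort) n.

Lemma flev_surj n (a : A n) : exists b : flim, flev n b = a.
Proof. exact: (@invlim_surj K n (fun n => A n : lmodType K) fa_tr_lin (@fa_surj _ A) a). Qed.

Lemma flev_tr n (a : flim) : fa_tr A n (flev n.+1 a) = flev n a.
Proof. exact: (coordP (a : flim_sort)). Qed.

Lemma flev0_le m n (a : flim) : (n <= m)%N -> flev m a = 0 -> flev n a = 0.
Proof.
move=> /subnK <-; elim: (m - n)%N => [//|k IH]; rewrite addSn => a0.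
by apply: IH; rewrite -flev_tr a0 (raddf0 (fa_tr A _)).
Qed.

Definition infinitesimal := forall a b : flim, aug a = 0 -> aug b = 0 -> a * b = 0.

End FormalLimit.

(* fm_cont is continuity for the inverse limit topologies. *)
Record formal_mor (K : fieldType) (A B : formalAlg K) := FormalMor {
  fm_mor :> aug_mor (flim A) (flim B);
  fm_cont : forall k, exists n, forall a : flim A, flev n a = 0 -> flev k (fm_mor a) = 0 }.

(* L_A = lim_k L (x)^ (A / m^k) *)

Section ScalarExtension.
Variables (K : fieldType) (L : filtLie K).

Definition LA_tr (A : formalAlg K) (k : nat) :
    {linear ctens L (A k.+1) -> ctens L (A k)} :=
  ctmap L (fa_tr_lin A k).

Definition LA (A : formalAlg K) : Type :=
  @invlim K (fun k => ctens L (A k)) (LA_tr A).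
HB.instance Definition _ A := GRing.Lmodule.on (LA A).

Variable A : formalAlg K.

(* the component of an element of L_A in (L / L^n) (x) (A / m^(k+1)) *)
Definition LA_coord (t : LA A) (k n : nat) : tensor (quotLie L n) (A k) :=
  coord (coord t k) n.

Fact LA_br_subproof1 (s t : LA A) k n :
  ctens_tr L (A k) n (tbr (LA_coord s k n.+1) (LA_coord t k n.+1))
  = tbr (LA_coord s k n) (LA_coord t k n).
Proof.
rewrite /LA_coord -[coord (coord s k) n]coordP -[coord (coord t k) n]coordP.
by apply: tmap_tbr => //; [exact: qtr_gr|exact: qtr_br].
Qed.
Definition LA_br1 (s t : LA A) k : ctens L (A k) := InvLim (LA_br_subproof1 s t k).
Fact LA_br_subproof2 (s t : LA A) k :
  LA_tr A k (LA_br1 s t k.+1) = LA_br1 s t k.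
Proof.
apply: invlim_eq => n /=; rewrite /LA_coord -[coord s k]coordP -[coord t k]coordP.
apply: (@tmap_tbr K (quotLie L n) (quotLie L n) (A k.+1) (A k) idfun
  (fa_tr_lin A k) _ _ _ _ (LA_coord s k.+1 n) (LA_coord t k.+1 n)) => //.
  exact: (am_even (fa_tr A k)).
exact: (rmorphM (fa_tr A k)).
Qed.
Definition LA_br (s t : LA A) : LA A := InvLim (LA_br_subproof2 s t).

Definition LA_homog (i : bool) (t : LA A) :=
  forall k n, tgr i (LA_coord t k n) = LA_coord t k n.

(* the inclusion x |-> x (x) 1 of L in L_A *)
Fact LA_incl_subproof1 (x : L) k n :
  ctens_tr L (A k) n (tens (qpi (fl_filt L n.+1) x : quotLie L n.+1) 1)
  = tens (qpi (fl_filt L n) x : quotLie L n) 1.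
Proof. by rewrite [LHS]tmapE; congr tens; exact: qtrE. Qed.
Definition LA_incl1 (x : L) k : ctens L (A k) := InvLim (LA_incl_subproof1 x k).
Fact LA_incl_subproof2 (x : L) k : LA_tr A k (LA_incl1 x k.+1) = LA_incl1 x k.
Proof.
apply: invlim_eq => n /=; rewrite [LHS]tmapE; congr tens.
exact: (rmorph1 (fa_tr A k)).
Qed.
Definition LA_incl (x : L) : LA A := InvLim (LA_incl_subproof2 x).

(* the projection of L_A onto L (x)^ K induced by the augmentation; when L is
   complete, L (x)^ K is L *)
Definition LA_aug (t : LA A) : ctens L K^o := ctmap L (aa_aug (A 0)) (coord t 0).

Definition LA_m (t : LA A) := LA_aug t = 0.

(* y is the sum of the series exp(ad l) x = \sum_i (ad l)^i x / i!, for the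
   inverse limit topology of L_A *)
Definition exp_ad (l x y : LA A) := forall k n, exists N, forall M, (N <= M)%N ->
  LA_coord (\sum_(i < M) (i`!%:R : K)^-1 *: iter i (LA_br l) x) k n = LA_coord y k n.

Definition formal_deformation (d : L) (t : LA A) :=
  [/\ LA_homog true t, LA_m (t - LA_incl d) & LA_br t t = 0].

Definition deformation_equiv (s t : LA A) :=
  exists l : LA A, [/\ LA_homog false l, LA_m l & exp_ad l s t].

End ScalarExtension.

(* The map f_* : L_A -> L_B induced by a morphism f : A -> B: by continuity,
   each A -> B -> B / m^(k+1) factors through some A / m^(n+1). *)

Section PushForward.
Variables (K : fieldType) (L : filtLie K) (A B : formalAlg K) (f : formal_mor A B).

Definition fm_lev k : nat := sval (cid (fm_cont f k)).

Fact fm_fact_exists k : {g : {linear A (fm_lev k) -> B k} |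
  forall a : flim A, g (flev (fm_lev k) a) = flev k (f a)}.
Proof.
rewrite /fm_lev; case: (cid _) => n /= f0.
pose g (b : A n) : B k := flev k (f (sval (cid (flev_surj b)))).
have gE (a : flim A) : g (flev n a) = flev k (f a).
  rewrite /g; case: (cid _) => a' /= aa'; apply/eqP; rewrite -subr_eq0.
  have -> : flev k (f a') - flev k (f a) = flev k (f (a' - a)) by rewrite rmorphB.
  apply/eqP/f0; apply/eqP; have -> : flev n (a' - a) = flev n a' - flev n a by [].
  by rewrite aa' subrr.
have gL : linear g.
  move=> c b b'; have [a <-] := flev_surj b; have [a' <-] := flev_surj b'.
  have -> : c *: flev n a + flev n a' = flev n (c *: a + a') by [].
  by rewrite !gE linearP.
pose gl : {linear A n -> B k} :=
  HB.pack g (GRing.isLinear.Build K (A n) (B k) *:%R g gL).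
by exists gl.
Qed.

Definition fm_fact k : {linear A (fm_lev k) -> B k} := sval (fm_fact_exists k).

Lemma fm_factE k (a : flim A) : fm_fact k (flev (fm_lev k) a) = flev k (f a).
Proof. exact: (svalP (fm_fact_exists k)). Qed.

Lemma ctmap_lev (X : lmodType K) m n (g : {linear A n -> X}) (h : {linear A m -> X}) :
  (n <= m)%N -> (forall a : flim A, g (flev n a) = h (flev m a)) ->
  forall t : LA L A, ctmap L g (coord t n) = ctmap L h (coord t m).
Proof.
move=> nm + t; move: nm => /subnK; move: (m - n)%N => e; elim: e n g => [|e IH] n g.
  rewrite add0n => mn; case: m / mn h => h gh; apply: invlim_eq => j /=.
  apply: (tmap_eqr idfun) => b; have [a <-] := flev_surj b; exact: gh.
rewrite addSnnS => em gh.
pose g' : {linear A n.+1 -> X} := g \o fa_tr_lin A n.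
rewrite -(IH n.+1 g') //; last first.
  by move=> a; rewrite -gh /= [fa_tr_lin _ _ _]flev_tr.
apply: invlim_eq => j /=; rewrite -[coord t n]coordP /=.
by apply: tmap_comp.
Qed.

Fact fpush_subproof (t : LA L A) k :
  LA_tr L B k (ctmap L (fm_fact k.+1) (coord t (fm_lev k.+1)))
  = ctmap L (fm_fact k) (coord t (fm_lev k)).
Proof.
pose g : {linear A (fm_lev k.+1) -> B k} := fa_tr_lin B k \o fm_fact k.+1.
have gE (a : flim A) : g (flev (fm_lev k.+1) a) = fm_fact k (flev (fm_lev k) a).
  by rewrite /= !fm_factE; exact: flev_tr.
have -> : LA_tr L B k (ctmap L (fm_fact k.+1) (coord t (fm_lev k.+1)))
    = ctmap L g (coord t (fm_lev k.+1)).
  by apply: invlim_eq => j; apply: tmap_comp.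
have [le|/ltnW le] := leqP (fm_lev k.+1) (fm_lev k).
  exact: ctmap_lev le gE t.
by apply/esym; apply: ctmap_lev => // a; rewrite gE.
Qed.

Definition fpush (t : LA L A) : LA L B := InvLim (fpush_subproof t).

End PushForward.

Definition miniversal (K : fieldType) (L : filtLie K) (d : L) (A : formalAlg K)
    (t : LA L A) :=
  [/\ formal_deformation d t,
      (forall (B : formalAlg K) (s : LA L B), formal_deformation d s ->
         exists f : formal_mor A B, deformation_equiv (fpush f t) s) &
      (forall (B : formalAlg K) (s : LA L B), infinitesimal B ->
         formal_deformation d s ->
         forall f g : formal_mor A B,
           deformation_equiv (fpush f t) s -> deformation_equiv (fpush g t) s ->
           forall a : flim A, f a = g a)].

(* Main.v *)
From HB Require Import structures.
From mathcomp Require Import all_boot all_algebra.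
From mathcomp Require Import boolp classical_sets functions freeg.
Require Import Defs.

(** Why a miniversal deformation exists.  Write D = [d, -].  Finite type makes the
    scalar extension of L to a formal algebra A the space of linear maps from the
    continuous dual C of L to A (pairing, LA_inj, LA_of).  A formal deformation
    d + delta of d is thus a family of elements of the maximal ideal of A, indexed
    linearly by C, with prescribed parities and subject to the polynomial equations
    that express [d + delta, d + delta] = 0.  Such families are classified by
    morphisms from a formal algebra given by generators and relations, so the first
    condition of miniversality would cost nothing; but over an infinitesimal algebra
    equivalent deformations can have different classifying morphisms.

    The remedy is to fix a gauge.  The transpose of D on C has a generalized
    inverse, because subspaces have complements (generalized_inverse); its transpose
    h satisfies D h D = D (homotopy_exists, DhD).  Call d + delta gauge-fixed if
    D h delta = 0.

    Every formal deformation s is equivalent to a gauge-fixed one (gauge_fixing):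
    the equation l = h (exp(ad l) s - d + D l) has a solution because its right-hand
    side is contracting for the powers of the maximal ideal, and applying D to it
    gives D h (exp(ad l) s - d) = 0.  Multiplicativity of the exponential
    (is_exp_br0) keeps the bracket of the deformation with itself zero, and
    exp(-ad l) leads back to s (is_exp_inv).

    The condition D h delta = 0 is linear, so it can be added to the relations.  The
    resulting formal algebra univ carries the deformation univ_def, from which every
    gauge-fixed deformation is the push-forward along a morphism (fpush_classify)
    that is unique (fpush_inj).  With gauge fixing this gives the first condition.

    For the second, let s be a deformation over an infinitesimal algebra that is
    equivalent to the push-forwards of univ_def along f and g.  An equivalence
    changes a deformation by some D m (inf_exp), so the two push-forwards differ by
    some D n.  Both are gauge-fixed, whence D n = D h D n = 0: they are equal, and
    so are f and g. *)

Set Implicit Arguments.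
Unset Strict Implicit.
Unset Printing Implicit Defensive.

Import GRing.Theory.
Local Open Scope ring_scope.

(** * Complements and generalized inverses *)

Section GeneralizedInverse.
Variable K : fieldType.

(** The empty set is included, so that the property passes to the union of every
    chain, even an empty one. *)
Definition lin_closed (V : lmodType K) (A : V -> Prop) :=
  forall a x y, A x -> A y -> A (a *: x + y).

Lemma lin_closed0 (V : lmodType K) (A : V -> Prop) x : lin_closed A -> A x -> A 0.
Proof. by move=> Ac Ax; have := Ac (-1) x x Ax Ax; rewrite scaleN1r addNr. Qed.

(** Zorn's lemma on the subspaces that meet U only in 0: adjoining to a maximal
    one a vector outside its sum with U would give a larger one. *)
Lemma complement_exists (V : lmodType K) (U : V -> Prop) :
  lin_closed U -> U 0 ->
  exists S : V -> Prop, [/\ lin_closed S, S 0, (forall v, U v -> S v -> v = 0) &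
    forall v, exists u s, [/\ U u, S s & v = u + s]].
Proof.
move=> Uc U0.
pose P (A : set V) := lin_closed A /\ forall v, U v -> A v -> v = 0.
have [|A [[Ac AU] Amax]] := @Zorn_bigcup V P.
  move=> F FP Ft; split=> [a x y [X FX Xx] [Y FY Yy]|v Uv [X FX Xv]].
    have [XY|YX] := Ft X Y FX FY.
      by exists Y => //; apply: (FP Y FY).1 => //; exact: XY.
    by exists X => //; apply: (FP X FX).1 => //; exact: YX.
  exact: (FP X FX).2.
have A0 : A 0.
  have [//|nA0] := pselect (A 0); exfalso.
  apply: (Amax [set 0 : V]%classic); last first.
    by split=> [a x y -> ->|v _ ->]; rewrite ?scaler0 ?addr0.
  split=> [x Ax|/(_ 0 erefl)//]; exfalso; exact/nA0/(lin_closed0 Ac Ax).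
exists A; split=> // v.
(* otherwise adjoin v to A *)
have [//|nUA] := pselect (exists u s, [/\ U u, A s & v = u + s]).
exfalso; pose B : set V := fun x => exists a c, A a /\ x = a + c *: v.
apply: (Amax B).
  split; first by move=> x Ax; exists x, 0; rewrite scale0r addr0.
  move=> BA; apply: nUA; exists 0, v; split => //; last by rewrite add0r.
  by apply: BA; exists 0, 1; rewrite scale1r add0r.
split=> [a x y [x' [c [Ax' ->]]] [y' [c' [Ay' ->]]]|x Ux [a [c [Aa xE]]]].
  exists (a *: x' + y'), (a * c + c'); split; first exact: Ac.
  by rewrite scalerDr scalerDl scalerA addrACA.
have [c0|cn0] := eqVneq c 0.
  by apply: AU => //; rewrite xE c0 scale0r addr0.
exfalso; apply: nUA; exists (c^-1 *: x), (- c^-1 *: a); split.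
- by rewrite -[_ *: x]addr0; apply: Uc.
- by rewrite -[_ *: a]addr0; apply: Ac.
by rewrite xE scalerDr scalerA mulVf // scale1r addrAC scaleNr subrr add0r.
Qed.

(** Choose complements N of the kernel and S of the image; g sends w to the
    unique v in N such that w - T v lies in S. *)
Lemma generalized_inverse (V W : lmodType K) (T : {linear V -> W}) :
  exists g : {linear W -> V}, forall v, T (g (T v)) = T v.
Proof.
have [||N [Nc N0 Nker Ndec]] := @complement_exists V (fun v => T v = 0).
- by move=> a x y Tx Ty; rewrite linearP Tx Ty scaler0 addr0.
- exact: linear0.
have [||S [Sc S0 Sim Sdec]] := @complement_exists W (fun w => exists v, w = T v).
- by move=> a _ _ [x ->] [y ->]; exists (a *: x + y); rewrite linearP.
- by exists 0; rewrite linear0.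
have ex w : exists v, N v /\ S (w - T v).
  have [_ [s [[v ->] Ss ->]]] := Sdec w.
  have [u [n [Tu Nn ->]]] := Ndec v.
  by exists n; split=> //; rewrite linearD Tu add0r [T n + s]addrC addrK.
have uni w v v' : N v -> S (w - T v) -> N v' -> S (w - T v') -> v = v'.
  move=> Nv Sv Nv' Sv'; apply/eqP; rewrite -subr_eq0; apply/eqP/Nker.
    apply: Sim; first by exists (v - v').
    have := Sc (-1) _ _ Sv Sv'; rewrite scaleN1r opprB linearB.
    by rewrite addrA subrK.
  by have := Nc (-1) _ _ Nv' Nv; rewrite scaleN1r addrC.
pose g w := sval (cid (ex w)).
have gP w : N (g w) /\ S (w - T (g w)) by rewrite /g; case: cid.
have gL : linear g.
  move=> a x y; have [Nx Sx] := gP x; have [Ny Sy] := gP y.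
  have [Nxy Sxy] := gP (a *: x + y).
  apply: (uni (a *: x + y)) => //; first exact: Nc.
  by have := Sc a _ _ Sx Sy; rewrite linearP scalerBr addrACA opprD.
pose gl : {linear W -> V} := HB.pack g (GRing.isLinear.Build K W V *:%R g gL).
exists gl => v; have [Ng Sg] := gP (T v).
apply/esym/eqP; rewrite -subr_eq0; apply/eqP/Sim; last exact: Sg.
by exists (v - g (T v)); rewrite linearB.
Qed.

End GeneralizedInverse.

(** * The continuous dual of a filtered Lie algebra *)

Section ContinuousDual.
Variables (K : fieldType) (L : filtLie K).

Definition kills (n : nat) (xi : L -> K^o) := forall x, x \in fl_filt L n -> xi x = 0.

Definition cdual_pred : {pred (L -> K^o)} :=
  fun xi => `[< linear xi /\ exists n, kills n xi >].

Lemma killsS n xi : kills n xi -> kills n.+1 xi.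
Proof. by move=> H x /fl_filtS /H. Qed.

Lemma kills_le m n xi : (m <= n)%N -> kills m xi -> kills n xi.
Proof.
by move=> /subnK <-; elim: (n - m)%N => //= k IH /IH; rewrite addSn; exact: killsS.
Qed.

Fact cdual_closed : submod_closed cdual_pred.
Proof.
split.
  apply/asboolP; split=> [a x y|]; last by exists 0.
  by rewrite /GRing.zero /= scaler0 addr0.
move=> a xi eta /asboolP[xiL [m xi0]] /asboolP[etaL [n eta0]].
apply/asboolP; split=> [b x y|].
  change (a *: xi (b *: x + y) + eta (b *: x + y)
    = b *: (a *: xi x + eta x) + (a *: xi y + eta y)).
  rewrite xiL etaL !scalerDr addrACA !scalerA.
  by rewrite [a * b]mulrC.
exists (maxn m n) => x xU; change (a *: xi x + eta x = 0).
rewrite (kills_le (leq_maxl m n) xi0 xU) (kills_le (leq_maxr m n) eta0 xU).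
by rewrite scaler0 addr0.
Qed.
HB.instance Definition _ :=
  GRing.isSubmodClosed.Build K (L -> K^o) cdual_pred cdual_closed.

(** Since the quotients of L by its filtration are finite-dimensional, L behaves
    like the full dual of this space.  Linear algebra on L that would need
    continuity (complements, sections) becomes plain linear algebra here. *)
Record cdual := CDual { cd_fun :> L -> K^o; cd_mem : cd_fun \in cdual_pred }.
HB.instance Definition _ := [isSub for cd_fun].
HB.instance Definition _ := [Choice of cdual by <:].
HB.instance Definition _ := [SubChoice_isSubLmodule of cdual by <:].

Fact cd_linear (xi : cdual) : linear xi.
Proof. by case: xi => xi /= /asboolP[]. Qed.
HB.instance Definition _ (xi : cdual) :=
  GRing.isLinear.Build K L K^o *:%R xi (cd_linear xi).

Lemma cd_kills (xi : cdual) : exists n, kills n xi.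
Proof. by case: xi => xi /= /asboolP[]. Qed.

Lemma cdualP (xi eta : cdual) : (forall x, xi x = eta x) -> xi = eta.
Proof. by move=> H; apply/val_inj/functional_extensionality_dep. Qed.

Lemma cdD (xi eta : cdual) x : (xi + eta) x = xi x + eta x. Proof. by []. Qed.
Lemma cdZ a (xi : cdual) x : (a *: xi) x = a * xi x. Proof. by []. Qed.
Lemma cd_sum I (r : seq I) (P : pred I) (F : I -> cdual) x :
  (\sum_(i <- r | P i) F i) x = \sum_(i <- r | P i) F i x.
Proof. by elim/big_rec2: _ => // i y z _ <-. Qed.

Definition mk_cdual (f : {linear L -> K^o}) (H : exists n, kills n f) : cdual :=
  CDual (introT (asboolP _) (conj (linearP f) H)).

Section Precomp.
Variables (T : {linear L -> L}) (TF : forall n x, x \in fl_filt L n -> T x \in fl_filt L n).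

Lemma precomp_kills n (xi : cdual) : kills n xi -> kills n (xi \o T).
Proof. by move=> H x /TF /H. Qed.

Definition precomp (xi : cdual) : cdual :=
  @mk_cdual (xi \o T)
    (let: ex_intro n H := cd_kills xi in ex_intro _ n (precomp_kills H)).

Fact precomp_linear : linear precomp.
Proof. by move=> a xi eta; apply: cdualP. Qed.
HB.instance Definition _ :=
  GRing.isLinear.Build K cdual cdual *:%R precomp precomp_linear.
End Precomp.

Definition cgr i := precomp (fun n x => @fl_filt_gr K L n i x).
HB.instance Definition _ i := GRing.Linear.on (cgr i).

Lemma cgrE i xi x : cgr i xi x = xi (gl_gr L i x). Proof. by []. Qed.

Lemma cgrD xi : cgr false xi + cgr true xi = xi.
Proof. by apply: cdualP => x; rewrite cdD !cgrE -linearD z2projD. Qed.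

Lemma cgr_sum xi : \sum_(i : bool) cgr i xi = xi.
Proof. by rewrite big_bool /= addrC cgrD. Qed.

Lemma cgrK i j xi : cgr i (cgr j xi) = if i == j then cgr j xi else 0.
Proof.
apply: cdualP => x; rewrite !cgrE z2projK; case: (eqVneq j i) => [->|]; rewrite ?eqxx //.
by rewrite linear0.
Qed.

End ContinuousDual.

(** * Pairing functionals with completed tensors *)

Section TEval.
Variables (K : fieldType).

Section Def.
Variables (Q X : lmodType K) (nu : {linear Q -> K^o}).
Fact teval_bil : bilinear_for *:%R *:%R (fun q (x : X) => (nu q : K) *: x).
Proof.
split=> [x a q q'|q a x x'].
  by rewrite linearP scalerDl; congr (_ + _); exact/esym/scalerA.
by rewrite scalerDr /= !scalerA mulrC.
Qed.
Definition teval : tensor Q X -> X := tlift teval_bil.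
HB.instance Definition _ := GRing.Linear.on teval.
Lemma tevalE q x : teval (tens q x) = (nu q : K) *: x.
Proof. exact: tliftE. Qed.
Lemma tevalP a s t : teval (a *: s + t) = a *: teval s + teval t.
Proof. exact: linearP. Qed.
Lemma tevalZ a t : teval (a *: t) = a *: teval t.
Proof. exact: linearZ. Qed.
Lemma teval0 : teval 0 = 0.
Proof. exact: linear0. Qed.
End Def.

Lemma teval_map (Q Q' X X' : lmodType K) (p : {linear Q -> Q'}) (g : {linear X -> X'})
    (nu : {linear Q' -> K^o}) (nu' : {linear Q -> K^o}) :
  (forall q, nu (p q) = nu' q) ->
  forall t, teval nu (tmap p g t) = g (teval nu' t).
Proof.
move=> nuE; elim/tens_ind => [|a q x t IH]; first by rewrite tmap0 !teval0 linear0.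
by rewrite tmapP !tevalP linearP IH tmapE !tevalE nuE [g (_ *: x)]linearZ.
Qed.

End TEval.

Section Pairing.
Variables (K : fieldType) (L : filtLie K).
Local Notation C := (cdual L).

Section Bar.
Variables (xi : C) (n : nat) (H : kills n xi).
Definition cbar : quotLie L n -> K^o := qlift H.
HB.instance Definition _ := GRing.Linear.on cbar.
Lemma cbarE x : cbar (qpi _ x) = xi x. Proof. exact: qliftE. Qed.
End Bar.

Definition cd_lev (xi : C) : nat := sval (cid (cd_kills xi)).
Definition cd_levP (xi : C) : kills (cd_lev xi) xi := svalP (cid (cd_kills xi)).

Section CPair.
Variable X : lmodType K.

(** The functional is evaluated at one level that it factors through; by
    cpairE all such levels give the same value. *)
Definition cpair (xi : C) (t : ctens L X) : X :=
  teval (cbar (@cd_levP xi)) (coord t (cd_lev xi)).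

Lemma cpair_step (xi : C) n (H : kills n xi) (H' : kills n.+1 xi) (t : ctens L X) :
  teval (cbar H') (coord t n.+1) = teval (cbar H) (coord t n).
Proof.
rewrite -(coordP t n); apply/esym.
by apply: (teval_map idfun); elim/quotmW => x;
  exact: etrans (congr1 (cbar H) (qtrE n x)) (etrans (cbarE H x) (esym (cbarE H' x))).
Qed.

Lemma cpair_le (xi : C) m n (Hm : kills m xi) (Hn : kills n xi) (t : ctens L X) :
  (m <= n)%N -> teval (cbar Hm) (coord t m) = teval (cbar Hn) (coord t n).
Proof.
move=> /subnK; move: (n - m)%N => k; elim: k n Hn => [|k IH] n Hn mn.
  by case: n / mn Hn => Hn; rewrite (Prop_irrelevance Hm Hn).
move: mn Hn; rewrite addSn => mn; case: n / mn => Hn.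
by rewrite (cpair_step (kills_le (leq_addl k m) Hm)); apply: IH.
Qed.

Lemma cpairE (xi : C) n (H : kills n xi) (t : ctens L X) :
  cpair xi t = teval (cbar H) (coord t n).
Proof.
by have [le|/ltnW le] := leqP (cd_lev xi) n; [|apply/esym]; exact: cpair_le.
Qed.

Lemma cpairPr xi a (s t : ctens L X) :
  cpair xi (a *: s + t) = a *: cpair xi s + cpair xi t.
Proof. exact: linearP. Qed.

Lemma cpair0 xi : cpair xi (0 : ctens L X) = 0.
Proof. exact: linear0. Qed.

Lemma cpairPl a xi eta (t : ctens L X) :
  cpair (a *: xi + eta) t = a *: cpair xi t + cpair eta t.
Proof.
have [m xi0] := cd_kills xi; have [n eta0] := cd_kills eta.
have xi1 := kills_le (leq_maxl m n) xi0; have eta1 := kills_le (leq_maxr m n) eta0.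
have H : kills (maxn m n) (a *: xi + eta).
  by move=> x xU; rewrite cdD cdZ xi1 ?eta1 // mulr0 addr0.
rewrite (cpairE H) (cpairE xi1) (cpairE eta1).
elim/tens_ind: (coord t _) => [|b q x u IH]; first by rewrite !teval0 scaler0 addr0.
rewrite !tevalP IH !tevalE !scalerDr !scalerA.
elim/quotmW: q => q; rewrite /= !cbarE cdD cdZ mulrDr scalerDl.
by rewrite addrACA !mulrA [a * b]mulrC.
Qed.
End CPair.

Lemma cpair_map (X Y : lmodType K) (g : {linear X -> Y}) xi (t : ctens L X) :
  cpair xi (ctmap L g t) = g (cpair xi t).
Proof. by apply: (teval_map (p := idfun)). Qed.

End Pairing.

(** * Frames of the finite-dimensional quotients *)

Lemma tens_suml (K : fieldType) (V X : lmodType K) I (r : seq I) (F : I -> V) (x : X) :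
  tens (\sum_(i <- r) F i) x = \sum_(i <- r) tens (F i) x.
Proof.
elim/big_rec2: _ => [|i t v _ IH].
  by rewrite -(scale0r (0 : V)) tensZl scale0r.
by rewrite -[F i]scale1r tensPl scale1r IH scale1r.
Qed.

Section Frames.
Variables (K : fieldType) (L : filtLie K) (L_fin : fl_finite_type L).
Local Notation C := (cdual L).

Lemma quot_spanned n : exists (m : nat) (e : 'I_m -> L), forall x,
  exists c : 'I_m -> K, x - \sum_i c i *: e i \in fl_filt L n.
Proof.
elim: n => [|n [m [e eP]]].
  by exists 0%N, (fun _ => 0) => x; exists (fun _ => 0); exact: fl_filt0.
have [p [b [bn bP]]] := L_fin n.
exists (m + p)%N, (fun i => match fintype.split i with inl j => e j | inr j => b j end) => x.
have [c /bP[c' H]] := eP x.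
exists (fun i => match fintype.split i with inl j => c j | inr j => c' j end).
rewrite big_split_ord opprD addrA /=.
under eq_bigr => i _ do rewrite (unsplitK (inl i)).
under [X in _ - _ - X]eq_bigr => i _ do rewrite (unsplitK (inr i)).
exact: H.
Qed.

(** A frame rather than a basis: the expansion fr_sum by itself makes vectors,
    functionals and tensors recoverable from finitely many coefficients. *)
Record frame n := Frame {
  fr_dim : nat;
  fr_vec : 'I_fr_dim -> L;
  fr_dual : 'I_fr_dim -> C;
  fr_kills : forall i, kills n (fr_dual i);
  fr_sum : forall x, x - \sum_i (fr_dual i x : K) *: fr_vec i \in fl_filt L n }.

(** A generalized inverse of the surjection from coefficient vectors onto the
    quotient is a linear choice of coefficients. *)
Lemma frame_exists n : exists fr : frame n, True.
Proof.
have [m [e eP]] := quot_spanned n.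
pose T0 (c : 'rV[K]_m) : quotm (fl_filt L n) := qpi _ (\sum_i c 0 i *: e i).
have T0L : linear T0.
  move=> a c c'; rewrite /T0 -linearP scaler_sumr -big_split; congr qpi.
  by apply: eq_bigr => i _; rewrite !mxE scalerDl scalerA.
pose T : {linear 'rV[K]_m -> quotm (fl_filt L n)} :=
  HB.pack T0 (GRing.isLinear.Build _ _ _ *:%R T0 T0L).
have [g gP] := generalized_inverse T.
pose f i (x : L) : K^o := g (qpi _ x) 0 i.
have fL i : linear (f i) by move=> a x y; rewrite /f !linearP !mxE.
pose fl i : {linear L -> K^o} := HB.pack (f i) (GRing.isLinear.Build _ _ _ *:%R (f i) (fL i)).
have fk i : kills n (fl i).
  move=> x xU; change (g (qpi (fl_filt L n) x) 0 i = 0).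
  have -> : qpi (fl_filt L n) x = 0.
    by rewrite -(linear0 (qpi (fl_filt L n))); apply/qpiP; rewrite subr0.
  by rewrite linear0 mxE.
unshelve eexists (@Frame n m e (fun i => mk_cdual (ex_intro _ n (fk i))) fk _) => //.
move=> x; apply/qpiP.
have [c /qpiP xE] := eP x.
have {}xE : qpi (fl_filt L n) x = T (\row_i c i).
  by rewrite xE /= /T0; congr qpi; apply: eq_bigr => i _; rewrite mxE.
by rewrite xE -gP -xE.
Qed.

Definition fr n : frame n := sval (cid (frame_exists n)).

End Frames.

Arguments fr_vec {K L n} f i.
Arguments fr_dual {K L n} f i.
Arguments fr_kills {K L n} f i.
Arguments fr_sum {K L n} f x.

Section FrameUse.
Variables (K : fieldType) (L : filtLie K) (n : nat) (F : frame L n).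
Local Notation C := (cdual L).
Local Notation pi := (qpi (fl_filt L n)).

Lemma frame_qsum x : pi x = \sum_i (fr_dual F i x : K) *: pi (fr_vec F i).
Proof.
under eq_bigr => i _ do rewrite -linearZ.
rewrite -linear_sum; apply/qpiP; exact: fr_sum.
Qed.

Lemma frame_dual (xi : C) : kills n xi -> xi = \sum_i (xi (fr_vec F i) : K) *: fr_dual F i.
Proof.
move=> H; apply: cdualP => x.
rewrite cd_sum; have /H := fr_sum F x.
rewrite linearB => /eqP; rewrite subr_eq0 => /eqP ->.
rewrite linear_sum; apply: eq_bigr => i _.
by rewrite linearZ cdZ mulrC.
Qed.

(** The values of the finitely many functionals of a frame determine a tensor;
    this is where finite type lets functionals replace tensors. *)
Lemma frame_tensor (X : lmodType K) (t : tensor (quotLie L n) X) :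
  t = \sum_i tens (pi (fr_vec F i) : quotLie L n) (teval (cbar (fr_kills F i)) t).
Proof.
elim/tens_ind: t => [|a q x t IH].
  by apply/esym/big1 => i _; rewrite teval0 -(scale0r 0) tensZr scale0r.
under eq_bigr => i _ do rewrite tevalP tensPr tevalE.
rewrite big_split /= -IH -scaler_sumr; congr (_ *: _ + _).
elim/quotmW: q => q.
have -> : tens (pi q : quotLie L n) x
    = tens (\sum_i (fr_dual F i q : K) *: pi (fr_vec F i) : quotLie L n) x.
  by congr tens; exact: frame_qsum.
rewrite tens_suml; apply: eq_bigr => i _.
by rewrite tensZl tensZr /= cbarE.
Qed.
End FrameUse.

(** * The scalar extension as a space of linear maps *)

Section LevelMorphism.
Variables (K : fieldType) (A : formalAlg K) (n : nat).
Fact flev_linear : linear (@flev K A n). Proof. by []. Qed.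
Fact flev_monoid : monoid_morphism (@flev K A n). Proof. by []. Qed.
HB.instance Definition _ :=
  GRing.isLinear.Build K (flim A) (A n) *:%R (@flev K A n) flev_linear.
HB.instance Definition _ :=
  GRing.isMonoidMorphism.Build (flim A) (A n) (@flev K A n) flev_monoid.
Lemma flevZ c (a : flim A) : flev n (c *: a) = c *: flev n a.
Proof. by []. Qed.
Lemma flev_gr i (a : flim A) : flev n (aa_gr (flim A) i a) = aa_gr (A n) i (flev n a).
Proof. by []. Qed.
End LevelMorphism.

Lemma flimP (K : fieldType) (A : formalAlg K) (a b : flim A) :
  (forall k, flev k a = flev k b) -> a = b.
Proof. exact: invlim_eq. Qed.

Section CompletedTensorDual.
Variables (K : fieldType) (L : filtLie K) (L_fin : fl_finite_type L).
Local Notation C := (cdual L).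
Local Notation fr := (fr L_fin).

Lemma ctens_inj (X : lmodType K) (s t : ctens L X) :
  (forall xi, cpair xi s = cpair xi t) -> s = t.
Proof.
move=> H; apply: invlim_eq => n.
rewrite (frame_tensor (fr n) (coord s n)) (frame_tensor (fr n) (coord t n)).
by apply: eq_bigr => i _; rewrite -!cpairE H.
Qed.

Section CtensOf.
Variables (X : lmodType K) (psi : {linear C -> X}).

Definition ctens_of_coord n : tensor (quotLie L n) X :=
  \sum_i tens (qpi (fl_filt L n) (fr_vec (fr n) i) : quotLie L n) (psi (fr_dual (fr n) i)).

Lemma teval_sum (Q Y : lmodType K) (nu : {linear Q -> K^o}) I (r : seq I)
    (F : I -> tensor Q Y) :
  teval nu (\sum_(i <- r) F i) = \sum_(i <- r) teval nu (F i).
Proof. exact: linear_sum. Qed.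

(** The coordinate built from a frame pairs correctly with every functional of
    that level, so the choice of frame at each level does not matter. *)
Lemma ctens_of_coordE n (xi : C) (H : kills n xi) :
  teval (cbar H) (ctens_of_coord n) = psi xi.
Proof.
rewrite teval_sum [in RHS](frame_dual (fr n) H) linear_sum.
by apply: eq_bigr => i _; rewrite tevalE /= cbarE linearZ.
Qed.

Fact ctens_of_subproof n : ctens_tr L X n (ctens_of_coord n.+1) = ctens_of_coord n.
Proof.
rewrite [LHS](frame_tensor (fr n)); apply: eq_bigr => i _; congr tens.
have H := fr_kills (fr n) i.
rewrite -(ctens_of_coordE (killsS H)).
apply: (@teval_map K _ _ _ _ (qtr L n) idfun); elim/quotmW => x.
exact: etrans (congr1 (cbar _) (qtrE n x)) (etrans (cbarE _ x) (esym (cbarE _ x))).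
Qed.
Definition ctens_of : ctens L X := InvLim ctens_of_subproof.

Lemma cpair_of xi : cpair xi ctens_of = psi xi.
Proof. exact: ctens_of_coordE. Qed.
End CtensOf.

End CompletedTensorDual.

Section Pair.
Variables (K : fieldType) (L : filtLie K).
Local Notation C := (cdual L).

Section Def.
Variable A : formalAlg K.

Fact pairing_subproof (xi : C) (t : LA L A) k :
  fa_tr_lin A k (cpair xi (coord t k.+1)) = cpair xi (coord t k).
Proof. by rewrite -[in RHS]coordP -cpair_map. Qed.
(** Applying xi to the L-factor.  Together with LA_inj and LA_of this identifies
    the scalar extension of L with the linear maps from the continuous dual of L
    to the formal algebra. *)
Definition pairing (xi : C) (t : LA L A) : flim A := InvLim (pairing_subproof xi t).

Lemma pairing_lev k xi t : flev k (pairing xi t) = cpair xi (coord t k).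
Proof. by []. Qed.

Lemma pairing_levE k n (xi : C) (H : kills n xi) t :
  flev k (pairing xi t) = teval (cbar H) (LA_coord t k n).
Proof. by rewrite pairing_lev (cpairE H). Qed.

Lemma pairingPl a xi eta t : pairing (a *: xi + eta) t = a *: pairing xi t + pairing eta t.
Proof. by apply: flimP => k; rewrite [LHS]cpairPl. Qed.

Fact pairing_linear xi : linear (pairing xi).
Proof. by move=> a s t; apply: flimP => k; rewrite [LHS]cpairPr. Qed.
HB.instance Definition _ xi :=
  GRing.isLinear.Build K (LA L A) (flim A) *:%R (pairing xi) (pairing_linear xi).

Definition pairing_map t xi := pairing xi t.
Fact pairing_map_linear t : linear (pairing_map t).
Proof. by move=> a xi eta; rewrite /pairing_map pairingPl. Qed.
HB.instance Definition _ t :=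
  GRing.isLinear.Build K C (flim A) *:%R (pairing_map t) (pairing_map_linear t).

Lemma LA_eq (s t : LA L A) :
  (forall k n, LA_coord s k n = LA_coord t k n) -> s = t.
Proof. by move=> H; apply: invlim_eq => k; apply: invlim_eq => n; exact: H. Qed.

Lemma LA_coordP k n a (s t : LA L A) :
  LA_coord (a *: s + t) k n = a *: LA_coord s k n + LA_coord t k n.
Proof. by []. Qed.

Lemma pairing_incl xi x : pairing xi (LA_incl A x) = (xi x : K)%:A.
Proof.
have [n H] := cd_kills xi; apply: flimP => k.
by rewrite (pairing_levE k H) tevalE /= cbarE.
Qed.

Lemma LA_m_pairingW (t : LA L A) xi : LA_m t -> aug (pairing xi t) = 0.
Proof.
move=> t0; change (aa_aug (A 0) (flev 0 (pairing xi t)) = 0).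
by rewrite pairing_lev -cpair_map [ctmap _ _ _]t0; exact: linear0.
Qed.

Lemma pairing_tgr i k n (xi : C) (H : kills n xi) (t : LA L A) :
  teval (cbar H) (tgr i (LA_coord t k n))
  = flev k (\sum_(j : bool) aa_gr (flim A) (i (+) j) (pairing (cgr j xi) t)).
Proof.
rewrite /tgr teval_sum [RHS]linear_sum; apply: eq_bigr => j _.
rewrite -[RHS]/(aa_gr (A k) (i (+) j) (flev k (pairing (cgr j xi) t))).
have Hj : kills n (cgr j xi) by move=> x /(@fl_filt_gr _ _ _ j) /H.
rewrite (pairing_levE k Hj); apply: teval_map; elim/quotmW => x.
by rewrite /= [qgr _ _]qgrE !cbarE cgrE.
Qed.

Lemma LA_homogW i (t : LA L A) xi : LA_homog i t ->
  pairing xi t = \sum_(j : bool) aa_gr (flim A) (i (+) j) (pairing (cgr j xi) t).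
Proof.
move=> ti; have [n H] := cd_kills xi; apply: flimP => k.
by rewrite (pairing_levE k H) -(pairing_tgr i k H) ti.
Qed.

Lemma LA_homog_pairing i j (t : LA L A) xi : LA_homog i t ->
  homog (aa_gr (flim A)) (i (+) j) (pairing (cgr j xi) t).
Proof.
move=> ti; rewrite /homog; apply/esym.
rewrite [LHS](LA_homogW _ ti) big_bool /= !cgrK.
have p0 : pairing 0 t = 0 by exact: (linear0 (pairing_map t)).
by case: j; rewrite /= p0 linear0 ?addr0 ?add0r.
Qed.
End Def.

Section Fin.
Variable L_fin : fl_finite_type L.
Local Notation fr := (fr L_fin).

Lemma LA_inj (A : formalAlg K) (s t : LA L A) :
  (forall xi, pairing xi s = pairing xi t) -> s = t.
Proof.
move=> H; apply: invlim_eq => k; apply: (ctens_inj L_fin) => xi.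
by rewrite -!pairing_lev H.
Qed.

Lemma LA_m_pairing (A : formalAlg K) (t : LA L A) :
  LA_m t <-> forall xi, aug (pairing xi t) = 0.
Proof.
split=> [t0 xi|H]; first exact: LA_m_pairingW.
apply: (ctens_inj L_fin) => xi; rewrite cpair_map; apply/esym.
rewrite [LHS]cpair0; exact/esym/H.
Qed.

End Fin.
End Pair.

Section Coordinates.
Variables (K : fieldType) (L : filtLie K) (L_fin : fl_finite_type L).
Local Notation C := (cdual L).
Local Notation fr := (fr L_fin).

Lemma tensor_inj n (X : lmodType K) (u v : tensor (quotLie L n) X) :
  (forall (xi : C) (H : kills n xi), teval (cbar H) u = teval (cbar H) v) -> u = v.
Proof.
move=> H; rewrite (frame_tensor (fr n) u) (frame_tensor (fr n) v).
by apply: eq_bigr => i _; rewrite H.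
Qed.

Section LAof.
Variables (A : formalAlg K) (phi : {linear C -> flim A}).
Definition LA_of_coord k : ctens L (A k) :=
  ctens_of L_fin (@flev K A k \o phi : {linear C -> A k}).
Fact LA_of_subproof k : LA_tr L A k (LA_of_coord k.+1) = LA_of_coord k.
Proof.
apply: (ctens_inj L_fin) => xi.
by rewrite cpair_map !cpair_of; exact: flev_tr.
Qed.
Definition LA_of : LA L A := InvLim LA_of_subproof.
Lemma pairing_of xi : pairing xi LA_of = phi xi.
Proof. by apply: flimP => k; rewrite pairing_lev cpair_of. Qed.
End LAof.

Lemma LA_homogP (A : formalAlg K) i (t : LA L A) :
  LA_homog i t <-> forall xi j, homog (aa_gr (flim A)) (i (+) j) (pairing (cgr j xi) t).
Proof.
split=> [ti xi j|H k n]; first exact: LA_homog_pairing.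
apply: tensor_inj => xi xi0; rewrite pairing_tgr.
under eq_bigr => j _ do rewrite (H xi j).
rewrite -(linear_sum (pairing_map t)) cgr_sum.
exact: pairing_levE.
Qed.

Lemma pairing_fpush (A B : formalAlg K) (f : formal_mor A B) (t : LA L A) xi :
  pairing xi (fpush f t) = f (pairing xi t).
Proof.
apply: flimP => k; rewrite pairing_lev cpair_map -pairing_lev.
exact: fm_factE.
Qed.

(** The coefficient of a bracket at xi, written in the coefficients a and b of
    the two factors: P is the parity projection and the sign comes from moving a
    coefficient of the first factor past a vector of the second.  It is stated for
    arbitrary algebras because it serves both as a relation in a free algebra and
    as a coefficient of a bracket in the scalar extension. *)
Definition br_eval n (xi : C) (E : lalgType K) (P : bool -> E -> E) (a b : C -> E) : E :=
  \sum_i \sum_j \sum_(k : bool) \sum_(l : bool)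
    (-1) ^+ (k && l) *:
      ((xi (gl_br L (fr_vec (fr n) i) (gl_gr L l (fr_vec (fr n) j))) : K) *:
        (P k (a (fr_dual (fr n) i)) * b (fr_dual (fr n) j))).

Lemma tbr_suml (Q : gLie K) (A : augAlg K) I (r : seq I) (F : I -> tensor Q A) t :
  tbr (\sum_(i <- r) F i) t = \sum_(i <- r) tbr (F i) t.
Proof.
elim/big_rec2: _ => [|i u v _ IH]; first exact: tbr0l.
by rewrite -[F i]scale1r tbrPl scale1r IH scale1r.
Qed.
Lemma tbr_sumr (Q : gLie K) (A : augAlg K) I (r : seq I) (F : I -> tensor Q A) t :
  tbr t (\sum_(i <- r) F i) = \sum_(i <- r) tbr t (F i).
Proof.
elim/big_rec2: _ => [|i u v _ IH]; first exact: tbr0r.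
by rewrite -[F i]scale1r tbrPr scale1r IH scale1r.
Qed.

Lemma pairing_br (A : formalAlg K) n (xi : C) (s t : LA L A) : kills n xi ->
  pairing xi (LA_br s t)
    = br_eval n xi (fun k (a : flim A) => aa_gr (flim A) k a) (pairing_map s) (pairing_map t).
Proof.
move=> H; apply: flimP => m; rewrite (pairing_levE m H).
rewrite -[LA_coord _ _ _]/(tbr (LA_coord s m n) (LA_coord t m n)).
rewrite (frame_tensor (fr n) (LA_coord s m n)) (frame_tensor (fr n) (LA_coord t m n)).
rewrite tbr_suml teval_sum /br_eval.
rewrite [RHS]linear_sum; apply: eq_bigr => i _.
rewrite tbr_sumr teval_sum [RHS]linear_sum; apply: eq_bigr => j _.
rewrite tbrE /tbr_pure teval_sum [RHS]linear_sum; apply: eq_bigr => k _.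
rewrite teval_sum [RHS]linear_sum; apply: eq_bigr => l _.
rewrite tevalZ [RHS]flevZ; congr (_ *: _).
rewrite tevalE [RHS]flevZ; congr (_ *: _); last first.
  by rewrite -!pairing_levE.
rewrite [gl_gr _ _ _]qgrE [gl_br _ _ _]qbrE; exact: cbarE.
Qed.

End Coordinates.

(** * Graded Lie identities in tensor products *)

Lemma homog_proj (K : fieldType) (V : lmodType K) (G : z2grading V) i j v :
  homog G j v -> G i v = if i == j then v else 0.
Proof. by move=> vj; rewrite -[in LHS]vj z2projK vj. Qed.

Lemma homog_z2proj (K : fieldType) (V : lmodType K) (G : z2grading V) i v :
  homog G i (G i v).
Proof. by rewrite /homog z2projK eqxx. Qed.

Section GradedTensor.
Variables (K : fieldType) (Q : gLie K) (A : augAlg K).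
Local Notation QA := (tensor Q A).

Lemma tgrP i c (s t : QA) : tgr i (c *: s + t) = c *: tgr i s + tgr i t.
Proof.
rewrite /tgr scaler_sumr -big_split; apply: eq_bigr => j _; exact: tmapP.
Qed.

Lemma tgr0 i : tgr i (0 : QA) = 0.
Proof. by rewrite /tgr big1 // => j _; rewrite tmap0. Qed.

Lemma tgr_homog i j l q (a : A) : homog (gl_gr Q) j q -> homog (aa_gr A) l a ->
  tgr i (tens q a) = if i == j (+) l then tens q a else 0.
Proof.
move=> qj al.
have t0l x : tens (0 : Q) x = 0 :> QA by rewrite -(scale0r 0) tensZl scale0r.
have t0r x : tens x (0 : A) = 0 :> QA by rewrite -(scale0r 0) tensZr scale0r.
rewrite /tgr big_bool /= !tmapE !(homog_proj _ qj) !(homog_proj _ al).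
by move: i j l {qj al} => [] [] []; rewrite /= ?t0l ?t0r ?addr0 ?add0r.
Qed.

Section Ind.
Variable P : QA -> Prop.
Hypothesis P0 : P 0.
Hypothesis PL : forall c s t, P s -> P t -> P (c *: s + t).

(** Every tensor is a combination of products of homogeneous vectors, so signs
    need only be checked on those. *)
Lemma tens_homog_ind :
  (forall i j q a, homog (gl_gr Q) i q -> homog (aa_gr A) j a -> P (tens q a)) ->
  forall t, P t.
Proof.
move=> Pg; elim/tens_ind => [//|c q a t Pt]; apply: PL => //.
have PD s u : P s -> P u -> P (s + u) by move=> Ps Pu; rewrite -[s]scale1r; exact: PL.
have Pq i x : homog (gl_gr Q) i x -> P (tens x a).
  move=> xi; rewrite -(z2projD (aa_gr A) a) -[aa_gr A false a]scale1r tensPr scale1r.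
  by apply: PD; apply: (Pg i) => //; exact: homog_z2proj.
rewrite -(z2projD (gl_gr Q) q) -[gl_gr Q false q]scale1r tensPl scale1r.
by apply: PD; apply: Pq; exact: homog_z2proj.
Qed.

Lemma tgr_ind i :
  (forall j q a, homog (gl_gr Q) j q -> homog (aa_gr A) (i (+) j) a -> P (tens q a)) ->
  forall t, P (tgr i t).
Proof.
move=> Pg t.
pose P' := fun t => P (tgr i t).
apply: (@tens_ind _ _ _ P') => [|c q a u Pu]; rewrite /P' ?tgr0 // tgrP.
apply: PL => //; rewrite /tgr big_bool /=.
by rewrite -[tmap _ _ _]scale1r; apply: PL; rewrite tmapE; apply: Pg; exact: homog_z2proj.
Qed.
End Ind.

Lemma tbr_homog i j q (a : A) y b : homog (aa_gr A) i a -> homog (gl_gr Q) j y ->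
  tbr (tens q a) (tens y b) = (-1) ^+ (i && j) *: tens (gl_br Q q y) (a * b).
Proof.
move=> ai yj; rewrite tbrE /tbr_pure !big_bool /= !(homog_proj _ ai) !(homog_proj _ yj).
have t0l x : tens (0 : Q) x = 0 :> QA by rewrite -(scale0r 0) tensZl scale0r.
have t0r x : tens x (0 : A) = 0 :> QA by rewrite -(scale0r 0) tensZr scale0r.
by move: i j {ai yj} => [] []; rewrite /= ?mul0r ?linear0r ?t0l ?t0r ?scaler0 ?addr0 ?add0r.
Qed.

Lemma tbr_tgr i j (s t : QA) :
  tgr (i (+) j) (tbr (tgr i s) (tgr j t)) = tbr (tgr i s) (tgr j t).
Proof.
pose P s := tgr (i (+) j) (tbr s (tgr j t)) = tbr s (tgr j t).
apply: (@tgr_ind P) => [|c u v|k q a qk ak]; rewrite /P.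
- by rewrite tbr0l tgr0.
- by move=> Pa Pb; rewrite tbrPl tgrP Pa Pb.
pose P' t := tgr (i (+) j) (tbr (tens q a) t) = tbr (tens q a) t.
apply: (@tgr_ind P') => [|c u v|l y b yl bl]; rewrite /P'.
- by rewrite tbr0r tgr0.
- by move=> Pa Pb; rewrite tbrPr tgrP Pa Pb.
rewrite (tbr_homog _ _ ak yl) -[_ *: _]addr0 tgrP tgr0 !addr0.
rewrite (tgr_homog _ (gl_br_homog qk yl) (aa_mul_homog ak bl)).
have -> : i (+) j == k (+) l (+) (i (+) k (+) (j (+) l)) by
  move: (i) (j) (k) (l); do 4!case.
by [].
Qed.

(** For an even first factor q (x) a the parities of q and a agree, and the signs
    of the graded law all cancel. *)
Lemma tbr_anti (s t : QA) : tbr (tgr false s) t = - tbr t (tgr false s).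
Proof.
pose P s := tbr s t = - tbr t s.
apply: (@tgr_ind P) => [|c u v|k q a qk ak]; rewrite /P.
- by rewrite tbr0l tbr0r oppr0.
- by move=> Pa Pb; rewrite tbrPl tbrPr Pa Pb opprD scalerN.
pose P' t := tbr (tens q a) t = - tbr t (tens q a).
apply: (@tens_homog_ind P') => [|c u v|i j y b yi bj]; rewrite /P'.
- by rewrite tbr0l tbr0r oppr0.
- by move=> Pa Pb; rewrite tbrPl tbrPr Pa Pb opprD scalerN.
rewrite (tbr_homog _ _ ak yi) (tbr_homog _ _ bj qk).
have e : gl_br Q y q = (- (-1) ^+ (i && k)) *: gl_br Q q y.
  by rewrite (gl_anti yi qk) scaleNr.
rewrite e (aa_comm bj ak) tensZl tensZr !scalerA -scaleNr.
congr (_ *: _).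
by move: (i) (j) (k); do 3!case; rewrite /= ?expr0 ?expr1 ?(mulrN, mulNr, mulr1, opprK).
Qed.

(** Bracketing with an even tensor is a derivation without signs: the parities
    of its two factors agree. *)
Lemma tbr_jacobi (s t u : QA) :
  tbr (tgr false s) (tbr t u) = tbr (tbr (tgr false s) t) u + tbr t (tbr (tgr false s) u).
Proof.
pose P s := tbr s (tbr t u) = tbr (tbr s t) u + tbr t (tbr s u).
apply: (@tgr_ind P) => [|c v w|k q a qk ak]; rewrite /P.
- by rewrite !tbr0l tbr0r addr0.
- by move=> Pa Pb; rewrite !tbrPl tbrPr Pa Pb scalerDr addrACA.
pose P1 t := tbr (tens q a) (tbr t u) = tbr (tbr (tens q a) t) u + tbr t (tbr (tens q a) u).
apply: (@tens_homog_ind P1) => [|c v w|i j y b yi bj]; rewrite /P1.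
- by rewrite !tbr0l tbr0r tbr0l addr0.
- by move=> Pa Pb; rewrite !(tbrPl, tbrPr) Pa Pb scalerDr addrACA.
pose P2 u := tbr (tens q a) (tbr (tens y b) u)
  = tbr (tbr (tens q a) (tens y b)) u + tbr (tens y b) (tbr (tens q a) u).
apply: (@tens_homog_ind P2) => [|c v w|i' j' z e zi ej]; rewrite /P2.
- by rewrite !tbr0r addr0.
- by move=> Pa Pb; rewrite !tbrPr Pa Pb scalerDr addrACA.
rewrite (tbr_homog _ _ bj zi) (tbr_homog _ _ ak yi) (tbr_homog _ _ ak zi).
have tZ c x v : tbr x (c *: v) = c *: tbr x v by rewrite -[c *: v]addr0 tbrPr tbr0r addr0.
have tZl c x v : tbr (c *: v) x = c *: tbr v x by rewrite -[c *: v]addr0 tbrPl tbr0l addr0.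
rewrite !tZ tZl.
rewrite (tbr_homog _ _ ak (gl_br_homog yi zi)).
rewrite (tbr_homog _ _ (aa_mul_homog ak bj) zi).
rewrite (tbr_homog _ _ bj (gl_br_homog qk zi)).
have -> : b * (a * e) = (-1) ^+ (j && k) *: (a * (b * e)).
  by rewrite mulrA (aa_comm bj ak) -scalerAl mulrA.
rewrite -mulrA tensZr (gl_jacobi _ qk yi) -[X in tens X _]addrC tensPl.
rewrite scalerDr !scalerDr !scalerA addrC; congr (_ *: _ + _ *: _).
  by move: (i) (j) (k) (i'); do 4!case; rewrite /= ?expr0 ?expr1 ?(mulrN, mulNr, mulr1, opprK).
by move: (i) (j) (k) (i'); do 4!case; rewrite /= ?expr0 ?expr1 ?(mulrN, mulNr, mulr1, opprK).
Qed.
End GradedTensor.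

(** * The bracket of the scalar extension *)

Section Bracket.
Variables (K : fieldType) (L : filtLie K) (A : formalAlg K).
Local Notation LA := (LA L A).

Lemma LA_brPl c (l l' t : LA) : LA_br (c *: l + l') t = c *: LA_br l t + LA_br l' t.
Proof. by apply: LA_eq => k n; exact: tbrPl. Qed.
Fact LA_br_linear (l : LA) : linear (LA_br l).
Proof. by move=> c s t; apply: LA_eq => k n; exact: tbrPr. Qed.
HB.instance Definition _ l :=
  GRing.isLinear.Build K LA LA *:%R (LA_br l) (LA_br_linear l).
Definition LA_rbr (t l : LA) : LA := LA_br l t.
Fact LA_rbr_linear (t : LA) : linear (LA_rbr t).
Proof. by move=> c l l'; exact: LA_brPl. Qed.
HB.instance Definition _ t :=
  GRing.isLinear.Build K LA LA *:%R (LA_rbr t) (LA_rbr_linear t).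

Lemma LA_brZl c (l t : LA) : LA_br (c *: l) t = c *: LA_br l t.
Proof. exact: (linearZ_LR (LA_rbr t)). Qed.
Lemma LA_brZr c (l t : LA) : LA_br l (c *: t) = c *: LA_br l t.
Proof. exact: (linearZ_LR (LA_br l)). Qed.
Lemma LA_brNl (l t : LA) : LA_br (- l) t = - LA_br l t.
Proof. exact: (linearN (LA_rbr t)). Qed.
Lemma LA_brBl (l l' t : LA) : LA_br (l - l') t = LA_br l t - LA_br l' t.
Proof. exact: (linearB (LA_rbr t)). Qed.

Lemma LA_homog_tgr i (t : LA) k n : LA_homog i t -> LA_coord t k n = tgr i (LA_coord t k n).
Proof. by move=> ti; rewrite ti. Qed.

Lemma LA_anti (l t : LA) : LA_homog false l -> LA_br l t = - LA_br t l.
Proof.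
move=> l0; apply: LA_eq => k n; rewrite -[RHS]/(- tbr (LA_coord t k n) (LA_coord l k n)).
by rewrite (LA_homog_tgr k n l0) -tbr_anti -LA_homog_tgr.
Qed.

Lemma LA_jacobi (l s t : LA) : LA_homog false l ->
  LA_br l (LA_br s t) = LA_br (LA_br l s) t + LA_br s (LA_br l t).
Proof.
move=> l0; apply: LA_eq => k n.
have := tbr_jacobi (LA_coord l k n) (LA_coord s k n) (LA_coord t k n).
by rewrite -(LA_homog_tgr k n l0).
Qed.

Lemma LA_br_homog i j (s t : LA) : LA_homog i s -> LA_homog j t ->
  LA_homog (i (+) j) (LA_br s t).
Proof.
move=> si tj k n; rewrite -[LA_coord _ _ _]/(tbr (LA_coord s k n) (LA_coord t k n)).
by rewrite (LA_homog_tgr k n si) (LA_homog_tgr k n tj) tbr_tgr.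
Qed.

Lemma LA_homogL i c (s t : LA) : LA_homog i s -> LA_homog i t -> LA_homog i (c *: s + t).
Proof. by move=> si ti k n; rewrite LA_coordP tgrP si ti. Qed.
Lemma LA_homog0 i : LA_homog i (0 : LA).
Proof. by move=> k n; exact: tgr0. Qed.
Lemma LA_homogD i (s t : LA) : LA_homog i s -> LA_homog i t -> LA_homog i (s + t).
Proof. by move=> si ti; rewrite -[s]scale1r; exact: LA_homogL. Qed.
Lemma LA_homogZ i c (s : LA) : LA_homog i s -> LA_homog i (c *: s).
Proof. by move=> si; rewrite -[_ *: _]addr0; apply: LA_homogL => //; exact: LA_homog0. Qed.
Lemma LA_homogN i (s : LA) : LA_homog i s -> LA_homog i (- s).
Proof. by rewrite -scaleN1r; exact: LA_homogZ. Qed.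
Lemma LA_homogB i (s t : LA) : LA_homog i s -> LA_homog i t -> LA_homog i (s - t).
Proof. by move=> si ti; apply: LA_homogD => //; exact: LA_homogN. Qed.

Variables (d : L) (d_odd : homog (gl_gr L) true d).

Lemma LA_incl_homog : LA_homog true (LA_incl A d).
Proof.
move=> k n; rewrite -[LA_coord _ _ _]/(tens (qpi (fl_filt L n) d : quotLie L n) (1 : A k)).
rewrite (tgr_homog true (j := true) (l := false)) //; last exact: aa_one_even.
by rewrite /homog [LHS]qgrE d_odd.
Qed.

Lemma adF n x : x \in fl_filt L n -> gl_br L d x \in fl_filt L n.
Proof. exact: (fl_filt_br (fl_filt0 d)). Qed.

(** The transpose of the differential [d, -]. *)
Definition dstar : cdual L -> cdual L := precomp (T := gl_br L d) adF.
HB.instance Definition _ := GRing.Linear.on dstar.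
Lemma dstarE xi x : dstar xi x = xi (gl_br L d x). Proof. by []. Qed.

Lemma tbr_1 (Q : gLie K) (B : augAlg K) (q : Q) (t : tensor Q B) :
  tbr (tens q 1) t = tmap (gl_br Q q) idfun t.
Proof.
elim/tens_ind: t => [|c y b t IH]; first by rewrite tbr0r tmap0.
rewrite tbrPr tmapP IH tmapE; congr (_ *: _ + _).
rewrite -[y in LHS](z2projD (gl_gr Q)) -[gl_gr Q false y]scale1r tensPl tbrPr.
rewrite !(tbr_homog _ _ (@aa_one_even _ B) (homog_z2proj _ _ _)) /= !scale1r !mul1r.
by rewrite -[tens _ b]scale1r -tensPl scale1r -linearD z2projD.
Qed.

(** The unit is even, so bracketing with d (x) 1 acts on the L-factor alone and
    without signs. *)
Lemma pairing_D xi (t : LA) : pairing xi (LA_br (LA_incl A d) t) = pairing (dstar xi) t.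
Proof.
have [n H] := cd_kills xi; apply: flimP => k; rewrite (pairing_levE k H).
have H' : kills n (dstar xi) by move=> x /adF /H.
rewrite (pairing_levE k H').
rewrite -[LA_coord _ _ _]/(tbr (tens (qpi (fl_filt L n) d : quotLie L n) (1 : A k))
  (LA_coord t k n)).
rewrite tbr_1; apply: (@teval_map K _ _ _ _ _ idfun); elim/quotmW => x.
exact: etrans (congr1 (cbar H) (@qbrE K L n d x)) (etrans (cbarE H _) (esym (cbarE H' x))).
Qed.

End Bracket.

(** * Powers of the augmentation ideal *)

Section AugPow.
Variable K : fieldType.

Lemma aug0 (A : augAlg K) : aug (0 : A) = 0. Proof. exact: (linear0 (aa_aug A)). Qed.
Lemma augD (A : augAlg K) (a b : A) : aug (a + b) = aug a + aug b.
Proof. exact: (linearD (aa_aug A)). Qed.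
Lemma augM (A : augAlg K) (a b : A) : aug (a * b) = aug a * aug b.
Proof. exact: (rmorphM (aa_aug A)). Qed.
Lemma aug_gr (A : augAlg K) i (a : A) : aug a = 0 -> aug (aa_gr A i a) = 0.
Proof.
have odd0 : aug (aa_gr A true a) = 0 by apply: aa_aug_odd; exact: homog_z2proj.
rewrite -{1}(z2projD (aa_gr A) a) augD odd0 addr0.
by case: i.
Qed.

Variable A : augAlg K.

Lemma aug_pow0 n : aug_pow n (0 : A).
Proof. by case: n => // n; exists [::]; rewrite big_nil. Qed.

Lemma aug_powD n (a b : A) : aug_pow n a -> aug_pow n b -> aug_pow n (a + b).
Proof.
case: n => // n [s [sP ->]] [t [tP ->]]; exists (s ++ t); rewrite big_cat; split=> // xy.
by rewrite mem_cat => /orP[/sP|/tP].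
Qed.

Lemma aug_powMl n (a b : A) : aug_pow n b -> aug_pow n (a * b).
Proof.
elim: n b => // n IH b [s [sP ->]].
exists [seq (a * xy.1, xy.2) | xy <- s]; split.
  by move=> _ /mapP[xy /sP[x0 y0] ->]; split=> //=; rewrite augM x0 mulr0.
by rewrite big_map mulr_sumr; apply: eq_bigr => xy _; rewrite mulrA.
Qed.

Lemma aug_powMr n (a b : A) : aug_pow n a -> aug_pow n (a * b).
Proof.
elim: n a => // n IH a [s [sP ->]].
exists [seq (xy.1, xy.2 * b) | xy <- s]; split.
  by move=> _ /mapP[xy /sP[x0 y0] ->]; split=> //=; exact: IH.
by rewrite big_map mulr_suml; apply: eq_bigr => xy _; rewrite mulrA.
Qed.

Lemma aug_powZ n c (a : A) : aug_pow n a -> aug_pow n (c *: a).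
Proof. by move=> an; rewrite -[a]mul1r scalerAl; exact: aug_powMl. Qed.

Lemma aug_powSl n (a b : A) : aug a = 0 -> aug_pow n b -> aug_pow n.+1 (a * b).
Proof.
move=> a0 bn; exists [:: (a, b)]; rewrite big_seq1; split=> // xy.
by rewrite inE => /eqP ->.
Qed.

(** Homogeneous parts of elements of the augmentation ideal stay in it because
    odd elements have augmentation zero. *)
Lemma aug_pow_gr n i (a : A) : aug_pow n a -> aug_pow n (aa_gr A i a).
Proof.
elim: n i a => // n IH i a [s [sP ->]]; rewrite linear_sum big_seq.
elim/big_rec: _ => [|xy x /sP[x0 y0] Hx]; first exact: aug_pow0.
apply: aug_powD => //.
have -> : aa_gr A i (xy.1 * xy.2) = \sum_(j : bool) aa_gr A j xy.1 * aa_gr A (i (+) j) xy.2.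
  have E j k : aa_gr A i (aa_gr A j xy.1 * aa_gr A k xy.2)
      = if i == j (+) k then aa_gr A j xy.1 * aa_gr A k xy.2 else 0.
    by apply: homog_proj; apply: aa_mul_homog; exact: homog_z2proj.
  rewrite -[in LHS](z2projD (aa_gr A) xy.1) -[in LHS](z2projD (aa_gr A) xy.2).
  rewrite mulrDl !mulrDr !linearD /= !E big_bool /=.
  by case: i {E Hx} => /=; rewrite ?addr0 ?add0r // addrC.
rewrite big_bool; apply: aug_powD; apply: aug_powSl; rewrite ?aug_gr //; exact: IH.
Qed.

End AugPow.

Section FormalOrder.
Variables (K : fieldType) (A : formalAlg K).

Lemma aug_pow_lift n m (b : A n) :
  aug_pow m b -> exists2 a : A n.+1, aug_pow m a & fa_tr A n a = b.
Proof.
elim: m b => [|m IH] b.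
  by move=> _; have [a <-] := fa_surj b; exists a.
move=> [s [sP ->]]; rewrite big_seq; elim/big_rec: _ => [|xy x /sP[x0 y0] [a am <-]].
  by exists 0; [exact: aug_pow0 | exact: raddf0].
have [u uE] := fa_surj xy.1; have [v vm vE] := IH _ y0.
exists (u * v + a); last by rewrite raddfD -uE -vE; congr (_ + _);
  exact: (rmorphM (fa_tr A n)).
by apply: aug_powD => //; apply: aug_powSl => //; rewrite -(am_aug (fa_tr A n)) uE.
Qed.

(** The axioms describe only the kernels of the transition maps; but an
    (n+1)-fold product at level n lifts to such a product at level n+1, which the
    transition map kills. *)
Lemma aug_pow_top n (b : A n) : aug_pow n.+1 b -> b = 0.
Proof. by move=> /aug_pow_lift[a am <-]; apply/fa_ker. Qed.

Lemma aug_lev n (a : flim A) : aug (flev n a) = aug a.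
Proof.
elim: n => [//|n <-]; rewrite -[in RHS]flev_tr; apply/esym; exact: am_aug.
Qed.

(** Membership in the k-th closed power of the maximal ideal, that is, in the
    kernel of the map onto level k-1; for k = 0 there is no condition. *)
Definition ford k (a : flim A) := forall j, (j < k)%N -> flev j a = 0.

Lemma ford_S k a : ford k.+1 a <-> flev k a = 0.
Proof.
split=> [H|a0 j]; first exact: H.
by rewrite ltnS => jk; apply: flev0_le a0.
Qed.
Lemma ford_le j k a : (j <= k)%N -> ford k a -> ford j a.
Proof. by move=> jk H i ij; apply: H; apply: leq_trans jk. Qed.
Lemma ford1 a : ford 1 a <-> aug a = 0.
Proof.
rewrite ford_S -(aug_lev 0); split=> [-> | /fa_lev0 //]; exact: aug0.
Qed.
Lemma ford_0 k : ford k 0. Proof. by []. Qed.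
Lemma fordD k a b : ford k a -> ford k b -> ford k (a + b).
Proof. by move=> ak bk j jk; rewrite -[LHS]/(flev j a + flev j b) ak // bk // addr0. Qed.
Lemma fordZ k c a : ford k a -> ford k (c *: a).
Proof. by move=> ak j jk; rewrite flevZ ak // scaler0. Qed.
Lemma ford_sum k I (r : seq I) (F : I -> flim A) :
  (forall i, ford k (F i)) -> ford k (\sum_(i <- r) F i).
Proof. by move=> H; elim/big_rec: _ => // i x _; exact: fordD. Qed.
Lemma ford_gr k i a : ford k a -> ford k (aa_gr (flim A) i a).
Proof. by move=> ak j jk; rewrite flev_gr ak // linear0. Qed.
Lemma fordMl k a b : ford k b -> ford k (a * b).
Proof. by move=> bk j jk; rewrite -[LHS]/(flev j a * flev j b) bk // mulr0. Qed.
Lemma fordMr k a b : ford k a -> ford k (a * b).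
Proof. by move=> ak j jk; rewrite -[LHS]/(flev j a * flev j b) ak // mul0r. Qed.

Lemma ford_pow k a : ford k a -> aug_pow k (flev k a).
Proof. by case: k => // k /ford_S ak; apply/fa_ker; rewrite flev_tr. Qed.

End FormalOrder.

Section FordM.
Variables (K : fieldType) (A : formalAlg K).

Lemma aug_powW (B : augAlg K) m n (a : B) : (m <= n)%N -> aug_pow n a -> aug_pow m a.
Proof.
elim: m n a => // m IH [//|n] a; rewrite ltnS => mn [s [sP ->]].
by exists s; split=> // xy /sP[x0 y0]; split=> //; exact: IH y0.
Qed.

Lemma aug_powM (B : augAlg K) m n (a b : B) :
  aug_pow m a -> aug_pow n b -> aug_pow (m + n) (a * b).
Proof.
move=> + bn; elim: m a => [|m IH] a; first by move=> _; exact: aug_powMl.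
move=> [s [sP ->]]; exists [seq (xy.1, xy.2 * b) | xy <- s]; split.
  by move=> _ /mapP[xy /sP[x0 y0] ->]; split=> //=; exact: IH.
by rewrite big_map mulr_suml; apply: eq_bigr => xy _; rewrite mulrA.
Qed.

(** Induction on the level: the image of a one level below lifts to a k-fold
    product, and the difference lies in the kernel of the transition map, a higher
    power. *)
Lemma ford_pow_ge k m (a : flim A) : (k <= m)%N -> ford k a -> aug_pow k (flev m a).
Proof.
move=> + ak; elim: m => [|m IH]; first by case: k ak.
rewrite leq_eqVlt => /orP[/eqP <-|]; first exact: ford_pow.
rewrite ltnS => km; have [b bk] := aug_pow_lift (IH km).
rewrite -flev_tr => bE.
have /fa_ker am : fa_tr A m (flev m.+1 a - b) = 0 by rewrite raddfB /= bE subrr.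
rewrite -(subrK b (flev m.+1 a)); apply: aug_powD => //.
by apply: aug_powW am; rewrite (leq_trans km).
Qed.

Lemma fordM i j (a b : flim A) : ford i a -> ford j b -> ford (i + j) (a * b).
Proof.
case: i => [|i] ai bj; first exact: fordMl.
case: j bj => [|j] bj; first by rewrite addn0; exact: fordMr.
rewrite addnS; apply/ford_S/aug_pow_top; rewrite rmorphM -addnS.
by apply: aug_powM; apply: ford_pow_ge => //; [exact: leq_addr | rewrite addSnnS leq_addl].
Qed.

End FordM.

(** * The adic filtration of the scalar extension *)

Section Order.
Variables (K : fieldType) (L : filtLie K) (L_fin : fl_finite_type L) (A : formalAlg K).
Local Notation LA := (LA L A).

(** The filtration of the scalar extension induced by the powers of the maximal
    ideal.  It drives all convergence arguments: LA_lim is completeness, LAord_eq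
    separation and LAord_br compatibility with the bracket. *)
Definition LAord k (t : LA) := forall xi, ford k (pairing xi t).

Arguments LAord : simpl never.

Lemma LAord_coord k (t : LA) j : LAord k t -> (j < k)%N -> coord t j = 0.
Proof.
move=> tk jk; apply: (ctens_inj L_fin) => xi.
by rewrite cpair0 -pairing_lev tk.
Qed.
Lemma coord_LAord k (t : LA) : coord t k = 0 -> LAord k.+1 t.
Proof. by move=> t0 xi; apply/ford_S; rewrite pairing_lev t0 cpair0. Qed.

Lemma LAord0 (t : LA) : LAord 0 t. Proof. by []. Qed.
Lemma LAord_0 k : LAord k (0 : LA).
Proof. by move=> xi; rewrite linear0; exact: ford_0. Qed.
Lemma LAordD k (s t : LA) : LAord k s -> LAord k t -> LAord k (s + t).
Proof. by move=> sk tk xi; rewrite linearD; exact: fordD (sk xi) (tk xi). Qed.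
Lemma LAordZ k c (s : LA) : LAord k s -> LAord k (c *: s).
Proof. by move=> sk xi; rewrite [pairing _ _]linearZ; exact: fordZ (sk xi). Qed.
Lemma LAordN k (s : LA) : LAord k s -> LAord k (- s).
Proof. by rewrite -scaleN1r; exact: LAordZ. Qed.
Lemma LAordB k (s t : LA) : LAord k s -> LAord k t -> LAord k (s - t).
Proof. by move=> sk tk; apply: LAordD => //; exact: LAordN. Qed.
Lemma LAord_sum k I (r : seq I) (F : I -> LA) :
  (forall i, LAord k (F i)) -> LAord k (\sum_(i <- r) F i).
Proof.
by move=> H; elim/big_rec: _ => [|i x _]; [exact: LAord_0 | exact: LAordD].
Qed.
Lemma LAord_le j k (t : LA) : (j <= k)%N -> LAord k t -> LAord j t.
Proof. by move=> jk tk xi; exact: ford_le jk (tk xi). Qed.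
Lemma LAord_trans k (s t u : LA) : LAord k (s - t) -> LAord k (t - u) -> LAord k (s - u).
Proof. by move=> st tu; rewrite -(subrK t s) -addrA; exact: LAordD. Qed.
Lemma LAord_sym k (s t : LA) : LAord k (s - t) -> LAord k (t - s).
Proof. by move=> /LAordN; rewrite opprB. Qed.
Lemma LAord_eq (s t : LA) : (forall k, LAord k (s - t)) -> s = t.
Proof.
move=> st; apply/eqP; rewrite -subr_eq0; apply/eqP; apply: invlim_eq => k.
exact: (LAord_coord (st k.+1)).
Qed.

Lemma LAord_br i j (s t : LA) : LAord i s -> LAord j t -> LAord (i + j) (LA_br s t).
Proof.
move=> si tj xi; have [n H] := cd_kills xi; rewrite (pairing_br L_fin _ _ H).
do 4!(apply: ford_sum => ?); do 2!apply: fordZ.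
by apply: fordM; [apply: ford_gr; exact: si | exact: tj].
Qed.

Lemma LA_lim (u : nat -> LA) :
  (forall i, LAord i.+1 (u i.+1 - u i)) ->
  exists t, forall i, LAord i.+1 (t - u i).
Proof.
move=> uC.
have uE k : coord (u k.+1) k = coord (u k) k.
  have := LAord_coord (uC k) (ltnSn k).
  rewrite -[coord (_ - _) k]/(coord (u k.+1) k - coord (u k) k).
  by move/eqP; rewrite subr_eq0 => /eqP.
have tP k : LA_tr L A k (coord (u k.+1) k.+1) = coord (u k) k by rewrite coordP uE.
exists (InvLim tP) => i; apply: coord_LAord.
by rewrite -[LHS]/(coord (u i) i - coord (u i) i) subrr.
Qed.

Lemma LA_homog_lim p (t : LA) :
  (forall k, exists2 u, LA_homog p u & LAord k (t - u)) -> LA_homog p t.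
Proof.
move=> H k n; have [u up tu] := H k.+1.
have e : coord t k = coord u k.
  have := LAord_coord tu (ltnSn k); rewrite -[coord (_ - _) k]/(coord t k - coord u k).
  by move/eqP; rewrite subr_eq0 => /eqP.
by rewrite /LA_coord e; exact: up.
Qed.

End Order.

Arguments LAord {K L A} k t : simpl never.

(** * Exponentials of inner derivations *)

Section Exponential.
Variables (K : fieldType) (charK0 : [pchar K] =i pred0).
Variables (L : filtLie K) (L_fin : fl_finite_type L) (A : formalAlg K).
Local Notation LA := (LA L A).

(** Divided powers of ad l, so that the exponential is their sum and dpowS and
    dpow_leibniz have no binomial coefficients. *)
Definition dpow (l : LA) i (x : LA) : LA := (i`!%:R : K)^-1 *: iter i (LA_br l) x.
Definition exp_trunc (l : LA) n x := \sum_(i < n) dpow l i x.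

Lemma fact_neq0 i : (i`!%:R : K) != 0.
Proof. by rewrite (pcharf0P K).1 // -lt0n fact_gt0. Qed.

Lemma dpow0 l x : dpow l 0 x = x.
Proof. by rewrite /dpow fact0 invr1 scale1r. Qed.

Lemma dpowS l i x : i.+1%:R *: dpow l i.+1 x = LA_br l (dpow l i x).
Proof.
rewrite /dpow [RHS]linearZ scalerA factS natrM invfM mulrA divff ?mul1r //.
by rewrite (pcharf0P K).1.
Qed.

Fact dpow_linear l i : linear (dpow l i).
Proof.
have itL : forall c x y, iter i (LA_br l) (c *: x + y)
    = c *: iter i (LA_br l) x + iter i (LA_br l) y.
  by move=> c x y; elim: i => //= i ->; rewrite linearP.
by move=> c x y; rewrite /dpow itL scalerDr !scalerA mulrC.
Qed.
HB.instance Definition _ l i :=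
  GRing.isLinear.Build K LA LA *:%R (dpow l i) (dpow_linear l i).

Fact exp_trunc_linear l n : linear (exp_trunc l n).
Proof.
move=> c x y; rewrite /exp_trunc scaler_sumr -big_split.
by apply: eq_bigr => i _; rewrite linearP.
Qed.
HB.instance Definition _ l n :=
  GRing.isLinear.Build K LA LA *:%R (exp_trunc l n) (exp_trunc_linear l n).

Lemma exp_truncS l n x : exp_trunc l n.+1 x = exp_trunc l n x + dpow l n x.
Proof. exact: big_ord_recr. Qed.

Lemma iter_ord (l : LA) i k (x : LA) :
  LAord 1 l -> LAord k x -> LAord (i + k) (iter i (LA_br l) x).
Proof.
by move=> l1 xk; elim: i => //= i IH; exact: (LAord_br L_fin l1 IH).
Qed.
Lemma dpow_ord (l : LA) i k (x : LA) : LAord 1 l -> LAord k x -> LAord (i + k) (dpow l i x).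
Proof. by move=> l1 xk; apply: LAordZ; exact: iter_ord. Qed.
Lemma dpow_ord0 (l : LA) i (x : LA) : LAord 1 l -> LAord i (dpow l i x).
Proof. by move=> l1; have := @dpow_ord l i 0 x l1 (LAord0 x); rewrite addn0. Qed.
Lemma exp_trunc_ord (l : LA) n k (x : LA) :
  LAord 1 l -> LAord k x -> LAord k (exp_trunc l n x).
Proof.
move=> l1 xk; apply: LAord_sum => i.
by apply: (LAord_le (leq_addl i k)); exact: dpow_ord.
Qed.

(** The exponential series, with the explicit rate of convergence that holds when
    l has order 1. *)
Definition is_exp (l x y : LA) := forall n, LAord n (y - exp_trunc l n x).

Lemma is_exp_exists (l x : LA) : LAord 1 l -> exists y, is_exp l x y.
Proof.
move=> l1; have [i|y yP] := @LA_lim _ _ L_fin A (fun n => exp_trunc l n.+1 x).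
  by rewrite [exp_trunc l i.+2 x]exp_truncS addrC addKr; exact: dpow_ord0.
by exists y => -[|n]; [exact: LAord0 | exact: yP].
Qed.

Lemma is_exp_exp_ad (l x y : LA) : is_exp l x y -> exp_ad l x y.
Proof.
move=> H k n; exists k.+1 => M kM.
rewrite -[\sum_(i < M) _]/(exp_trunc l M x) /LA_coord.
have := LAord_coord L_fin (H M) kM.
rewrite -[coord (_ - _) k]/(coord y k - coord (exp_trunc l M x) k).
by move/eqP; rewrite subr_eq0 => /eqP ->.
Qed.

Lemma dpow_homog (l : LA) i p (x : LA) :
  LA_homog false l -> LA_homog p x -> LA_homog p (dpow l i x).
Proof.
move=> l0 xp; apply: LA_homogZ; elim: i => //= i IH.
exact: (LA_br_homog l0 IH).
Qed.

Lemma is_exp_homog (l : LA) p (x y : LA) :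
  LA_homog false l -> LA_homog p x -> is_exp l x y -> LA_homog p y.
Proof.
move=> l0 xp xy; apply: (LA_homog_lim L_fin) => k; exists (exp_trunc l k x) => //.
rewrite /exp_trunc; elim/big_rec: _ => [|i z _ zp]; first exact: LA_homog0.
by apply: LA_homogD => //; exact: dpow_homog.
Qed.

Lemma triangle_sum (F : nat -> nat -> LA) n :
  \sum_(k < n) \sum_(i < k.+1) F i (k - i)%N = \sum_(i < n) \sum_(j < n - i) F i j.
Proof.
elim: n => [|n IH]; first by rewrite !big_ord0.
rewrite big_ord_recr IH /= [RHS]big_ord_recr /= subSnn.
rewrite [X in _ + X]big_ord_recr /= subnn addrA; congr (_ + _); last first.
  by rewrite big_ord_recl big_ord0 addr0.
rewrite -big_split; apply: eq_bigr => i _.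
by rewrite subSn 1?ltnW // [RHS]big_ord_recr.
Qed.

(** Square and triangular truncations of a double series differ by terms whose
    total index, hence whose order, is at least n. *)
Lemma triangle_ord (F : nat -> nat -> LA) n :
  (forall i j, (n <= i + j)%N -> LAord n (F i j)) ->
  LAord n (\sum_(i < n) \sum_(j < n) F i j - \sum_(k < n) \sum_(i < k.+1) F i (k - i)%N).
Proof.
move=> H; rewrite triangle_sum -sumrB; apply: LAord_sum => i.
have -> : \sum_(j < n) F i j = \sum_(j < n - i) F i j + \sum_(n - i <= j < n) F i j.
  by rewrite -!(big_mkord xpredT (F i)) -big_cat_nat // leq_subr.
rewrite addrC addKr big_nat; elim/big_rec: _ => [|j x /andP[ij _] Hx]; first exact: LAord_0.
by apply: LAordD => //; apply: H; rewrite -leq_subLR.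
Qed.

Lemma dpow_leibniz (l : LA) k (x y : LA) : LA_homog false l ->
  dpow l k (LA_br x y) = \sum_(i < k.+1) LA_br (dpow l i x) (dpow l (k - i)%N y).
Proof.
move=> l0; elim: k => [|k IH]; first by rewrite big_ord_recl big_ord0 addr0 !dpow0.
have kn0 : (k.+1%:R : K) != 0 by rewrite (pcharf0P K).1.
apply: (scalerI kn0); rewrite dpowS IH linear_sum.
under eq_bigr => i _ do rewrite /= LA_jacobi // -!dpowS.
rewrite big_split /=.
pose G i j := LA_br (dpow l i x) (dpow l j y).
under eq_bigr => i _ do rewrite LA_brZl -/(G i.+1 (k - i)%N).
under [X in _ + X = _]eq_bigr => i _ do rewrite LA_brZr -/(G i (k - i).+1).
have -> : \sum_(i < k.+1) i.+1%:R *: G i.+1 (k - i)%N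
    = \sum_(i < k.+2) i%:R *: G i (k.+1 - i)%N.
  by rewrite [RHS]big_ord_recl scale0r add0r; apply: eq_bigr => i _; rewrite lift0 subSS.
have -> : \sum_(i < k.+1) (k - i).+1%:R *: G i (k - i).+1
    = \sum_(i < k.+2) (k.+1 - i)%:R *: G i (k.+1 - i)%N.
  rewrite [RHS]big_ord_recr /= subnn scale0r addr0; apply: eq_bigr => i _.
  by rewrite subSn // -ltnS.
rewrite -big_split scaler_sumr; apply: eq_bigr => i _ /=.
by rewrite -scalerDl -natrD subnKC // -ltnS.
Qed.

(** The exponential of a derivation is multiplicative: by the Leibniz rule the
    n-th term of the exponential of [s, s] is an antidiagonal sum of the square
    of the series for s. *)
Lemma is_exp_br0 (l s t : LA) : LA_homog false l -> LAord 1 l -> is_exp l s t ->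
  LA_br s s = 0 -> LA_br t t = 0.
Proof.
move=> l0 l1 st ss; apply: (LAord_eq L_fin) => n.
pose P := exp_trunc l n s.
apply: (LAord_trans (t := LA_br P P)).
  have -> : LA_br t t - LA_br P P = LA_br (t - P) t + LA_br P (t - P).
    by rewrite LA_brBl linearB addrA subrK.
  apply: LAordD.
    by rewrite -[n]addn0; apply: (LAord_br L_fin) => //; exact: st.
  by apply: (LAord_br L_fin (i := 0)) => //; exact: st.
have -> : LA_br P P = \sum_(i < n) \sum_(j < n) LA_br (dpow l i s) (dpow l j s).
  rewrite -[LHS]/(LA_rbr P P) {2}/P linear_sum; apply: eq_bigr => i _.
  exact: (linear_sum (LA_br (dpow l i s))).
have := @triangle_ord (fun i j => LA_br (dpow l i s) (dpow l j s)) n.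
rewrite [X in _ - X]big1 => [|k _]; last by rewrite -dpow_leibniz // ss linear0.
apply => i j nij.
by apply: (LAord_le nij); apply: (LAord_br L_fin); exact: dpow_ord0.
Qed.

Lemma dpowN l i x : dpow (- l) i x = (-1) ^+ i *: dpow l i x.
Proof.
have itN : iter i (LA_br (- l)) x = (-1) ^+ i *: iter i (LA_br l) x.
  elim: i => [|i IH]; first by rewrite scale1r.
  rewrite iterS IH LA_brZr LA_brNl.
  by rewrite exprS -scalerA scaleN1r -scalerN.
by rewrite /dpow itN !scalerA mulrC.
Qed.

(** The coefficients of exp(-x) exp(x) = 1, by the binomial theorem for
    (1 - 1)^k. *)
Lemma exp_coef k : \sum_(i < k.+1) (-1) ^+ i * (i`!%:R)^-1 * ((k - i)`!%:R)^-1
  = (k == 0%N)%:R :> K.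
Proof.
apply: (mulfI (fact_neq0 k)).
transitivity ((1 - 1) ^+ k : K); last first.
  by rewrite subrr expr0n; case: eqP => [->|_]; rewrite ?fact0 ?mulr1 ?mulr0.
rewrite exprDn mulr_sumr; apply: eq_bigr => i _.
rewrite expr1n mul1r -[_ *+ 'C(_, _)]mulr_natr -!mulrA mulrCA; congr (_ * _).
have ik : (i <= k)%N by rewrite -ltnS.
by rewrite -(bin_fact ik) !natrM -mulrA mulrACA mulfV ?fact_neq0 // mulfV ?fact_neq0 // !mulr1.
Qed.

Lemma dpow_comp l i j x : dpow l i (dpow l j x) =
  ((i`!%:R)^-1 * (j`!%:R)^-1) *: iter (i + j) (LA_br l) x.
Proof.
rewrite /dpow iterD -[RHS]scalerA; congr (_ *: _).
elim: i => //= i ->; exact: LA_brZr.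
Qed.

Lemma is_exp_inv (l s t : LA) : LAord 1 l -> is_exp l s t -> is_exp (- l) t s.
Proof.
move=> l1 st n.
have Nl1 : LAord 1 (- l) by exact: LAordN.
apply: (LAord_trans (t := exp_trunc (- l) n (exp_trunc l n s))); last first.
  by rewrite -linearB; apply: exp_trunc_ord => //; apply: LAord_sym; exact: st.
apply: LAord_sym.
pose F i j := dpow (- l) i (dpow l j s).
have -> : exp_trunc (- l) n (exp_trunc l n s) = \sum_(i < n) \sum_(j < n) F i j.
  by apply: eq_bigr => i _; exact: (linear_sum (dpow (- l) i)).
case: n => [|n] //; apply: LAord_trans (triangle_ord (F := F) _) _.
  by move=> i j nij; apply: (LAord_le nij); apply: dpow_ord => //; exact: dpow_ord0.
have e k : \sum_(i < k.+1) F i (k - i)%N = (k == 0%N)%:R *: iter k (LA_br l) s.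
  rewrite -exp_coef scaler_suml; apply: eq_bigr => i _.
  rewrite /F dpowN dpow_comp subnKC -1?ltnS // scalerA; congr (_ *: _).
  by rewrite mulrA.
rewrite big_ord_recl [X in _ + X - _]big1 => [|i _]; last by rewrite (e i.+1) scale0r.
by rewrite (e 0%N) scale1r addr0 subrr; exact: LAord_0.
Qed.

End Exponential.

(** * Gauge fixing *)

Section Homotopy.
Variables (K : fieldType) (L : filtLie K) (d : L) (d_odd : homog (gl_gr L) true d).
Local Notation C := (cdual L).

Lemma dstar_gr i (xi : C) : dstar d (cgr i xi) = cgr (~~ i) (dstar d xi).
Proof.
apply: cdualP => x; rewrite dstarE !cgrE dstarE.
have E j : homog (gl_gr L) (~~ j) (gl_br L d (gl_gr L j x)).
  by apply: (gl_br_homog d_odd); exact: homog_z2proj.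
have Dx : gl_br L d x = gl_br L d (gl_gr L false x) + gl_br L d (gl_gr L true x).
  by rewrite -linearDr z2projD.
rewrite Dx [gl_gr L i _]linearD (homog_proj i (E false)) (homog_proj i (E true)).
by case: i => /=; rewrite ?addr0 ?add0r.
Qed.

(** The transpose of a partial inverse of the differential.  The odd part of any
    generalized inverse of dstar will do, since dstar itself is odd. *)
Lemma homotopy_exists : exists h : {linear C -> C},
  (forall xi, dstar d (h (dstar d xi)) = dstar d xi) /\
  (forall i xi, h (cgr i xi) = cgr (~~ i) (h xi)).
Proof.
have [g gP] := generalized_inverse (dstar d : {linear C -> C}).
pose h0 xi := cgr false (g (cgr true xi)) + cgr true (g (cgr false xi)).
have h0L : linear h0.
  by move=> a x y; rewrite /h0 !linearP scalerDr addrACA.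
pose h : {linear C -> C} := HB.pack h0 (GRing.isLinear.Build _ _ _ *:%R h0 h0L).
exists h; split=> [xi|i xi]; rewrite /= /h0.
  have G i : cgr (~~ i) (dstar d (g (cgr (~~ i) (dstar d xi)))) = cgr (~~ i) (dstar d xi).
    by rewrite -(dstar_gr i xi) gP /= dstar_gr cgrK eqxx.
  by rewrite linearD /= !dstar_gr (G false) (G true) addrC cgrD.
by case: i; rewrite linearD /= !cgrK /= !linear0 ?addr0 ?add0r.
Qed.
End Homotopy.

Section GaugeFixing.
Variables (K : fieldType) (L : filtLie K) (L_fin : fl_finite_type L).
Variables (d : L) (d_odd : homog (gl_gr L) true d).
Local Notation C := (cdual L).
Variable h : {linear C -> C}.
Hypothesis hD : forall xi, dstar d (h (dstar d xi)) = dstar d xi.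
Hypothesis h_gr : forall i xi, h (cgr i xi) = cgr (~~ i) (h xi).
Variable A : formalAlg K.
Local Notation LA := (LA L A).
Local Notation D := (LA_br (LA_incl A d)).

Definition LA_h (t : LA) : LA := LA_of L_fin (pairing_map t \o h : {linear C -> flim A}).
Lemma pairing_h xi t : pairing xi (LA_h t) = pairing (h xi) t.
Proof. exact: pairing_of. Qed.
Fact LA_h_linear : linear LA_h.
Proof.
by move=> c s t; apply: (LA_inj L_fin) => xi; rewrite linearP /= !pairing_h linearP.
Qed.
HB.instance Definition _ := GRing.isLinear.Build K LA LA *:%R LA_h LA_h_linear.

(** D LA_h is a projection onto the image of D; its kernel is a complement that is
    the same for all base algebras. *)
Lemma DhD t : D (LA_h (D t)) = D t.
Proof. by apply: (LA_inj L_fin) => xi; rewrite pairing_D pairing_h !pairing_D hD. Qed.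

Lemma LA_h_ord k t : LAord k t -> LAord k (LA_h t).
Proof. by move=> tk xi; rewrite pairing_h; exact: tk. Qed.

Lemma LA_h_homog i t : LA_homog i t -> LA_homog (~~ i) (LA_h t).
Proof.
move=> /(LA_homogP L_fin) ti; apply/(LA_homogP L_fin) => xi j.
by rewrite pairing_h h_gr; have := ti (h xi) (~~ j); rewrite addbN -addNb.
Qed.

Variable s : LA.
Hypothesis s_odd : LA_homog true s.
Hypothesis s_ord : LAord 1 (s - LA_incl A d).

(** The first-order term of the exponential is only as close as l and l' are;
    from the second on, one more factor of order 1 is gained. *)
Lemma iter_diff k (l l' : LA) : LAord 1 l -> LAord 1 l' -> LAord k (l - l') -> forall i,
  LAord k (iter i (LA_br l) s - iter i (LA_br l') s) /\
  LAord k.+1 (iter i.+2 (LA_br l) s - iter i.+2 (LA_br l') s).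
Proof.
move=> l1 l1' lk.
have E i : iter i.+1 (LA_br l) s - iter i.+1 (LA_br l') s =
   LA_br l (iter i (LA_br l) s - iter i (LA_br l') s)
   + LA_br (l - l') (iter i (LA_br l') s).
  by rewrite !iterS LA_brBl linearB addrA subrK.
have H i : LAord k (iter i (LA_br l) s - iter i (LA_br l') s).
  elim: i => [|i IH]; first by rewrite subrr; exact: LAord_0.
  rewrite E; apply: LAordD.
    exact: (LAord_le (leqnSn k)) (LAord_br L_fin l1 IH).
  by have := LAord_br L_fin lk (LAord0 (iter i (LA_br l') s)); rewrite addn0.
move=> i; split=> //; rewrite E; apply: LAordD.
  exact: (LAord_br L_fin l1 (H i.+1)).
rewrite -addn1; apply: (LAord_br L_fin lk).
by have := @iter_ord K L L_fin A l' i.+1 0 s l1' (LAord0 s); rewrite addn0; apply: LAord_le.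
Qed.

(** To first order exp(ad l) s changes l by -D l, which the summand D l cancels;
    what remains involves l together with s - d or with a second l, so it gains one
    order. *)
Lemma gauge_contract k (l l' t t' : LA) :
  LA_homog false l -> LA_homog false l' -> LAord 1 l -> LAord 1 l' -> LAord k.+1 (l - l') ->
  is_exp l s t -> is_exp l' s t' ->
  LAord k.+2 ((t + D l) - (t' + D l')).
Proof.
move=> l0 l0' l1 l1' lk lt lt'.
pose P := exp_trunc l k.+2 s; pose P' := exp_trunc l' k.+2 s.
have S a b : a + D l - (b + D l') = (a - b) + (D l - D l') by rewrite opprD addrACA.
rewrite -[_ - _]subr0; apply: (LAord_trans (t := P + D l - (P' + D l'))).
  have -> : t + D l - (t' + D l') - (P + D l - (P' + D l')) = (t - P) - (t' - P').
    rewrite !S opprD addrACA subrr addr0 !opprB.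
    by rewrite [P' - P]addrC addrACA [- t' + P']addrC.
  by apply: LAordB; [exact: lt | exact: lt'].
rewrite subr0 S.
have PE : P - P' = LA_br (l - l') s
    + \sum_(i < k) (dpow l i.+2 s - dpow l' i.+2 s).
  rewrite /P /P' /exp_trunc -sumrB !big_ord_recl /= !dpow0 subrr add0r; congr (_ + _).
  by rewrite /dpow /= invr1 !scale1r LA_brBl.
rewrite PE addrAC; apply: LAordD; last first.
  apply: LAord_sum => i; rewrite /dpow -scalerBr; apply: LAordZ.
  exact: (iter_diff l1 l1' lk i).2.
have -> : D l - D l' = - LA_br (l - l') (LA_incl A d).
  by rewrite -linearB (LA_anti _ (LA_homogB l0 l0')) opprK.
by rewrite -linearB -addn1; exact: LAord_br.
Qed.

(** Solve l = h (exp(ad l) s - d + D l) by iterating the right-hand side, which is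
    contracting by gauge_contract.  Applying D to the equation and using
    D h D = D gives D h (exp(ad l) s - d) = 0.  Solving for l at once avoids
    composing infinitely many exponentials, and with it the
    Baker-Campbell-Hausdorff formula. *)
Theorem gauge_fixing : exists l t, [/\ LA_homog false l, LAord 1 l, is_exp l s t &
  D (LA_h (t - LA_incl A d)) = 0].
Proof.
pose ok (l : LA) := LA_homog false l /\ LAord 1 l.
have ex l : exists t, ok l -> is_exp l s t.
  have [[_ l1]|nl] := pselect (ok l); last by exists 0 => /nl.
  by have [t lt] := is_exp_exists L_fin s l1; exists t.
(* only the values of E at even l of order 1 matter *)
have [E EP] := choice ex.
pose Psi l := LA_h (E l + D l - LA_incl A d).
have d1 := LA_incl_homog A d_odd.
have Psi_ok l : ok l -> ok (Psi l).
  move=> l_ok; have lE := EP _ l_ok; have [l0 l1] := l_ok; split.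
    apply: (LA_h_homog (i := true)); apply: LA_homogB => //; apply: LA_homogD.
      exact: (is_exp_homog L_fin l0 s_odd lE).
    exact: (LA_br_homog d1 l0).
  apply: LA_h_ord; rewrite addrAC; apply: LAordD.
    apply: LAord_trans s_ord; have := lE 1%N.
    by rewrite /exp_trunc big_ord1 dpow0.
  exact: (LAord_br L_fin (LAord0 (LA_incl A d)) l1).
have Psi_contract k l l' : ok l -> ok l' -> LAord k.+1 (l - l') -> LAord k.+2 (Psi l - Psi l').
  move=> lo lo' ll; rewrite -linearB; apply: LA_h_ord; rewrite opprB addrA subrK.
  have [l0 l1] := lo; have [l0' l1'] := lo'.
  exact: gauge_contract ll (EP _ lo) (EP _ lo').
pose u i := iter i Psi 0.
have ok0 : ok 0 by split; [exact: LA_homog0 | exact: LAord_0].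
have u_ok i : ok (u i) by elim: i => //= i; exact: Psi_ok.
have uC i : LAord i.+1 (u i.+1 - u i).
  elim: i => [|i IH]; last exact: (Psi_contract _ _ _ (u_ok i.+1) (u_ok i) IH).
  by apply: LAordB; [exact: (u_ok 1%N).2 | exact: (u_ok 0%N).2].
have [l lP] := LA_lim L_fin uC.
have l_ok : ok l.
  split; last by rewrite -(subrK (u 0%N) l); apply: LAordD; [exact: lP | exact: (u_ok 0%N).2].
  apply: (LA_homog_lim L_fin) => k; exists (u k); first exact: (u_ok k).1.
  exact: LAord_le (leqnSn k) (lP k).
have fix_l : l = Psi l.
  apply: (LAord_eq L_fin) => k; apply: (LAord_trans (t := u k.+1)).
    exact: LAord_le (leqW (leqnSn k)) (lP k.+1).
  apply: (LAord_le (leqW (leqnSn k))); apply: Psi_contract => //.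
  exact/LAord_sym/lP.
exists l, (E l); split; try exact: l_ok.1; try exact: l_ok.2; first exact: EP.
have -> : E l - LA_incl A d = (E l + D l - LA_incl A d) - D l by rewrite addrAC addrK.
by rewrite linearB /= -/(Psi l) -fix_l linearB /= DhD subrr.
Qed.

End GaugeFixing.

(** * The free associative algebra *)

Section FreeModule.
Variables (K : fieldType) (T : choiceType).
Local Notation F := {freeg T / K}.

Lemma freeg_genZ (c : K) (x : T) : << c *g x >> = c *: (<< x >> : F).
Proof. by apply/eqP/freeg_eqP => y; rewrite coeffZ !coeffU mul1r. Qed.

Lemma freeg_lin_ind (P : F -> Prop) :
  P 0 -> (forall c x f, P f -> P (c *: << x >> + f)) -> forall f, P f.
Proof.
move=> P0 PS f; rewrite -[f]freeg_sumE; elim/big_rec: _ => // x g _ Pg.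
by rewrite freeg_genZ; exact: PS.
Qed.

Variables (W : lmodType K) (h : T -> W).

Fact freeg_lift_linear : linear (fglift h : F -> W).
Proof.
have addL := lift_is_additive h.
pose g : {additive F -> W} :=
  HB.pack (fglift h : F -> W) (GRing.isZmodMorphism.Build F W (fglift h) addL).
have gZ a D : g (a *: D) = a *: g D.
  elim/freeg_lin_ind: D => [|c x D IH]; first by rewrite scaler0 !(raddf0 g) scaler0.
  rewrite scalerDr !(raddfD g) scalerDr IH; congr (_ + _).
  by rewrite scalerA -!freeg_genZ /g /= !liftU scalerA.
by move=> a D D'; rewrite -[fglift h]/(g : _ -> _) raddfD gZ.
Qed.

Definition freeg_lift : {linear F -> W} :=
  HB.pack (fglift h : F -> W)
    (GRing.isLinear.Build K F W *:%R (fglift h) freeg_lift_linear).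

Lemma freeg_lift_gen x : freeg_lift << x >> = h x.
Proof. by rewrite /= liftU scale1r. Qed.

End FreeModule.

Section FreeAlgebra.
Variables (K : fieldType) (X : choiceType).

Definition words : Type := {freeg (seq X) / K}.
HB.instance Definition _ := GRing.Lmodule.on words.
Local Notation F := words.

Definition word (s : seq X) : F := << s >>.

Lemma words_ind (P : F -> Prop) :
  P 0 -> (forall c s f, P f -> P (c *: word s + f)) -> forall f, P f.
Proof. exact: freeg_lin_ind. Qed.

Definition wlift (W : lmodType K) (h : seq X -> W) : F -> W := freeg_lift h.
HB.instance Definition _ W h := GRing.Linear.on (@wlift W h).
Lemma wlift_word (W : lmodType K) (h : seq X -> W) s : wlift h (word s) = h s.
Proof. exact: freeg_lift_gen. Qed.
Lemma wliftP (W : lmodType K) (h : seq X -> W) a f g :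
  wlift h (a *: f + g) = a *: wlift h f + wlift h g.
Proof. exact: linearP. Qed.
Lemma wlift0 (W : lmodType K) (h : seq X -> W) : wlift h 0 = 0.
Proof. exact: linear0. Qed.

Definition wmul (f g : F) : F := wlift (fun s => wlift (fun t => word (s ++ t)) g) f.

Lemma wmulPl a f f' g : wmul (a *: f + f') g = a *: wmul f g + wmul f' g.
Proof. exact: wliftP. Qed.
Lemma wmul0l g : wmul 0 g = 0. Proof. exact: wlift0. Qed.
Lemma wmul_wl s g : wmul (word s) g = wlift (fun t => word (s ++ t)) g.
Proof. exact: wlift_word. Qed.
Lemma wmulPr a f g g' : wmul f (a *: g + g') = a *: wmul f g + wmul f g'.
Proof.
elim/words_ind: f => [|c s f IH]; first by rewrite !wmul0l scaler0 addr0.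
rewrite !wmulPl IH !wmul_wl wliftP !scalerDr !scalerA addrACA.
by rewrite [c * a]mulrC.
Qed.
Lemma wmul0r f : wmul f 0 = 0.
Proof. by have := wmulPr (-1) f 0 0; rewrite scaler0 addr0 scaleN1r addNr. Qed.
Lemma wmul_ww s t : wmul (word s) (word t) = word (s ++ t).
Proof. by rewrite wmul_wl wlift_word. Qed.

Fact wmulA : associative wmul.
Proof.
move=> f g h; elim/words_ind: f => [|c s f IH]; first by rewrite !wmul0l.
rewrite !wmulPl IH; congr (_ *: _ + _) => {IH f c}.
elim/words_ind: g => [|c t g IH]; first by rewrite !(wmul0l, wmul0r).
rewrite !(wmulPl, wmulPr) IH; congr (_ *: _ + _) => {IH g c}.
elim/words_ind: h => [|c u h IH]; first by rewrite !wmul0r.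
by rewrite !wmulPr IH !wmul_ww catA.
Qed.
Fact wmul1l : left_id (word [::]) wmul.
Proof.
move=> f; elim/words_ind: f => [|c s f IH]; first by rewrite wmul0r.
by rewrite wmulPr IH wmul_ww.
Qed.
Fact wmul1r : right_id (word [::]) wmul.
Proof.
move=> f; elim/words_ind: f => [|c s f IH]; first by rewrite wmul0l.
by rewrite wmulPl IH wmul_ww cats0.
Qed.
Fact wmulDl : left_distributive wmul +%R.
Proof. by move=> f f' g; rewrite -[f]scale1r wmulPl !scale1r. Qed.
Fact wmulDr : right_distributive wmul +%R.
Proof. by move=> f g g'; rewrite -[g]scale1r wmulPr !scale1r. Qed.
Fact word_nil_neq0 : word [::] != 0.
Proof.
apply/eqP => /(congr1 (wlift (fun _ => 1 : K^o))); rewrite wlift_word wlift0.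
by move/eqP; rewrite oner_eq0.
Qed.
HB.instance Definition _ := GRing.Zmodule_isNzRing.Build F
  wmulA wmul1l wmul1r wmulDl wmulDr word_nil_neq0.
Fact wscaleAl (c : K) (f g : F) : c *: (f * g) = (c *: f) * g.
Proof. by rewrite -[c *: f]addr0 [RHS]wmulPl wmul0l addr0. Qed.
HB.instance Definition _ := GRing.Lmodule_isLalgebra.Build K F wscaleAl.
Fact wscaleAr (c : K) (f g : F) : c *: (f * g) = f * (c *: g).
Proof. by rewrite -[c *: g]addr0 [RHS]wmulPr wmul0r addr0. Qed.
HB.instance Definition _ := GRing.Lalgebra_isAlgebra.Build K F wscaleAr.

(** Linear independence of the words is expressed by the possibility of extending
    functions on words linearly, which is how it is used. *)
Record is_free_algebra (E : algType K) (w : seq X -> E) : Prop := IsFreeAlgebra {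
  free_nil : w [::] = 1;
  free_cat : forall s t, w (s ++ t) = w s * w t;
  free_ind : forall P : E -> Prop, P 0 -> (forall c s f, P f -> P (c *: w s + f)) ->
    forall f, P f;
  free_lift : forall (W : lmodType K) (h : seq X -> W),
    exists g : {linear E -> W}, forall s, g (w s) = h s }.

Lemma free_algebra_exists : exists (E : algType K) (w : seq X -> E), is_free_algebra w.
Proof.
exists words, word; split.
- by [].
- by move=> s t; apply/esym/wmul_ww.
- exact: words_ind.
- by move=> W h; exists (wlift h) => s; exact: wlift_word.
Qed.

End FreeAlgebra.

(** * Parity and evaluation on the free algebra *)

Section Ground.
Variable K : fieldType.
Definition ground_proj (i : bool) (c : K^o) : K^o := if i then 0 else c.
Fact ground_proj_linear i : linear (ground_proj i).
Proof. by case: i => a x y; rewrite /ground_proj // scaler0 addr0. Qed.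
HB.instance Definition _ i :=
  GRing.isLinear.Build K K^o K^o *:%R (ground_proj i) (ground_proj_linear i).
Fact ground_projD c : ground_proj false c + ground_proj true c = c.
Proof. exact: addr0. Qed.
Fact ground_projK i j c :
  ground_proj i (ground_proj j c) = if i == j then ground_proj j c else 0.
Proof. by case: i; case: j. Qed.
Definition ground_gr : z2grading K^o :=
  @Z2Grading K K^o ground_proj ground_projD ground_projK.
Fact ground_mul_homog i j (a b : K^o) : homog ground_gr i a -> homog ground_gr j b ->
  homog ground_gr (i (+) j) (a * b).
Proof.
rewrite /homog /= /ground_proj.
by case: i => [<-|_]; case: j => [<-|_]; rewrite /= ?mul0r ?mulr0.
Qed.
Fact ground_comm i j (a b : K^o) : homog ground_gr i a -> homog ground_gr j b ->
  a * b = (-1) ^+ (i && j) *: (b * a).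
Proof.
rewrite /homog /= /ground_proj.
by case: i => [<-|_]; case: j => [<-|_]; rewrite /= ?mul0r ?mulr0 ?scaler0 // scale1r mulrC.
Qed.
Fact ground_odd (a : K^o) : homog ground_gr true a -> (idfun a : K^o) = 0.
Proof. by rewrite /homog /= /ground_proj => <-. Qed.
(** The ground field as an augmented algebra, so that the augmentation of the free
    algebra is one of its evaluations. *)
Definition ground_aug : augAlg K :=
  @AugAlg K K^o ground_gr erefl ground_mul_homog ground_comm idfun ground_odd.
End Ground.

Section FreeGraded.
Variables (K : fieldType) (X : choiceType) (parity : X -> bool).
Variables (F : algType K) (w : seq X -> F) (Fw : is_free_algebra w).

Definition free_lin (W : lmodType K) (h : seq X -> W) : {linear F -> W} :=
  sval (cid (free_lift Fw h)).
Lemma free_linE (W : lmodType K) (h : seq X -> W) s : free_lin h (w s) = h s.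
Proof. by rewrite /free_lin; case: cid. Qed.

Lemma free_ext (W : lmodType K) (f g : {linear F -> W}) :
  (forall s, f (w s) = g (w s)) -> f =1 g.
Proof.
move=> fg; elim/(free_ind Fw) => [|c s u IH]; first by rewrite !linear0.
by rewrite !linearP fg IH.
Qed.

Definition word_parity (s : seq X) := foldr (fun x b => parity x (+) b) false s.
Lemma word_parity_cat s t : word_parity (s ++ t) = word_parity s (+) word_parity t.
Proof. by elim: s => //= x s ->; rewrite addbA. Qed.

Definition wproj i : {linear F -> F} :=
  free_lin (fun s => if word_parity s == i then w s else 0).

Lemma wproj_word i s : wproj i (w s) = if word_parity s == i then w s else 0.
Proof. exact: free_linE. Qed.

Fact wprojD f : wproj false f + wproj true f = f.
Proof.
elim/(free_ind Fw): f => [|c s f IH]; first by rewrite !linear0 addr0.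
rewrite !linearP addrACA IH -scalerDr !wproj_word.
by case: (word_parity s); rewrite /= ?addr0 ?add0r.
Qed.
Fact wprojK i j f : wproj i (wproj j f) = if i == j then wproj j f else 0.
Proof.
elim/(free_ind Fw): f => [|c s f IH]; first by rewrite !linear0; case: ifP.
have E : wproj i (if word_parity s == j then w s else 0)
    = if i == j then (if word_parity s == j then w s else 0) else 0.
  case: (eqVneq (word_parity s) j) => [<-|_]; first by rewrite wproj_word eq_sym.
  by rewrite linear0; case: ifP.
rewrite !linearP IH !wproj_word E.
by case: ifP => _; rewrite ?scaler0 ?addr0.
Qed.

Definition free_gr : z2grading F := @Z2Grading K F wproj wprojD wprojK.

Lemma wproj_mul f g i j : homog free_gr i f -> homog free_gr j g ->
  homog free_gr (i (+) j) (f * g).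
Proof.
have E : wproj (i (+) j) (wproj i f * wproj j g) = wproj i f * wproj j g.
  elim/(free_ind Fw): f => [|c s f IH]; first by rewrite linear0 mul0r linear0.
  rewrite linearP mulrDl -scalerAl linearP IH; congr (_ *: _ + _) => {IH f c}.
  elim/(free_ind Fw): g => [|c t g IH]; first by rewrite linear0 mulr0 linear0.
  rewrite linearP mulrDr -scalerAr linearP IH; congr (_ *: _ + _) => {IH g c}.
  rewrite !wproj_word; case: eqP => [<-|_]; last by rewrite mul0r linear0.
  case: eqP => [<-|_]; last by rewrite mulr0 linear0.
  by rewrite -(free_cat Fw) wproj_word word_parity_cat eqxx.
by move=> fi gj; rewrite /homog -[in LHS]fi -[in LHS]gj [LHS]E [X in X * _]fi [X in _ * X]gj.
Qed.

Lemma free_one_homog : homog free_gr false 1.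
Proof. by rewrite /homog /= -(free_nil Fw) wproj_word. Qed.

Section Eval.
Variables (E : augAlg K) (v : X -> E).
Definition free_eval : {linear F -> E} := free_lin (fun s => \prod_(x <- s) v x).
Lemma free_eval_word s : free_eval (w s) = \prod_(x <- s) v x.
Proof. exact: free_linE. Qed.
Lemma free_eval1 : free_eval 1 = 1.
Proof. by rewrite -(free_nil Fw) free_eval_word big_nil. Qed.
Lemma free_eval_letter x : free_eval (w [:: x]) = v x.
Proof. by rewrite free_eval_word big_seq1. Qed.
Lemma free_evalM f g : free_eval (f * g) = free_eval f * free_eval g.
Proof.
elim/(free_ind Fw): f => [|c s f IH]; first by rewrite mul0r linear0 mul0r.
rewrite mulrDl -scalerAl !linearP IH mulrDl -scalerAl; congr (_ *: _ + _) => {IH f c}.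
elim/(free_ind Fw): g => [|c t g IH]; first by rewrite mulr0 linear0 mulr0.
rewrite mulrDr -scalerAr !linearP IH mulrDr -scalerAr; congr (_ *: _ + _) => {IH g c}.
by rewrite -(free_cat Fw) !free_eval_word big_cat.
Qed.

Hypothesis v_homog : forall x, homog (aa_gr E) (parity x) (v x).
Lemma free_eval_homog_word s : homog (aa_gr E) (word_parity s) (free_eval (w s)).
Proof.
elim: s => [|x s IH]; first by rewrite (free_nil Fw) free_eval1; exact: aa_one_even.
rewrite -cat1s (free_cat Fw) free_evalM free_eval_letter /=; exact: aa_mul_homog.
Qed.
Lemma free_eval_gr i f : free_eval (wproj i f) = aa_gr E i (free_eval f).
Proof.
elim/(free_ind Fw): f => [|c s f IH]; first by rewrite !linear0.
rewrite !linearP IH wproj_word; congr (_ *: _ + _).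
by rewrite (homog_proj i (free_eval_homog_word s)) eq_sym; case: eqP => // _; rewrite linear0.
Qed.
Lemma free_eval_homog i f : homog free_gr i f -> homog (aa_gr E) i (free_eval f).
Proof. by move=> fi; rewrite /homog -free_eval_gr [wproj i f]fi. Qed.
End Eval.

Definition free_aug : {linear F -> ground_aug K} := free_eval (fun _ => 0 : ground_aug K).
Lemma free_aug_homog x : homog (aa_gr (ground_aug K)) (parity x) 0.
Proof. by rewrite /homog linear0. Qed.

Lemma free_eval_aug (E : augAlg K) (v : X -> E) : (forall x, aug (v x) = 0) ->
  forall f, aug (free_eval v f) = free_aug f.
Proof.
move=> v0; apply: (@free_ext K^o (aa_aug E \o free_eval v) free_aug) => s.
rewrite /= !free_eval_word; elim: s => [|x s IH]; first by rewrite !big_nil rmorph1.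
have v0x : aa_aug E (v x) = 0 by exact: v0.
by rewrite !big_cons mul0r rmorphM /= v0x mul0r.
Qed.

(** The same recursion as aug_pow, for the free algebra, which is not
    graded-commutative and so not an augmented algebra. *)
Fixpoint free_pow n (f : F) : Prop :=
  if n is n'.+1 then
    exists s : seq (F * F),
      (forall xy, xy \in s -> free_aug xy.1 = 0 /\ free_pow n' xy.2)
      /\ f = \sum_(xy <- s) xy.1 * xy.2
  else True.

Lemma free_powW m n f : (m <= n)%N -> free_pow n f -> free_pow m f.
Proof.
elim: m n f => // m IH [//|n] f; rewrite ltnS => mn [s [sP ->]].
by exists s; split=> // xy /sP[x0 y0]; split=> //; exact: IH y0.
Qed.

Lemma free_pow_aug n f : free_pow n.+1 f -> free_aug f = 0.
Proof.
move=> [s [sP ->]]; rewrite linear_sum big_seq big1 // => xy /sP[x0 _].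
by rewrite /= [free_aug _]free_evalM -/(free_aug _) x0 mul0r.
Qed.

Lemma free_eval_pow (E : augAlg K) (v : X -> E) : (forall x, aug (v x) = 0) ->
  forall n f, free_pow n f -> aug_pow n (free_eval v f).
Proof.
move=> v0; elim=> // n IH f [s [sP ->]].
exists [seq (free_eval v xy.1, free_eval v xy.2) | xy <- s]; split.
  by move=> _ /mapP[xy /sP[x0 y0] ->]; split; [rewrite free_eval_aug | exact: IH].
by rewrite big_map linear_sum; apply: eq_bigr => xy _; exact: free_evalM.
Qed.

Record homog_ideal (J : F -> Prop) : Prop := HomogIdeal {
  hi_0 : J 0;
  hi_P : forall a f g, J f -> J g -> J (a *: f + g);
  hi_Ml : forall f g, J g -> J (f * g);
  hi_Mr : forall f g, J f -> J (f * g);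
  hi_gr : forall i f, J f -> J (wproj i f) }.

(** The ideals whose quotients are augmented algebras. *)
Record graded_ideal (J : F -> Prop) : Prop := GradedIdeal {
  gi_h :> homog_ideal J;
  gi_aug : forall f, J f -> free_aug f = 0;
  gi_comm : forall i j f g, homog free_gr i f -> homog free_gr j g ->
    J (f * g - (-1) ^+ (i && j) *: (g * f)) }.

Lemma ker_homog_ideal (E : augAlg K) (psi : {linear F -> E}) :
  (forall f g, psi (f * g) = psi f * psi g) ->
  (forall i f, psi (wproj i f) = aa_gr E i (psi f)) ->
  homog_ideal (fun f => psi f = 0).
Proof.
move=> psiM psi_gr; split.
- exact: linear0.
- by move=> a f g f0 g0; rewrite linearP f0 g0 scaler0 addr0.
- by move=> f g g0; rewrite psiM g0 mulr0.
- by move=> f g f0; rewrite psiM f0 mul0r.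
by move=> i f f0; rewrite psi_gr f0 linear0.
Qed.

End FreeGraded.

(** * Graded-commutative quotients of the free algebra *)

Section Quotient.
Variables (K : fieldType) (X : choiceType) (parity : X -> bool).
Variables (F : algType K) (w : seq X -> F) (Fw : is_free_algebra w).
Variables (J : F -> Prop) (HJ : graded_ideal parity Fw J).
Local Notation wproj := (wproj parity Fw).
Local Notation free_aug := (free_aug Fw).

Definition ideal_pred : {pred F} := fun f => `[< J f >].
Fact ideal_closed : submod_closed ideal_pred.
Proof.
split; first by apply/asboolP; exact: hi_0 HJ.
by move=> a f g /asboolP Jf /asboolP Jg; apply/asboolP; exact: hi_P HJ _ _ _ Jf Jg.
Qed.
Definition ideal : submodClosed F :=
  HB.pack ideal_pred (GRing.isSubmodClosed.Build K F ideal_pred ideal_closed).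

Definition qalg_sort : Type := quotm ideal.
HB.instance Definition _ := GRing.Lmodule.on qalg_sort.
Definition qclass (f : F) : qalg_sort := qpi ideal f.
Fact qclass_linear : linear qclass. Proof. exact: (qpi_linear ideal). Qed.
HB.instance Definition _ := GRing.isLinear.Build K F qalg_sort *:%R qclass qclass_linear.

Lemma qclass_eq f g : J (f - g) <-> qclass f = qclass g.
Proof.
split=> [Jfg|/qpiP /asboolP//]; by apply/qpiP/asboolP.
Qed.
Lemma qclass0 f : J f <-> qclass f = 0.
Proof. by rewrite -[f in J f]subr0 qclass_eq linear0. Qed.
Lemma qclass_repr (q : qalg_sort) : qclass (qrepr q) = q.
Proof. exact: qreprK. Qed.
Lemma qclassW (P : qalg_sort -> Prop) : (forall f, P (qclass f)) -> forall q, P q.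
Proof. exact: quotmW. Qed.
Lemma qclassD f g : qclass (f + g) = qclass f + qclass g. Proof. exact: linearD. Qed.
Lemma qclassZ a f : qclass (a *: f) = a *: qclass f. Proof. exact: linearZ. Qed.

Definition qmul (p q : qalg_sort) : qalg_sort := qclass (qrepr p * qrepr q).
Lemma qmulE f g : qmul (qclass f) (qclass g) = qclass (f * g).
Proof.
set f' := qrepr (qclass f); set g' := qrepr (qclass g).
have Jf : J (f' - f) by apply/qclass_eq; exact: qclass_repr.
have Jg : J (g' - g) by apply/qclass_eq; exact: qclass_repr.
apply/qclass_eq; rewrite -/f' -/g'.
have -> : f' * g' - f * g = 1 *: ((f' - f) * g') + f * (g' - g).
  by rewrite scale1r mulrBl mulrBr addrA subrK.
by apply: (hi_P HJ); [exact: hi_Mr HJ _ _ Jf | exact: hi_Ml HJ _ _ Jg].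
Qed.
Definition qone := qclass 1.
Fact qmulA : associative qmul.
Proof.
elim/qclassW => f; elim/qclassW => g; elim/qclassW => h.
by rewrite !qmulE mulrA.
Qed.
Fact qmul1l : left_id qone qmul.
Proof. by elim/qclassW => f; rewrite qmulE mul1r. Qed.
Fact qmul1r : right_id qone qmul.
Proof. by elim/qclassW => f; rewrite qmulE mulr1. Qed.
Fact qmulDl : left_distributive qmul +%R.
Proof.
elim/qclassW => f; elim/qclassW => g; elim/qclassW => h.
by rewrite -qclassD !qmulE mulrDl qclassD.
Qed.
Fact qmulDr : right_distributive qmul +%R.
Proof.
elim/qclassW => f; elim/qclassW => g; elim/qclassW => h.
by rewrite -qclassD !qmulE mulrDr qclassD.
Qed.
Fact qone_neq0 : qone != 0.
Proof.
apply/eqP => /qclass0 /(gi_aug HJ); rewrite /free_aug free_eval1 => /eqP.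
by rewrite oner_eq0.
Qed.
HB.instance Definition _ := GRing.Zmodule_isNzRing.Build qalg_sort
  qmulA qmul1l qmul1r qmulDl qmulDr qone_neq0.
Lemma qclassM f g : qclass (f * g) = qclass f * qclass g. Proof. exact/esym/qmulE. Qed.
Fact qscaleAl (c : K) (p q : qalg_sort) : c *: (p * q) = (c *: p) * q.
Proof.
by elim/qclassW: p => f; elim/qclassW: q => g; rewrite -qclassM -!qclassZ -qclassM scalerAl.
Qed.
HB.instance Definition _ := GRing.Lmodule_isLalgebra.Build K qalg_sort qscaleAl.
Fact qscaleAr (c : K) (p q : qalg_sort) : c *: (p * q) = p * (c *: q).
Proof.
by elim/qclassW: p => f; elim/qclassW: q => g; rewrite -qclassM -!qclassZ -qclassM scalerAr.
Qed.
HB.instance Definition _ := GRing.Lalgebra_isAlgebra.Build K qalg_sort qscaleAr.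

Fact qproj0 i f : f \in ideal -> (qclass \o wproj i) f = 0.
Proof. by move=> /asboolP Jf; apply/qclass0; exact: hi_gr HJ _ _ Jf. Qed.
Definition qproj i : qalg_sort -> qalg_sort := qlift (@qproj0 i).
Fact qproj_linear i : linear (qproj i). Proof. exact: qlift_linear. Qed.
HB.instance Definition _ i :=
  GRing.isLinear.Build K qalg_sort qalg_sort *:%R (qproj i) (qproj_linear i).
Lemma qprojE i f : qproj i (qclass f) = qclass (wproj i f).
Proof. by apply: qliftE; exact: qproj0. Qed.
Fact qprojD q : qproj false q + qproj true q = q.
Proof. by elim/qclassW: q => f; rewrite !qprojE -qclassD wprojD. Qed.
Fact qprojK i j q : qproj i (qproj j q) = if i == j then qproj j q else 0.
Proof.
elim/qclassW: q => f; rewrite !qprojE wprojK; case: ifP => // _.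
exact: linear0.
Qed.
Definition qgrading : z2grading qalg_sort := @Z2Grading K qalg_sort qproj qprojD qprojK.
Lemma qclass_homog i (q : qalg_sort) : homog qgrading i q ->
  exists2 f, homog (free_gr parity Fw) i f & q = qclass f.
Proof.
elim/qclassW: q => f; rewrite /homog -[qgrading i _]/(qproj i _) qprojE => <-.
by exists (wproj i f) => //; rewrite /homog /= wprojK eqxx.
Qed.
Fact qone_homog : homog qgrading false 1.
Proof. by rewrite /homog -[LHS]/(qproj _ (qclass 1)) qprojE [wproj false 1]free_one_homog. Qed.
Fact qmul_homog i j (p q : qalg_sort) : homog qgrading i p -> homog qgrading j q ->
  homog qgrading (i (+) j) (p * q).
Proof.
move=> /qclass_homog[f fi ->] /qclass_homog[g gj ->].
by rewrite -qclassM /homog -[LHS]/(qproj _ _) qprojE [wproj _ _](wproj_mul fi gj).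
Qed.
Fact qcomm i j (p q : qalg_sort) : homog qgrading i p -> homog qgrading j q ->
  p * q = (-1) ^+ (i && j) *: (q * p).
Proof.
move=> /qclass_homog[f fi ->] /qclass_homog[g gj ->].
by rewrite -!qclassM -qclassZ; apply/qclass_eq; exact: gi_comm HJ _ _ _ _ fi gj.
Qed.
Fact qaug0 f : f \in ideal -> (free_aug f : K^o) = 0.
Proof. by move=> /asboolP /(gi_aug HJ). Qed.
Definition qaug : qalg_sort -> K^o := qlift (f := free_aug : {linear F -> K^o}) qaug0.
Fact qaug_linear : linear qaug. Proof. exact: qlift_linear. Qed.
HB.instance Definition _ := GRing.isLinear.Build K qalg_sort K^o *:%R qaug qaug_linear.
Lemma qaugE f : qaug (qclass f) = free_aug f.
Proof. by apply: qliftE; exact: qaug0. Qed.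
Fact qaug_monoid : monoid_morphism qaug.
Proof.
split=> [|p q]; first by rewrite -[qaug 1]/(qaug (qclass 1)) qaugE;
  exact: (free_eval1 Fw (fun _ => 0 : ground_aug K)).
elim/qclassW: p => f; elim/qclassW: q => g; rewrite -qclassM !qaugE.
exact: (free_evalM Fw (fun _ => 0 : ground_aug K)).
Qed.
HB.instance Definition _ := GRing.isMonoidMorphism.Build qalg_sort K^o qaug qaug_monoid.
Fact qaug_odd q : homog qgrading true q -> qaug q = 0.
Proof.
move=> /qclass_homog[f f1 ->]; rewrite qaugE -[f]f1.
exact: etrans (free_eval_gr Fw (@free_aug_homog _ _ parity) true f) _.
Qed.
Definition qalg : augAlg K :=
  @AugAlg K qalg_sort qgrading qone_homog qmul_homog qcomm qaug qaug_odd.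

Definition qmap (f : F) : qalg := qclass f.
Fact qmap_linear : linear qmap. Proof. exact: qclass_linear. Qed.
HB.instance Definition _ := GRing.isLinear.Build K F qalg *:%R qmap qmap_linear.
Lemma qmapM f g : qmap (f * g) = qmap f * qmap g. Proof. exact: qclassM. Qed.
Lemma qmap1 : qmap 1 = 1. Proof. by []. Qed.
Lemma qmap_gr i f : qmap (wproj i f) = aa_gr qalg i (qmap f).
Proof. exact/esym/qprojE. Qed.
Lemma qmap_aug f : aug (qmap f) = free_aug f. Proof. exact: qaugE. Qed.
Lemma qmap0 f : J f <-> qmap f = 0. Proof. exact: qclass0. Qed.
Lemma qmap_surj (q : qalg) : exists f, qmap f = q.
Proof. by exists (qrepr (q : qalg_sort)); exact: qclass_repr. Qed.

Section Desc.
Variables (B : augAlg K) (g : {linear F -> B}).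
Hypothesis g0 : forall f, J f -> g f = 0.
Hypothesis gM : forall a b, g (a * b) = g a * g b.
Hypothesis g1 : g 1 = 1.
Hypothesis g_gr : forall i f, g (wproj i f) = aa_gr B i (g f).
Hypothesis g_aug : forall f, aug (g f) = free_aug f.

Fact desc0 f : f \in ideal -> g f = 0.
Proof. by move=> /asboolP /g0. Qed.
Definition desc_fun : qalg -> B := qlift desc0.
Fact desc_linear : linear desc_fun. Proof. exact: qlift_linear. Qed.
HB.instance Definition _ := GRing.isLinear.Build K qalg B *:%R desc_fun desc_linear.
Lemma desc_funE f : desc_fun (qmap f) = g f.
Proof. by apply: qliftE; exact: desc0. Qed.
Fact desc_monoid : monoid_morphism desc_fun.
Proof.
split=> [|p q]; first by rewrite -qmap1 desc_funE g1.
have [a <-] := qmap_surj p; have [b <-] := qmap_surj q.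
by rewrite -qmapM !desc_funE gM.
Qed.
HB.instance Definition _ := GRing.isMonoidMorphism.Build qalg B desc_fun desc_monoid.
Fact desc_even i q : desc_fun (aa_gr qalg i q) = aa_gr B i (desc_fun q).
Proof. by have [f <-] := qmap_surj q; rewrite -qmap_gr !desc_funE g_gr. Qed.
Fact desc_aug q : aug (desc_fun q) = aug q.
Proof. by have [f <-] := qmap_surj q; rewrite desc_funE g_aug qmap_aug. Qed.
Definition desc : aug_mor qalg B :=
  @AugMor K qalg B desc_fun desc_even desc_aug.
Lemma descE f : desc (qmap f) = g f.
Proof. exact: desc_funE. Qed.
End Desc.

End Quotient.

(** * The algebra of gauge-fixed deformations *)

Section BrEval.
Variables (K : fieldType) (L : filtLie K) (L_fin : fl_finite_type L).
Local Notation C := (cdual L).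

Lemma br_eval_map n (xi : C) (E E' : lalgType K) (P : bool -> E -> E) (P' : bool -> E' -> E')
    (psi : {linear E -> E'}) (a b : C -> E) (a' b' : C -> E') :
  (forall f g, psi (f * g) = psi f * psi g) ->
  (forall k f, psi (P k f) = P' k (psi f)) ->
  (forall e, psi (a e) = a' e) -> (forall e, psi (b e) = b' e) ->
  psi (br_eval L_fin n xi P a b) = br_eval L_fin n xi P' a' b'.
Proof.
move=> psiM psiP psia psib; rewrite /br_eval.
do 4!(rewrite linear_sum; apply: eq_bigr => ? _).
by rewrite 2!linearZ psiM psiP psia psib.
Qed.

(** Over the ground field with coefficients those of d, the formula computes
    [d, d]: frames expand d up to the n-th step, on which xi vanishes. *)
Lemma br_eval_ground n (xi : C) (d : L) : kills n xi ->
  br_eval L_fin n xi (fun k (c : ground_aug K) => aa_gr (ground_aug K) k c)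
    (fun e : C => e d : K^o) (fun e : C => e d : K^o) = xi (gl_br L d d).
Proof.
move=> H; pose e := fr_vec (fr L_fin n); pose c i : K := fr_dual (fr L_fin n) i d.
pose d' := \sum_i c i *: e i.
have xiD x y : xi (x + y) = xi x + xi y by exact: linearD.
have dd' : d - d' \in fl_filt L n by exact: fr_sum.
have -> : xi (gl_br L d d) = xi (gl_br L d' d').
  have -> : gl_br L d d = gl_br L (d - d') d + gl_br L d' (d - d') + gl_br L d' d'.
    by rewrite linearBl linearBr addrA subrK subrK.
  have H1 : xi (gl_br L (d - d') d) = 0.
    by apply: H; have := fl_filt_br dd' (fl_filt0 d); rewrite addn0.
  have H2 : xi (gl_br L d' (d - d')) = 0.
    by apply: H; exact: (fl_filt_br (fl_filt0 d') dd').
  by rewrite !xiD H1 H2 !add0r.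
have -> : gl_br L d' d' = \sum_i \sum_j (c i * c j) *: gl_br L (e i) (e j).
  rewrite {1}/d' linear_sumlz; apply: eq_bigr => i _.
  rewrite /d' linear_sumr; apply: eq_bigr => j _.
  by rewrite linearZl_LR linearZr_LR /= scalerA.
rewrite linear_sum; apply: eq_bigr => i _; rewrite linear_sum; apply: eq_bigr => j _.
rewrite linearZ -[gl_br L (e i) (e j)](_ : gl_br L (e i) (gl_gr L false (e j))
  + gl_br L (e i) (gl_gr L true (e j)) = _); last by rewrite -linearDr z2projD.
rewrite !big_bool /= /ground_proj !mul0r !scaler0 !add0r !scale1r linearD /=.
by rewrite -scalerDl addrC [RHS]mulrC.
Qed.

End BrEval.

Section Universal.
Variables (K : fieldType) (L : filtLie K) (L_fin : fl_finite_type L).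
Variables (d : L) (dd0 : gl_br L d d = 0).
Local Notation C := (cdual L).
Variable h : {linear C -> C}.
Local Notation X := (C * bool)%type.
Variables (F : algType K) (w : seq X -> F) (Fw : is_free_algebra w).
(** The letter (xi, i) stands for the coefficient of an odd element at the part of
    parity i of xi; oddness of the element shifts its parity. *)
Definition letter_parity (x : X) := ~~ x.2.
Local Notation wproj := (wproj letter_parity Fw).
Local Notation free_aug := (free_aug Fw).

Definition letter (xi : C) i := w [:: (xi, i)].
Definition generic_delta xi := letter xi false + letter xi true.
Definition generic_d (xi : C) := (xi d : K) *: 1 + generic_delta xi.

(** In turn: the coefficients depend linearly on the functional and respect
    parity; the algebra is graded-commutative; the base part delta satisfies
    D h delta = 0; and d + delta satisfies [d + delta, d + delta] = 0. *)
Inductive defining_rel : F -> Prop :=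
| rel_lin a xi eta i :
    defining_rel (letter (a *: xi + eta) i - (a *: letter xi i + letter eta i))
| rel_gr i j xi : defining_rel (letter (cgr j xi) i - (if i == j then letter xi i else 0))
| rel_comm i j f g :
    homog (free_gr letter_parity Fw) i f -> homog (free_gr letter_parity Fw) j g ->
    defining_rel (f * g - (-1) ^+ (i && j) *: (g * f))
| rel_gauge xi : defining_rel (generic_delta (h (dstar d xi)))
| rel_mc n (xi : C) :
    kills n xi -> defining_rel (br_eval L_fin n xi (fun k f => wproj k f) generic_d generic_d).

(** The smallest homogeneous ideal containing the relations and the (n+1)-st power
    of the augmentation ideal, as an intersection. *)
Definition univ_ideal n (f : F) : Prop :=
  forall S : F -> Prop, homog_ideal letter_parity Fw S ->
  (forall r, defining_rel r -> S r) -> (forall r, free_pow Fw n.+1 r -> S r) -> S f.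

Lemma univ_ideal_rel n r : defining_rel r -> univ_ideal n r.
Proof. by move=> rr S _ H _; exact: H. Qed.
Lemma univ_ideal_pow n r : free_pow Fw n.+1 r -> univ_ideal n r.
Proof. by move=> rr S _ _ H; exact: H. Qed.
Lemma univ_ideal_homog n : homog_ideal letter_parity Fw (univ_ideal n).
Proof.
split.
- by move=> S SI _ _; exact: hi_0 SI.
- by move=> a f g Jf Jg S SI Sr Sp; apply: (hi_P SI); [exact: Jf|exact: Jg].
- by move=> f g Jg S SI Sr Sp; apply: (hi_Ml SI); exact: Jg.
- by move=> f g Jg S SI Sr Sp; apply: (hi_Mr SI); exact: Jg.
by move=> i f Jf S SI Sr Sp; apply: (hi_gr SI); exact: Jf.
Qed.

Section Solution.
Variables (E : augAlg K) (phi : {linear C -> E}).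
Hypothesis phi_odd : forall xi i, homog (aa_gr E) (~~ i) (phi (cgr i xi)).
Hypothesis phi_gauge : forall xi, phi (h (dstar d xi)) = 0.
Definition codiff_of (xi : C) : E := (xi d : K) *: 1 + phi xi.
Hypothesis phi_mc : forall n (xi : C), kills n xi ->
  br_eval L_fin n xi (fun k (a : E) => aa_gr E k a) codiff_of codiff_of = 0.

Definition sol_eval : {linear F -> E} := free_eval Fw (fun x : X => phi (cgr x.2 x.1)).

Lemma sol_eval_letter xi i : sol_eval (letter xi i) = phi (cgr i xi).
Proof. exact: free_eval_letter. Qed.
Lemma sol_eval_delta xi : sol_eval (generic_delta xi) = phi xi.
Proof. by rewrite linearD !sol_eval_letter -linearD cgrD. Qed.
Lemma sol_eval_d xi : sol_eval (generic_d xi) = codiff_of xi.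
Proof. by rewrite linearP sol_eval_delta [sol_eval 1]free_eval1. Qed.
Lemma sol_eval_gr i f : sol_eval (wproj i f) = aa_gr E i (sol_eval f).
Proof. by apply: free_eval_gr => x; exact: phi_odd. Qed.
Lemma sol_evalM f g : sol_eval (f * g) = sol_eval f * sol_eval g.
Proof. exact: free_evalM. Qed.

(** A gauge-fixed solution with coefficients in E is the same as an evaluation of
    the letters in E that satisfies the relations. *)
Lemma sol_eval_rel r : defining_rel r -> sol_eval r = 0.
Proof.
case=> [a xi eta i|i j xi|i j f g fi gj|xi|n xi H].
- by rewrite linearB linearP !sol_eval_letter [cgr i (_ + _)]linearP
    [phi (_ + _)]linearP subrr.
- rewrite linearB !sol_eval_letter cgrK; case: eqP => [->|_].
    by rewrite sol_eval_letter subrr.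
  by rewrite (linear0 phi) (linear0 sol_eval) subrr.
- rewrite linearB sol_evalM [sol_eval (_ *: _)]linearZ sol_evalM.
  have fi' : homog (aa_gr E) i (sol_eval f) by apply: free_eval_homog fi => x; exact: phi_odd.
  have gj' : homog (aa_gr E) j (sol_eval g) by apply: free_eval_homog gj => x; exact: phi_odd.
  by rewrite (aa_comm fi' gj') subrr.
- by rewrite sol_eval_delta phi_gauge.
apply: etrans (phi_mc H).
exact: (br_eval_map L_fin n xi sol_evalM sol_eval_gr sol_eval_d sol_eval_d).
Qed.
End Solution.

(** The augmentation is the evaluation at the solution delta = 0 over the ground
    field, which exists because [d, d] = 0. *)
Lemma free_aug_rel r : defining_rel r -> free_aug r = 0.
Proof.
move=> rr; pose phi : {linear C -> ground_aug K} := \0.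
have <- : aug (sol_eval phi r) = free_aug r by apply: free_eval_aug => x; exact: aug0.
rewrite sol_eval_rel //.
- by move=> xi i; rewrite /homog linear0.
move=> n xi H.
have := br_eval_ground L_fin d H; rewrite dd0 linear0 => E.
apply: etrans E; apply: (@br_eval_map _ _ _ n xi _ _ _ _ idfun) => // e.
- by rewrite /codiff_of /= addr0; exact: mulr1.
- by rewrite /codiff_of /= addr0; exact: mulr1.
Qed.

Lemma univ_ideal_graded n : graded_ideal letter_parity Fw (univ_ideal n).
Proof.
split; first exact: univ_ideal_homog; last first.
  by move=> i j f g fi gj; apply: univ_ideal_rel; exact: rel_comm.
move=> f Jf; apply: (Jf (fun f => free_aug f = 0)).
- apply: ker_homog_ideal; first exact: free_evalM.
  by apply: free_eval_gr; exact: free_aug_homog.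
- exact: free_aug_rel.
exact: free_pow_aug.
Qed.

Definition univ_lev n : augAlg K := qalg (univ_ideal_graded n).
Definition univ_class n : {linear F -> univ_lev n} := qmap (univ_ideal_graded n).

Lemma univ_class0 n f : univ_ideal n f <-> univ_class n f = 0. Proof. exact: qmap0. Qed.
Lemma univ_classM n f g : univ_class n (f * g) = univ_class n f * univ_class n g.
Proof. exact: qmapM. Qed.
Lemma univ_class1 n : univ_class n 1 = 1. Proof. exact: qmap1. Qed.
Lemma univ_class_gr n i f : univ_class n (wproj i f) = aa_gr (univ_lev n) i (univ_class n f).
Proof. exact: qmap_gr. Qed.
Lemma univ_class_aug n f : aug (univ_class n f) = free_aug f. Proof. exact: qmap_aug. Qed.
Lemma univ_class_surj n q : exists f, univ_class n f = q. Proof. exact: qmap_surj. Qed.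

Lemma univ_idealS n f : univ_ideal n.+1 f -> univ_ideal n f.
Proof.
move=> Jf; apply: Jf; [exact: univ_ideal_homog | exact: univ_ideal_rel |].
by move=> r rp; apply: univ_ideal_pow; exact: free_powW rp.
Qed.

Definition univ_tr n : aug_mor (univ_lev n.+1) (univ_lev n) :=
  @desc _ _ _ _ _ _ _ (univ_ideal_graded n.+1) (univ_lev n) (univ_class n)
    (fun f Jf => (univ_class0 n f).1 (univ_idealS Jf))
    (@univ_classM n) (univ_class1 n) (@univ_class_gr n) (@univ_class_aug n).
Lemma univ_trE n f : univ_tr n (univ_class n.+1 f) = univ_class n f.
Proof. exact: descE. Qed.

Lemma univ_class_pow n k f : free_pow Fw k f -> aug_pow k (univ_class n f).
Proof.
elim: k f => // k IH f [s [sP ->]].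
exists [seq (univ_class n xy.1, univ_class n xy.2) | xy <- s]; split.
  by move=> _ /mapP[xy /sP[x0 y0] ->]; split; [rewrite univ_class_aug | exact: IH].
by rewrite big_map linear_sum; apply: eq_bigr => xy _; exact: univ_classM.
Qed.

Lemma free_powD k f g : free_pow Fw k f -> free_pow Fw k g -> free_pow Fw k (f + g).
Proof.
case: k => // k [s [sP ->]] [t [tP ->]]; exists (s ++ t); rewrite big_cat; split=> // xy.
by rewrite mem_cat => /orP[/sP|/tP].
Qed.

Lemma univ_class_pow_lift n k (q : univ_lev n) :
  aug_pow k q -> exists2 f, free_pow Fw k f & univ_class n f = q.
Proof.
elim: k q => [|k IH] q; first by move=> _; have [f <-] := univ_class_surj q; exists f.
move=> [s [sP ->]]; rewrite big_seq; elim/big_rec: _ => [|xy x /sP[x0 y0] [a am <-]].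
  by exists 0; [exists [::]; rewrite big_nil | exact: linear0].
have [u uE] := univ_class_surj xy.1; have [v vm vE] := IH _ y0.
exists (u * v + a); last by rewrite linearD univ_classM uE vE.
apply: free_powD => //; exists [:: (u, v)]; rewrite big_seq1; split=> // z.
by rewrite inE => /eqP -> /=; rewrite -(univ_class_aug n) uE.
Qed.

Fact univ_lev0 (a : univ_lev 0) : aug a = 0 -> a = 0.
Proof.
have [f <-] := univ_class_surj a; rewrite univ_class_aug => f0.
apply/univ_class0; apply: univ_ideal_pow.
exists [:: (f, 1)]; split=> [z|]; last by rewrite big_seq1 mulr1.
by rewrite inE => /eqP ->; split; first exact: f0.
Qed.
Fact univ_tr_surj n (b : univ_lev n) : exists a, univ_tr n a = b.
Proof. by have [f <-] := univ_class_surj b; exists (univ_class n.+1 f); exact: univ_trE. Qed.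
(** From left to right, by minimality of univ_ideal n: the elements whose class at
    the next level is in the (n+1)-st power form a homogeneous ideal that contains
    its generators. *)
Fact univ_tr_ker n (a : univ_lev n.+1) : univ_tr n a = 0 <-> aug_pow n.+1 a.
Proof.
split.
  have [f <-] := univ_class_surj a; rewrite univ_trE => /univ_class0 Jf.
  apply: (Jf (fun f => aug_pow n.+1 (univ_class n.+1 f))).
  - split.
    + by rewrite linear0; exact: aug_pow0.
    + by move=> c u v Ju Jv; rewrite linearP; apply: aug_powD => //; exact: aug_powZ.
    + by move=> u v Jv; rewrite univ_classM; exact: aug_powMl.
    + by move=> u v Jv; rewrite univ_classM; exact: aug_powMr.
    by move=> i u Ju; rewrite univ_class_gr; exact: aug_pow_gr.
  - move=> r rr; have /univ_class0 -> : univ_ideal n.+1 r by exact: univ_ideal_rel.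
    exact: aug_pow0.
  exact: univ_class_pow.
move=> /univ_class_pow_lift[f fp <-]; rewrite univ_trE.
by apply/univ_class0; apply: univ_ideal_pow.
Qed.

(** It represents the functor of gauge-fixed formal deformations. *)
Definition univ : formalAlg K := FormalAlg univ_lev0 univ_tr_surj univ_tr_ker.

Fact plim_subproof f n : fa_tr_lin univ n (univ_class n.+1 f) = univ_class n f.
Proof. exact: univ_trE. Qed.
(** The image of the free algebra in the limit, which is dense: at each level the
    classes of the free algebra are everything. *)
Definition plim (f : F) : flim univ := InvLim (plim_subproof f).
Fact plim_linear : linear plim.
Proof. by move=> a f g; apply: invlim_eq => n; exact: linearP. Qed.
HB.instance Definition _ := GRing.isLinear.Build K F (flim univ) *:%R plim plim_linear.
Lemma plimL a f g : plim (a *: f + g) = a *: plim f + plim g.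
Proof. exact: linearP. Qed.
Lemma plimD f g : plim (f + g) = plim f + plim g.
Proof. exact: linearD. Qed.
Lemma plim0 : plim 0 = 0.
Proof. exact: linear0. Qed.
Lemma plimM f g : plim (f * g) = plim f * plim g.
Proof. by apply: invlim_eq => n; exact: univ_classM. Qed.
Lemma plim1 : plim 1 = 1.
Proof. by apply: invlim_eq => n; exact: univ_class1. Qed.
Lemma plim_gr i f : plim (wproj i f) = aa_gr (flim univ) i (plim f).
Proof. by apply: invlim_eq => n; exact: univ_class_gr. Qed.
Lemma plim_aug f : aug (plim f) = free_aug f. Proof. exact: univ_class_aug. Qed.
Lemma plim_rel r : defining_rel r -> plim r = 0.
Proof. by move=> rr; apply: invlim_eq => n; apply/univ_class0; exact: univ_ideal_rel. Qed.

End Universal.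

(** * The universal gauge-fixed deformation *)

Lemma aug_pow_lev (K : fieldType) (A : formalAlg K) k n (a : flim A) :
  aug_pow k a -> aug_pow k (flev n a).
Proof.
elim: k a => // k IH a [s [sP ->]].
exists [seq (flev n xy.1, flev n xy.2) | xy <- s]; split.
  by move=> _ /mapP[xy /sP[x0 y0] ->]; split; [rewrite aug_lev | exact: IH].
by rewrite big_map linear_sum; apply: eq_bigr => xy _; exact: rmorphM.
Qed.

Section FormalMor.
Variables (K : fieldType) (A B : formalAlg K) (f : formal_mor A B).
Lemma fmL c (a b : flim A) : f (c *: a + b) = c *: f a + f b.
Proof. exact: linearP. Qed.
Lemma fmB (a b : flim A) : f (a - b) = f a - f b. Proof. exact: linearB. Qed.
Lemma fm0 : f 0 = 0. Proof. exact: linear0. Qed.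
Lemma fmM (a b : flim A) : f (a * b) = f a * f b. Proof. exact: rmorphM. Qed.
Lemma fm1 : f 1 = 1. Proof. exact: rmorph1. Qed.
End FormalMor.

Section UniversalDeformation.
Variables (K : fieldType) (L : filtLie K) (L_fin : fl_finite_type L).
Variables (d : L) (d_odd : homog (gl_gr L) true d) (dd0 : gl_br L d d = 0).
Local Notation C := (cdual L).
Variable h : {linear C -> C}.
Local Notation X := (C * bool)%type.
Variables (F : algType K) (w : seq X -> F) (Fw : is_free_algebra w).

Local Notation defining_rel := (defining_rel L_fin d h Fw).
Local Notation U := (univ L_fin dd0 h Fw).
Local Notation plim := (plim L_fin dd0 h Fw).
Local Notation generic_delta := (generic_delta w).
Local Notation generic_d := (generic_d d w).
Local Notation letter_parity := (letter_parity (L := L)).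

Definition univ_delta_fun (xi : C) : flim U := plim (generic_delta xi).

Lemma plim_eq f g : defining_rel (f - g) -> plim f = plim g.
Proof. by move=> /(plim_rel dd0); rewrite linearB => /eqP; rewrite subr_eq0 => /eqP. Qed.

Fact univ_delta_linear : linear univ_delta_fun.
Proof.
move=> a xi eta; rewrite /univ_delta_fun /generic_delta !plimD.
rewrite !(plim_eq (rel_lin _ _ _ _ a xi eta _)) !plimL.
by rewrite scalerDr addrACA.
Qed.
Definition univ_delta : {linear C -> flim U} :=
  HB.pack univ_delta_fun
    (GRing.isLinear.Build K C (flim U) *:%R univ_delta_fun univ_delta_linear).

(** The deformation whose coefficients are the letters. *)
Definition univ_def : LA L U := LA_incl U d + LA_of L_fin univ_delta.

Lemma pairing_delta xi : pairing xi (univ_def - LA_incl U d) = plim (generic_delta xi).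
Proof. by rewrite /univ_def addrC addKr pairing_of. Qed.

Lemma pairing_univ (xi : C) : pairing xi univ_def = plim (generic_d xi).
Proof.
rewrite -(subrK (LA_incl U d) univ_def) linearD /= pairing_delta addrC plimL.
by rewrite pairing_incl plim1.
Qed.

Lemma plim_delta_gr i (xi : C) : plim (generic_delta (cgr i xi)) = plim (letter w xi i).
Proof.
rewrite plimD !(plim_eq (rel_gr _ _ _ _ _ _ _)).
by case: i; rewrite /= plim0 ?addr0 ?add0r.
Qed.

Lemma univ_def_homog : LA_homog true univ_def.
Proof.
apply: LA_homogD; first exact: LA_incl_homog.
apply/(LA_homogP L_fin) => xi i; rewrite pairing_of /homog /=.
rewrite /univ_delta_fun plim_delta_gr -plim_gr wproj_word /=.
by rewrite /letter_parity /= addbF eqxx.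
Qed.

Lemma univ_def_deformation : formal_deformation d univ_def.
Proof.
split; first exact: univ_def_homog.
  apply/(LA_m_pairing L_fin) => xi; rewrite pairing_delta plim_aug linearD /= !free_eval_letter.
  exact: addr0.
apply: (LA_inj L_fin) => xi; have [n H] := cd_kills xi.
rewrite (pairing_br L_fin _ _ H) linear0.
apply: etrans (plim_rel dd0 (rel_mc L_fin d h Fw H)); apply: esym.
apply: br_eval_map => [f g|k f|e|e]; [exact: plimM | exact: plim_gr | |];
  exact/esym/pairing_univ.
Qed.

Section Classify.
Variables (B : formalAlg K) (t : LA L B).
Hypothesis t_odd : LA_homog true t.
Hypothesis t_mc : LA_br t t = 0.
Hypothesis t_m : LAord 1 (t - LA_incl B d).
Hypothesis t_gauge : LA_br (LA_incl B d) (LA_h L_fin h (t - LA_incl B d)) = 0.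

Definition delta_of : {linear C -> flim B} := pairing_map (t - LA_incl B d).

Lemma delta_of_odd (xi : C) i : homog (aa_gr (flim B)) (~~ i) (delta_of (cgr i xi)).
Proof.
apply: (LA_homog_pairing (i := true)); apply: LA_homogB => //; exact: LA_incl_homog.
Qed.
Lemma delta_of_gauge xi : delta_of (h (dstar d xi)) = 0.
Proof. by rewrite /= /pairing_map -(pairing_h L_fin) -pairing_D t_gauge linear0. Qed.
Lemma delta_of_d (xi : C) : codiff_of d delta_of xi = pairing xi t.
Proof.
rewrite /codiff_of /= /pairing_map -[in RHS](subrK (LA_incl B d) t) [RHS]linearD /= addrC.
by rewrite pairing_incl.
Qed.
Lemma delta_of_mc n (xi : C) : kills n xi ->
  br_eval L_fin n xi (fun k (a : flim B) => aa_gr (flim B) k a)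
    (codiff_of d delta_of) (codiff_of d delta_of) = 0.
Proof.
move=> H; have := pairing_br L_fin t t H; rewrite t_mc linear0 => E.
apply: etrans (esym E).
by apply: (@br_eval_map _ _ _ n xi _ _ _ _ idfun) => // e; exact: delta_of_d.
Qed.

Definition free_classify : {linear F -> flim B} := sol_eval Fw delta_of.
Lemma free_classifyM f g : free_classify (f * g) = free_classify f * free_classify g.
Proof. exact: sol_evalM. Qed.
Lemma free_classify1 : free_classify 1 = 1. Proof. exact: free_eval1. Qed.
Lemma free_classify_gr i f :
  free_classify (wproj letter_parity Fw i f) = aa_gr (flim B) i (free_classify f).
Proof. exact: (sol_eval_gr Fw delta_of_odd). Qed.
Lemma free_classify_aug f : aug (free_classify f) = free_aug Fw f.
Proof. by apply: free_eval_aug => x; apply/ford1; exact: t_m. Qed.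

Definition free_classify_lev n : {linear F -> B n} := @flev K B n \o free_classify.
Lemma free_classify_lev0 n f : univ_ideal L_fin d h Fw n f -> free_classify_lev n f = 0.
Proof.
move=> Jf; apply: (Jf (fun f => free_classify_lev n f = 0)).
- apply: ker_homog_ideal => [a b|i a]; first by rewrite /= free_classifyM.
  by rewrite /= free_classify_gr.
- move=> r rr; rewrite /= (sol_eval_rel delta_of_odd delta_of_gauge delta_of_mc rr).
  exact: linear0.
move=> r rp; apply: aug_pow_top.
have : aug_pow n.+1 (free_classify r) by apply: free_eval_pow rp => x; apply/ford1; exact: t_m.
exact: aug_pow_lev.
Qed.

Definition classify_lev n : aug_mor (U n) (B n) :=
  @desc _ _ _ _ _ _ _ (univ_ideal_graded L_fin dd0 h Fw n) (B n)
    (free_classify_lev n) (@free_classify_lev0 n)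
    (fun a b => etrans (congr1 (@flev K B n) (free_classifyM a b)) erefl)
    (congr1 (@flev K B n) free_classify1)
    (fun i f => congr1 (@flev K B n) (free_classify_gr i f))
    (fun f => etrans (aug_lev n (free_classify f)) (free_classify_aug f)).
Lemma classify_levE n f :
  classify_lev n (univ_class L_fin dd0 h Fw n f) = flev n (free_classify f).
Proof. exact: descE. Qed.

Fact classify_subproof (a : flim U) n :
  fa_tr_lin B n (classify_lev n.+1 (flev n.+1 a)) = classify_lev n (flev n a).
Proof.
rewrite -(flev_tr n a); have [f <-] := univ_class_surj (flev n.+1 a).
rewrite [fa_tr U n _]univ_trE !classify_levE; exact: flev_tr.
Qed.
Definition classify_fun (a : flim U) : flim B := InvLim (classify_subproof a).
Fact classify_linear : linear classify_fun.
Proof. by move=> c a b; apply: invlim_eq => n; exact: (linearP (classify_lev n)). Qed.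
Fact classify_monoid : monoid_morphism classify_fun.
Proof.
split=> [|a b]; apply: invlim_eq => n; first exact: (rmorph1 (classify_lev n)).
exact: (rmorphM (classify_lev n)).
Qed.
HB.instance Definition _ :=
  GRing.isLinear.Build K (flim U) (flim B) *:%R classify_fun classify_linear.
HB.instance Definition _ :=
  GRing.isMonoidMorphism.Build (flim U) (flim B) classify_fun classify_monoid.
Fact classify_even i a : classify_fun (aa_gr (flim U) i a) = aa_gr (flim B) i (classify_fun a).
Proof. by apply: invlim_eq => n; exact: (am_even (classify_lev n)). Qed.
Fact classify_aug a : aug (classify_fun a) = aug a.
Proof. exact: (am_aug (classify_lev 0)). Qed.
Definition classify_am : aug_mor (flim U) (flim B) :=
  @AugMor K (flim U) (flim B) classify_fun classify_even classify_aug.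
Fact classify_cont k : exists n, forall a : flim U, flev n a = 0 -> flev k (classify_am a) = 0.
Proof.
exists k => a a0; rewrite -[LHS]/(classify_lev k (flev k a)) a0.
exact: (linear0 (classify_lev k)).
Qed.
(** The morphism from the universal base that evaluates the letters at the
    coefficients of a gauge-fixed deformation. *)
Definition classify : formal_mor U B := FormalMor classify_cont.

Lemma classify_plim f : classify (plim f) = free_classify f.
Proof. by apply: invlim_eq => n; exact: classify_levE. Qed.

Lemma fpush_classify : fpush classify univ_def = t.
Proof.
apply: (LA_inj L_fin) => xi.
rewrite pairing_fpush pairing_univ classify_plim -delta_of_d.
exact: sol_eval_d.
Qed.
End Classify.

Lemma fpush_deformation (B : formalAlg K) (f : formal_mor U B) :
  LAord 1 (fpush f univ_def - LA_incl B d) /\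
  LA_br (LA_incl B d) (LA_h L_fin h (fpush f univ_def - LA_incl B d)) = 0.
Proof.
have E (xi : C) : pairing xi (fpush f univ_def - LA_incl B d) = f (plim (generic_delta xi)).
  rewrite linearB /= pairing_fpush pairing_univ pairing_incl plimL plim1 fmL fm1.
  exact: etrans (addrC _ _) (addKr _ _).
split=> [xi|].
  apply/ford1; rewrite E am_aug plim_aug linearD /= !free_eval_letter; exact: addr0.
apply: (LA_inj L_fin) => xi.
rewrite pairing_D pairing_h E linear0 (plim_rel dd0 (rel_gauge _ _ _ _ xi)); exact: linear0.
Qed.

(** The coefficients of the universal deformation generate a dense subalgebra of
    its base, so a continuous morphism is determined by the image of the
    deformation. *)
Lemma fpush_inj (B : formalAlg K) (f g : formal_mor U B) :
  fpush f univ_def = fpush g univ_def -> forall a : flim U, f a = g a.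
Proof.
move=> fg.
have letter_eq (xi : C) i : f (plim (letter w xi i)) = g (plim (letter w xi i)).
  have := congr1 (pairing (cgr i xi)) fg.
  rewrite !pairing_fpush !pairing_univ !plimL plim1 !fmL !fm1.
  by move/addrI; rewrite plim_delta_gr.
have word_eq s : f (plim (w s)) = g (plim (w s)).
  elim: s => [|[xi i] s IH]; first by rewrite (free_nil Fw) plim1 !fm1.
  by rewrite -cat1s (free_cat Fw) plimM !fmM IH letter_eq.
have plim_fg u : f (plim u) = g (plim u).
  elim/(free_ind Fw): u => [|c s u IH]; first by rewrite !plim0 !fm0.
  by rewrite !plimL !fmL word_eq IH.
move=> a; apply: flimP => k.
have [n nP] := fm_cont f k; have [m mP] := fm_cont g k.
have [u uE] := univ_class_surj (flev (maxn n m) a).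
have a0 : flev (maxn n m) (a - plim u) = 0.
  by rewrite linearB /= -uE; exact: subrr.
have /nP fa0 := flev0_le (leq_maxl n m) a0.
have /mP ga0 := flev0_le (leq_maxr n m) a0.
move: fa0 ga0; rewrite !fmB !linearB /= plim_fg => /eqP.
by rewrite subr_eq0 => /eqP -> /eqP; rewrite subr_eq0 => /eqP ->.
Qed.

End UniversalDeformation.

(** * Infinitesimal bases and miniversality *)

Section Infinitesimal.
Variables (K : fieldType) (L : filtLie K) (L_fin : fl_finite_type L).
Variables (B : formalAlg K) (B_inf : infinitesimal B).
Local Notation LA := (LA L B).

Lemma LA_m_ord (t : LA) : LA_m t <-> LAord 1 t.
Proof.
split=> [/(LA_m_pairing L_fin) tm xi|t1]; first exact/ford1.
by apply/(LA_m_pairing L_fin) => xi; apply/ford1; exact: t1.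
Qed.

Lemma inf_br0 (u v : LA) : LAord 1 u -> LAord 1 v -> LA_br u v = 0.
Proof.
move=> u1 v1; apply: (LA_inj L_fin) => xi; have [n H] := cd_kills xi.
rewrite linear0 (pairing_br L_fin _ _ H) /br_eval.
do 4!(apply: big1 => ? _).
rewrite [_ * _]B_inf ?scaler0 //; last by apply/ford1; exact: v1.
by apply/aug_gr/ford1; exact: u1.
Qed.

(** With square-zero maximal ideal only the first-order term of the exponential
    survives, and in it only the bracket of l with d. *)
Lemma inf_exp (d : L) (l t s : LA) : LA_homog false l -> LAord 1 l ->
  LAord 1 (t - LA_incl B d) -> exp_ad l t s -> s = t - LA_br (LA_incl B d) l.
Proof.
move=> l0 l1 td ets.
have br1 u : LAord 1 (LA_br l u).
  by have := LAord_br L_fin l1 (LAord0 u).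
have trunc m : exp_trunc l m.+2 t = t + LA_br l t.
  rewrite /exp_trunc !big_ord_recl /= dpow0 big1 ?addr0 => [|i _].
    by rewrite /dpow /= invr1 scale1r.
  by rewrite /dpow !iterS (inf_br0 l1 (br1 _)) scaler0.
have -> : s = t + LA_br l t.
  apply: LA_eq => k n; have [N NP] := ets k n.
  by rewrite -(NP N.+2) ?(leq_trans (leqnSn N)) // -(trunc N).
have -> : LA_br l t = LA_br l (LA_incl B d).
  by rewrite -[in LHS](subrK (LA_incl B d) t) linearD /= (inf_br0 l1 td) add0r.
by rewrite (LA_anti _ l0).
Qed.
End Infinitesimal.

Theorem theorem7p1 (K : fieldType) (charK0 : [pchar K] =i pred0)
    (L : filtLie K) (L_complete : fl_complete L) (L_fin : fl_finite_type L)
    (d : L) (d_codiff : codifferential d) :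
  exists (A : formalAlg K) (dtilde : LA L A), miniversal d dtilde.
Proof.
have [d_odd dd0] := d_codiff.
have [h [hD h_gr]] := homotopy_exists d_odd.
have [F [w Fw]] := free_algebra_exists K (cdual L * bool)%type.
exists (univ L_fin dd0 h Fw), (univ_def L_fin dd0 h Fw); split.
- exact: univ_def_deformation.
- move=> B s [s_odd /(LA_m_ord L_fin) s1 ss].
  have [l [t [l0 l1 lst t_gauge]]] := gauge_fixing L_fin d_odd hD h_gr s_odd s1.
  have t_odd := is_exp_homog L_fin l0 s_odd lst.
  have t_mc := is_exp_br0 charK0 L_fin l0 l1 lst ss.
  have t1 : LAord 1 (t - LA_incl B d).
    apply: LAord_trans s1; have := lst 1%N.
    by rewrite /exp_trunc big_ord1 dpow0.
  exists (classify d_odd dd0 Fw t_odd t_mc t1 t_gauge); exists (- l); split.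
  + exact: LA_homogN.
  + by apply/(LA_m_ord L_fin); exact: LAordN.
  rewrite fpush_classify; apply: (is_exp_exp_ad L_fin).
  exact: (is_exp_inv charK0 L_fin l1 lst).
move=> B s B_inf _ f g [l [l0 /(LA_m_ord L_fin) l1 fE]] [m [m0 /(LA_m_ord L_fin) m1 gE]].
apply: fpush_inj.
have [f1 f_gauge] := fpush_deformation f.
have [g1 g_gauge] := fpush_deformation g.
set tf := fpush f _ in fE f1 f_gauge *; set tg := fpush g _ in gE g1 g_gauge *.
have := inf_exp L_fin B_inf l0 l1 f1 fE; rewrite (inf_exp L_fin B_inf m0 m1 g1 gE) => E.
have {}E : tf - tg = LA_br (LA_incl B d) (l - m).
  have -> : tf = tg + (LA_br (LA_incl B d) l - LA_br (LA_incl B d) m).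
    by rewrite -[LHS](subrK (LA_br (LA_incl B d) l)) -E -addrA [- _ + _]addrC.
  by rewrite addrC addKr linearB.
(* D h kills the difference of two gauge-fixed deformations *)
apply/eqP; rewrite -subr_eq0 E -(DhD L_fin hD) -E.
have -> : tf - tg = (tf - LA_incl B d) - (tg - LA_incl B d) by rewrite opprB addrA subrK.
move: (tf - _) (tg - _) f_gauge g_gauge {f1 g1 E} => a b a0 b0.
by rewrite [LA_h L_fin h (a - b)]linearB linearB /= a0 b0 subrr.
Qed.
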